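(* Let $D$ be a central division algebra over $F=k((t))$ with $\operatorname{char}D=p>0$ such that $Z(\bar D)=\bar D$ and $[Z(\bar D):\bar F]=p$. Then $D$ is a splittable algebra, and the local height $i=i(u,z)$ (in the situation when it is defined, i.e. when $\alpha=\mathrm{id}$) does not depend on the embedding $u$ and the parameter $z$. $D$ is a good splittable algebra if $(i,p)=1$. If $p\mid i$, then there exists a parameter $z$ such that $z^p\in Z(D)$, and any ''unramified'' maximal subfield of $D$ is cyclic Galois over $F$. So, in both cases $D$ is a cyclic division algebra of degree $p$.
   Context: Let $k$ be a field, $F=k((t))$; $D$ is a division algebra finite dimensional over its centre $Z(D)=F$. The $t$-adic valuation extends uniquely to a valuation $w$ on $D$, normalized so that its value group $\Gamma_D$ is $\mathbb Z$. $V_D$, $M_D$, $\bar D=V_D/M_D$ denote valuation ring, maximal ideal and residue division ring (similarly for $F$). A parameter of $D$ is an element $z$ with $w(z)=1$. An embedding $u:\bar D\hookrightarrow D$ is a ring homomorphism $\bar D\to V_D$ that is a section of the residue map; $D$ is splittable if an embedding exists, and good splittable if there exists an embedding $u$ with $u(\overline{Z(D)})\subset Z(D)$. The automorphism $\alpha={}^{(z)}\alpha$ of $\bar D$ is the one induced by conjugation by $z$: $\bar a\mapsto\overline{zaz^{-1}}$ (here $\bar D$ is commutative, so $\alpha$ does not depend on $z$). When $\alpha=\mathrm{id}$ the local height is $i(u,z)=\min_{a\in\bar D}w(zu(a)z^{-1}-u(a))$. A subfield $E\supseteq F$ of $D$ is called ''unramified'' over $F$ if $[\bar E:\bar F]=[E:F]$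 (no separability of $\bar E/\bar F$ is required). *)

(* Defs.v *)
From HB Require Import structures.
From mathcomp Require Import all_boot all_order all_algebra all_fingroup.
From mathcomp Require Import all_solvable all_field generic_quotient ring_quotient.
From mathcomp Require Import mathcomp_extra boolp.

Set Implicit Arguments.
Unset Strict Implicit.
Unset Printing Implicit Defensive.
Import Order.TTheory GRing.Theory Num.Theory.
Local Open Scope ring_scope.
Local Open Scope quotient_scope.

(* Coefficient functions; [f n] is the coefficient of t^n.  The ring product is
   the Cauchy product, not the pointwise one. *)
Definition powser (k : fieldType) : Type := nat -> k.

HB.instance Definition _ (k : fieldType) := gen_eqMixin (powser k).
HB.instance Definition _ (k : fieldType) := gen_choiceMixin (powser k).

Section PowerSeries.
Variable k : fieldType.
Implicit Types f g h : powser k.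

Definition ps_zero : powser k := fun=> 0.
Definition ps_opp f : powser k := fun n => - f n.
Definition ps_add f g : powser k := fun n => f n + g n.
Definition ps_one : powser k := fun n => (n == 0%N)%:R.
Definition ps_mul f g : powser k := fun n => \sum_(i < n.+1) f i * g (n - i)%N.

Lemma ps_addA : associative ps_add.
Proof. by move=> f g h; apply: funext => n; apply: addrA. Qed.
Lemma ps_addC : commutative ps_add.
Proof. by move=> f g; apply: funext => n; apply: addrC. Qed.
Lemma ps_add0 : left_id ps_zero ps_add.
Proof. by move=> f; apply: funext => n; apply: add0r. Qed.
Lemma ps_addN : left_inverse ps_zero ps_opp ps_add.
Proof. by move=> f; apply: funext => n; apply: addNr. Qed.

HB.instance Definition _ :=
  GRing.isZmodule.Build (powser k) ps_addA ps_addC ps_add0 ps_addN.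

Let trunc n f : {poly k} := \poly_(i < n.+1) f i.

Let trunc_mul n f g m : (m <= n)%N -> (trunc n f * trunc n g)`_m = ps_mul f g m.
Proof.
move=> mn; rewrite coefM; apply: eq_bigr => -[i /=]; rewrite ltnS => im _.
rewrite !coef_poly !ltnS (leq_trans im mn).
by rewrite (leq_trans (leq_subr _ _) mn).
Qed.

Lemma ps_mulA : associative ps_mul.
Proof.
move=> f g h; apply: funext => n.
transitivity ((trunc n f * (trunc n g * trunc n h))`_n).
  rewrite coefM; apply: eq_bigr => -[i /= im] _.
  by rewrite trunc_mul ?leq_subr // coef_poly im.
rewrite mulrA coefM; apply: eq_bigr => -[i /= im] _.
by rewrite trunc_mul // coef_poly ltnS leq_subr.
Qed.

Lemma ps_mulC : commutative ps_mul.
Proof.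
by move=> f g; apply: funext => n; rewrite -!(@trunc_mul n) // mulrC.
Qed.

Lemma ps_mul1 : left_id ps_one ps_mul.
Proof.
move=> f; apply: funext => n; rewrite /ps_mul big_ord_recl /= subn0 mul1r.
by rewrite big1 ?addr0 // => i _; rewrite mul0r.
Qed.

Lemma ps_mulDl : left_distributive ps_mul ps_add.
Proof.
move=> f g h; apply: funext => n.
by rewrite /ps_mul /ps_add -big_split; apply: eq_bigr => i _; rewrite mulrDl.
Qed.

Lemma ps_one_neq0 : ps_one != ps_zero.
Proof.
by apply/eqP => /(congr1 (fun f => f 0%N)) /eqP; rewrite /ps_one oner_eq0.
Qed.

HB.instance Definition _ := GRing.Zmodule_isComNzRing.Build (powser k)
  ps_mulA ps_mulC ps_mul1 ps_mulDl ps_one_neq0.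

Definition ps_unit : pred (powser k) := fun f => `[< exists g, g * f = 1 >].
Definition ps_inv f : powser k :=
  if pselect (exists g, g * f = 1) is left h then projT1 (cid h) else f.

Lemma ps_mulV : {in ps_unit, left_inverse 1 ps_inv *%R}.
Proof.
move=> f /asboolP h; rewrite /ps_inv; case: pselect => // h'.
exact: (projT2 (cid h')).
Qed.

Lemma ps_unitP f g : g * f = 1 -> ps_unit f.
Proof. by move=> h; apply/asboolP; exists g. Qed.

Lemma ps_inv_out : {in [predC ps_unit], ps_inv =1 id}.
Proof. by move=> f /asboolP h; rewrite /ps_inv; case: pselect. Qed.

HB.instance Definition _ := GRing.ComNzRing_hasMulInverse.Build (powser k)
  ps_mulV ps_unitP ps_inv_out.

Lemma ps_neq0P f : f != 0 -> exists n, f n != 0.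
Proof.
move=> f0; apply/not_existsP => h; case/eqP: f0; apply: funext => n.
by apply/eqP/negPn/negP; apply: h.
Qed.

(* t-adic order: the least n with f n != 0 (junk value 0 at f = 0). *)
Definition ps_order f : nat :=
  if pselect (exists n, f n != 0) is left h then ex_minn h else 0.

Lemma ps_orderP f : f != 0 ->
  f (ps_order f) != 0 /\ forall n, (n < ps_order f)%N -> f n = 0.
Proof.
move=> /ps_neq0P h; rewrite /ps_order; case: pselect => // h'.
case: ex_minnP => m fm hm; split=> // n nm.
by apply/eqP/negPn/negP => /hm; rewrite leqNgt nm.
Qed.

Lemma ps_orderE f n : f n != 0 -> (forall m, (m < n)%N -> f m = 0) ->
  ps_order f = n.
Proof.
move=> fn hn; have f0 : f != 0 by apply: contra_neq fn => ->.
have [h1 h2] := ps_orderP f0.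
case: (ltngtP (ps_order f) n) => // [/hn|/h2] E.
  by rewrite E eqxx in h1.
by rewrite E eqxx in fn.
Qed.

Lemma ps_mul_lead f g : f != 0 -> g != 0 ->
  (f * g) (ps_order f + ps_order g)%N = f (ps_order f) * g (ps_order g)
  /\ forall m, (m < ps_order f + ps_order g)%N -> (f * g) m = 0.
Proof.
move=> /ps_orderP [_ hf] /ps_orderP [_ hg].
set a := ps_order f in hf *; set b := ps_order g in hg *.
have h0 m i : (m <= a + b)%N -> (i < m.+1)%N ->
    ~~ ((m == a + b)%N && (i == a)) -> f i * g (m - i)%N = 0.
  move=> mle im ne; case: (ltnP i a) => [/hf ->|fi].
    by rewrite mul0r.
  have mlt : (m < i + b)%N.
    rewrite ltn_neqAle (leq_trans mle) ?leq_add2r // andbT.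
    apply: contra ne => /eqP E; move: mle; rewrite E leq_add2r => ilf.
    have -> : i = a by apply/eqP; rewrite eqn_leq fi ilf.
    by rewrite !eqxx.
  by rewrite hg ?mulr0 // ltn_subLR.
split=> [|m mlt]; last first.
  apply: big1 => -[i /= im] _; apply: h0 => //; first exact: ltnW.
  by rewrite (ltn_eqF mlt).
have lt : (a < (a + b).+1)%N by rewrite ltnS leq_addr.
transitivity (\sum_(i < (a + b).+1) f i * g (a + b - i)%N) => //.
rewrite (bigD1 (Ordinal lt)) //= addKn big1 ?addr0 // => -[i /= im] ne.
by apply: h0 => //; rewrite eqxx.
Qed.

Lemma ps_mulf_eq0 f g : f * g = 0 -> (f == 0) || (g == 0).
Proof.
move=> fg0; apply/orP; have [|f0] := eqVneq f 0; first by left.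
have [|g0] := eqVneq g 0; first by right.
have [] := ps_mul_lead f0 g0; rewrite fg0 => /esym /eqP.
rewrite mulf_eq0 => /orP [] /eqP E _.
  by case: (ps_orderP f0); rewrite E eqxx.
by case: (ps_orderP g0); rewrite E eqxx.
Qed.

HB.instance Definition _ :=
  GRing.ComUnitRing_isIntegral.Build (powser k) ps_mulf_eq0.

Lemma ps_orderM f g : f != 0 -> g != 0 ->
  ps_order (f * g) = (ps_order f + ps_order g)%N.
Proof.
move=> f0 g0; have [h1 h2] := ps_mul_lead f0 g0.
apply: ps_orderE => //; rewrite h1 mulf_neq0 //.
  by case: (ps_orderP f0).
by case: (ps_orderP g0).
Qed.

End PowerSeries.

Notation laurent k := {fraction (powser k)}.

Section TAdic.
Variable k : fieldType.

(* ord(f) - ord(g) for the fraction f / g; junk value at 0. *)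
Definition tval (x : laurent k) : int :=
  (ps_order \n_(repr x))%:Z - (ps_order \d_(repr x))%:Z.

Lemma tval_div (f g : powser k) : f != 0 -> g != 0 ->
  tval (FracField.tofrac f / FracField.tofrac g)
  = (ps_order f)%:Z - (ps_order g)%:Z.
Proof.
move=> f0 g0; rewrite /tval; set x := _ / _.
have d0 : \d_(repr x) != 0 by exact: denom_ratioP.
have F (a : powser k) : FracField.tofrac a
    = \pi_(laurent k) (Ratio a 1) by rewrite piE.
have xE : x = \pi_(laurent k) (Ratio f g).
  have gg : FracField.tofrac g != 0 :> laurent k by rewrite tofrac_eq0.
  apply: (mulIf gg); rewrite /x divfK // !F -[RHS]FracField.pi_mul.
  apply/eqmodP => /=; rewrite FracField.equivfE /FracField.mulf.
  by rewrite !numden_Ratio ?mulr1 ?mul1r ?oner_neq0 // mulrC.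
have /eqP E : \n_(repr x) * g == \d_(repr x) * f.
  have := FracField.equivf_def (repr x) (Ratio f g).
  by rewrite reprK xE eqxx !numden_Ratio // => <-.
have n0 : \n_(repr x) != 0.
  apply/eqP => n0; move/eqP: E.
  by rewrite n0 mul0r eq_sym mulf_eq0 (negPf d0) (negPf f0).
have := congr1 (@ps_order k) E; rewrite !ps_orderM // => EE.
apply/eqP; rewrite subr_eq addrAC eq_sym subr_eq -!PoszD eqz_nat.
by rewrite addnC -EE.
Qed.

End TAdic.

(* The value +oo of a valuation at 0 is not represented: [w 0] is arbitrary and
   every use of [w x] is guarded by [x != 0]. *)
Record valuation (D : nzRingType) := Valuation {
  val_fun :> D -> int;
  valM : forall x y, x != 0 -> y != 0 -> val_fun (x * y) = val_fun x + val_fun y;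
  valD : forall x y, x != 0 -> y != 0 -> x + y != 0 ->
    Num.min (val_fun x) (val_fun y) <= val_fun (x + y) }.

Section Residue.
Variables (D : nzRingType) (w : valuation D).

Lemma val1 : w 1 = 0.
Proof.
have := @valM D w 1 1 (oner_neq0 D) (oner_neq0 D); rewrite mulr1 => /eqP.
by rewrite -subr_eq subrr => /eqP.
Qed.

Lemma valN x : x != 0 -> w (- x) = w x.
Proof.
move=> x0; have N0 : (- 1 : D) != 0 by rewrite oppr_eq0 oner_neq0.
have : w (-1) *+ 2 = 0.
  by have := valM w N0 N0; rewrite mulrNN mulr1 val1 mulr2n.
move/eqP; rewrite mulrn_eq0 /= -[- x]mulN1r (valM w N0 x0) => /eqP ->.
by rewrite add0r.
Qed.

Definition valuation_ring : {pred D} := fun x => (x == 0) || (0 <= w x).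

Lemma valuation_ring_closed : subring_closed valuation_ring.
Proof.
split; rewrite /valuation_ring.
- by apply/orP; right; rewrite val1.
- move=> x y; rewrite !unfold_in.
  have [->|x0] := eqVneq x 0; have [->|y0] /= := eqVneq y 0;
    rewrite ?subr0 ?sub0r ?oppr_eq0 ?eqxx ?(negPf x0) ?(negPf y0) //= ?valN //.
  move=> hx hy; have [//|xy0] /= := eqVneq (x - y) 0.
  have Ny0 : - y != 0 by rewrite oppr_eq0.
  by apply: (le_trans _ (valD w x0 Ny0 xy0)); rewrite le_min hx valN.
- move=> x y; rewrite !unfold_in.
  have [->|x0] := eqVneq x 0; have [->|y0] /= := eqVneq y 0;
    rewrite ?mul0r ?mulr0 ?eqxx //= => hx hy.
  by rewrite valM // addr_ge0 ?orbT.
Qed.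

HB.instance Definition _ :=
  GRing.isSubringClosed.Build D valuation_ring valuation_ring_closed.

Record vring := VRing { vring_val :> D; _ : vring_val \in valuation_ring }.
HB.instance Definition _ := [isSub for vring_val].
HB.instance Definition _ := [Choice of vring by <:].
HB.instance Definition _ := [SubChoice_isSubNzRing of vring by <:].

Definition max_ideal : {pred vring} :=
  fun x => (val x == 0) || (0 < w (val x)).

Lemma max_ideal_closed : zmod_closed max_ideal.
Proof.
split=> [|[x ?] [y ?]]; first by rewrite unfold_in raddf0 eqxx.
rewrite !unfold_in /=.
have [->|x0] := eqVneq x 0; have [->|y0] /= := eqVneq y 0;
  rewrite ?subr0 ?sub0r ?oppr_eq0 ?eqxx ?(negPf x0) ?(negPf y0) //= ?valN //.
move=> hx hy; have [//|xy0] /= := eqVneq (x - y) 0.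
have Ny0 : - y != 0 by rewrite oppr_eq0.
by apply: (lt_le_trans _ (valD w x0 Ny0 xy0)); rewrite lt_min hx valN.
Qed.

HB.instance Definition _ :=
  GRing.isZmodClosed.Build vring max_ideal max_ideal_closed.

Lemma max_idealMl x y : y \in max_ideal -> x * y \in max_ideal.
Proof.
case: x y => [x hx] [y hy]; rewrite !unfold_in /=.
move: hx; rewrite unfold_in.
have [->|x0] := eqVneq x 0; have [->|y0] /= := eqVneq y 0;
  rewrite ?mul0r ?mulr0 ?eqxx //= => hx' hy'.
by rewrite valM // ltr_wpDl ?orbT.
Qed.

Lemma max_idealMr x y : x \in max_ideal -> x * y \in max_ideal.
Proof.
case: x y => [x hx] [y hy]; rewrite !unfold_in /=.
move: hy; rewrite unfold_in.
have [->|x0] := eqVneq x 0; have [->|y0] /= := eqVneq y 0;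
  rewrite ?mul0r ?mulr0 ?eqxx //= => hx' hy'.
by rewrite valM // ltr_wpDr ?orbT.
Qed.

Definition residue_ring : Type := Quotient.quot max_ideal.
HB.instance Definition _ := Choice.on residue_ring.
HB.instance Definition _ := GRing.Zmodule.on residue_ring.

Definition residue (x : vring) : residue_ring := \pi_(Quotient.quot max_ideal) x.
Definition res_repr (x : residue_ring) : vring :=
  repr (x : Quotient.quot max_ideal).

Lemma res_reprK : cancel res_repr residue.
Proof. exact: reprK. Qed.

Lemma residue_eq x y : residue x = residue y <-> x - y \in max_ideal.
Proof.
rewrite Quotient.idealrBE; split; first by move=> E; apply/eqP.
by move/eqP.
Qed.

Lemma residueB : zmod_morphism residue.
Proof. move=> x y; exact: (raddfB (\pi_(Quotient.quot max_ideal))). Qed.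

Definition res_mul (x y : residue_ring) : residue_ring :=
  residue (res_repr x * res_repr y).

Lemma residue_mul x y : residue (x * y) = res_mul (residue x) (residue y).
Proof.
apply/residue_eq; set x' := res_repr _; set y' := res_repr _.
have xx : x - x' \in max_ideal by apply/residue_eq; rewrite res_reprK.
have yy : y - y' \in max_ideal by apply/residue_eq; rewrite res_reprK.
have -> : x * y - x' * y' = (x - x') * y + x' * (y - y').
  by rewrite mulrBl mulrBr addrA subrK.
by apply: rpredD; [exact: max_idealMr | exact: max_idealMl].
Qed.

Lemma res_mulA : associative res_mul.
Proof.
move=> x y z; rewrite -[x]res_reprK -[y]res_reprK -[z]res_reprK.
by rewrite -!residue_mul mulrA.
Qed.

Lemma res_mul1 : left_id (residue 1) res_mul.
Proof. by move=> x; rewrite -[x]res_reprK -residue_mul mul1r. Qed.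

Lemma res_1mul : right_id (residue 1) res_mul.
Proof. by move=> x; rewrite -[x]res_reprK -residue_mul mulr1. Qed.

Lemma residueD x y : residue (x + y) = residue x + residue y.
Proof. exact: (raddfD (\pi_(Quotient.quot max_ideal))). Qed.

Lemma res_mulDl : left_distributive res_mul +%R.
Proof.
move=> x y z; rewrite -[x]res_reprK -[y]res_reprK -[z]res_reprK.
by rewrite -residueD -!residue_mul mulrDl residueD.
Qed.

Lemma res_mulDr : right_distributive res_mul +%R.
Proof.
move=> x y z; rewrite -[x]res_reprK -[y]res_reprK -[z]res_reprK.
by rewrite -residueD -!residue_mul mulrDr residueD.
Qed.

Lemma res_one_neq0 : residue 1 != 0.
Proof.
have <- : residue 0 = 0 by exact: (raddf0 (\pi_(Quotient.quot max_ideal))).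
apply/eqP => /residue_eq; rewrite subr0 unfold_in /=.
by rewrite oner_eq0 val1 ltxx.
Qed.

HB.instance Definition _ := GRing.Zmodule_isNzRing.Build residue_ring
  res_mulA res_mul1 res_1mul res_mulDl res_mulDr res_one_neq0.

HB.instance Definition _ :=
  GRing.isZmodMorphism.Build vring residue_ring residue residueB.

Lemma residue_monoid_morphism : monoid_morphism residue.
Proof. by split=> [//|x y]; rewrite residue_mul. Qed.

HB.instance Definition _ :=
  GRing.isMonoidMorphism.Build vring residue_ring residue residue_monoid_morphism.

End Residue.

(* [B : A] = n, for B seen as a left A-vector space. *)
Definition has_degree (R : nzRingType) (A B : R -> Prop) (n : nat) : Prop :=
  exists b : 'I_n -> R, (forall i, B (b i)) /\
    forall x, B x -> exists! c : 'I_n -> R,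
      (forall i, A (c i)) /\ x = \sum_i c i * b i.

Definition ring_center (R : nzRingType) (x : R) : Prop :=
  forall y, GRing.comm x y.

Definition division_ring (R : unitRingType) : Prop :=
  forall x : R, x != 0 -> x \is a GRing.unit.

Section DivisionAlgebra.
Variables (F : fieldType) (D : falgType F) (w : valuation D).

(* The residue ring of a subset S of D (typically a subfield), as a subset of
   the residue ring of D. *)
Definition residue_of (S : {pred D}) (x : residue_ring w) : Prop :=
  exists2 a : vring w, val a \in S & residue a = x.

Definition parameter (z : D) : Prop := z != 0 /\ w z = 1.

Definition embedding (u : {rmorphism residue_ring w -> vring w}) : Prop :=
  cancel u (@residue D w).

Definition splittable : Prop := exists u, embedding u.

Definition good_splittable : Prop :=
  exists2 u, embedding u &
    forall x, residue_of 'Z({:D})%VS x -> val (u x) \in 'Z({:D})%VS.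

(* The map induced on the residue ring by a |-> z a z^-1; the default value of
   [insubd] is never used when z is nonzero (see [conj_residueE]). *)
Definition conj_residue (z : D) (x : residue_ring w) : residue_ring w :=
  residue (insubd 0 (z * val (res_repr x) * z^-1)).

Lemma val_conj (z a : D) : division_ring D -> z != 0 -> a != 0 ->
  z * a * z^-1 != 0 /\ w (z * a * z^-1) = w a.
Proof.
move=> divD z0 a0; have Uz := divD _ z0.
have iz0 : z^-1 != 0 by rewrite invr_eq0.
have mul_neq0 (x y : D) : x != 0 -> y != 0 -> x * y != 0.
  by move=> /divD Ux; apply: contra => /eqP E; rewrite -[y](mulKr Ux) E mulr0.
split; first by rewrite !mul_neq0.
rewrite !valM ?mul_neq0 // addrAC -valM // divrr //.
by rewrite val1 add0r.
Qed.

Lemma conj_residueE (z : D) (a b : vring w) : division_ring D -> z != 0 ->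
  val b = z * val a * z^-1 -> conj_residue z (residue a) = residue b.
Proof.
move=> divD z0 vb; rewrite /conj_residue; set a' := res_repr _.
have in_w (c : vring w) : z * val c * z^-1 \in valuation_ring w.
  have [->|c0] := eqVneq (val c) 0; first by rewrite mulr0 mul0r rpred0.
  have [h1 h2] := val_conj divD z0 c0.
  by have := valP c; rewrite !unfold_in (negPf c0) (negPf h1) h2.
have : a' - a \in max_ideal (w := w) by apply/residue_eq; rewrite res_reprK.
rewrite !unfold_in => H; apply/residue_eq; rewrite unfold_in.
have -> : val (insubd 0 (z * val a' * z^-1) - b : vring w)
    = z * (val (a' - a)) * z^-1.
  by rewrite !raddfB /= insubdK ?in_w // vb mulrBr mulrBl.
case/orP: H => [/eqP ->|]; first by rewrite mulr0 mul0r eqxx.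
have [->|d0 d1] := eqVneq (val (a' - a)) 0; first by rewrite mulr0 mul0r eqxx.
by have [_ ->] := val_conj divD z0 d0; rewrite d1 orbT.
Qed.

(* i = min over a of w (z u(a) z^-1 - u(a)); the a for which the difference
   vanishes contribute +oo. *)
Definition is_local_height (u : residue_ring w -> vring w) (z : D) (i : int) :
    Prop :=
  let d a := z * val (u a) * z^-1 - val (u a) in
  (exists a, d a != 0 /\ w (d a) = i) /\ (forall a, d a != 0 -> i <= w (d a)).

Definition is_subfield (E : {vspace D}) : Prop :=
  [/\ 1 \in E, {in E &, forall x y, x * y \in E}, {in E, forall x, x^-1 \in E}
    & {in E &, forall x y, x * y = y * x}].

Definition maximal_subfield (E : {vspace D}) : Prop :=
  is_subfield E /\ forall E', is_subfield E' -> (E <= E')%VS -> E' = E.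

(* "Unramified" over F: no separability of the residue extension is asked. *)
Definition unramified (E : {vspace D}) : Prop :=
  has_degree (residue_of 1%VS) (residue_of E) (\dim E).

Definition cyclic_galois (E : {vspace D}) : Prop :=
  exists (L : splittingFieldType F) (f : 'AHom(L, D)),
    [/\ (f @: fullv)%VS = E, galois 1%VS {:L} & cyclic 'Gal({:L} / 1%VS)].

(* A cyclic division algebra of degree n: dimension n^2 over the centre F, with
   a maximal subfield that is cyclic Galois over F. *)
Definition cyclic_division_algebra (n : nat) : Prop :=
  [/\ division_ring D, 'Z({:D})%VS = 1%VS, \dim {:D} = (n ^ 2)%N
    & exists2 E, maximal_subfield E & cyclic_galois E].

End DivisionAlgebra.

Arguments residue_of {F D} w S x.
Arguments parameter {F D} w z.
Arguments conj_residue {F D} w z x.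
Arguments splittable {F D} w.
Arguments good_splittable {F D} w.
Arguments cyclic_division_algebra {F} D n.

(* w is the extension of the t-adic valuation to D, rescaled so that its value
   group is the whole of Z; e is the ramification index. *)
Definition normalized_extension (k : fieldType) (D : falgType (laurent k))
    (w : valuation D) : Prop :=
  (forall n : int, exists2 x : D, x != 0 & w x = n) /\
  exists2 e : nat, (0 < e)%N &
    forall a : laurent k, a != 0 -> w a%:A = e%:Z * tval a.

(* Main.v *)
(* Filter D by the powers of its maximal ideal; as an F-space D is spanned by the
   x^j z^l with j < p and l < e, where x lifts a generator of the residue field,
   z is a parameter and e is the ramification index.  Artin-Whaples independence
   applied to F(x) and F(z) gives p^2 <= dim D <= pe and e^2 <= pe, so e = p and
   dim D = p^2.

   If alpha <> id, then alpha - 1 is nilpotent on the residue field (z^p / t is a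
   unit), which yields b with alpha(b) = b + 1, and b lifts to an Artin-Schreier
   element of D.

   If alpha = id, let i + 1 be the value of [z, x].  Then w([a, b]) >= w(a) + w(b) + i,
   commutators define a Poisson bracket on the graded ring, and i does not depend
   on the choices made.  The residue field is k(c^(1/p)); an embedding is a limit
   of lifts by polynomials in x whose coefficients lie in smaller and smaller
   subfields of k, each maximal among the subfields of the previous one that
   contain its p-th powers and avoid a given element.

   If p | i, successive approximation solves [z, x] = g z with g in F(x).
   Conjugation by z is then an automorphism of F(x), of order p because its n-th
   power moves x when p does not divide n, so z^p is central.  If i is prime
   to p, replacing x by x + y changes x^p by y^p + ad(x)^(p-1)(y) up to smaller
   terms (Jacobson), and y can be chosen to bring x^p ever closer to F.  In the
   limit ad(x)^p = 0, hence [x, h] = 1 for some h, and hx is an Artin-Schreier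
   element. *)

From HB Require Import structures.
From mathcomp Require Import all_boot all_order all_algebra all_fingroup.
From mathcomp Require Import all_solvable all_field generic_quotient.
From mathcomp Require Import mathcomp_extra boolp classical_sets.
From mathcomp Require Import ssrAC zify.
Require Import Defs.

Set Implicit Arguments.
Unset Strict Implicit.
Unset Printing Implicit Defensive.
Import Order.TTheory GRing.Theory Num.Theory.
Local Open Scope ring_scope.

(** The obstacle is that the residue extension may be inseparable, so Hensel's lemma does not lift
    it. If alpha = id, then x^p agrees with a constant c only modulo the maximal ideal, and a
    polynomial in x over k with zero residue need not be small in D. The shrinking coefficient
    fields make it small to any prescribed order, because the powers of c^(p^j) below the p-th stay
    independent over field number j + 1.

    The dichotomy on i comes from one formula. An element of value n is v z^n with v a unit, and
    bracketing it with x multiplies its leading form by n times a fixed form of degree i. Brackets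
    are therefore blind exactly in degrees divisible by p. If p divides i, those are the degrees
    reached by F(x), since e = p: what brackets cannot correct, F(x) can. If p does not divide i, an
    element commuting with x has value divisible by p, and p - 1 brackets starting p - 1 steps below
    such a value multiply by i, 2i, ..., (p-1)i, all nonzero modulo p; so ad(x)^(p-1) reaches every
    form that has to be removed. *)

Section CommutingAdditiveMaps.

(** * Binomial identities for sums of commuting additive maps *)

Variables (A : zmodType) (f g : A -> A).
Hypotheses (fD : {morph f : x y / x + y}) (gD : {morph g : x y / x + y}).
Hypothesis fgC : forall y, f (g y) = g (f y).

Let f0 : f 0 = 0.
Proof. by apply: (addIr (f 0)); rewrite -fD !add0r. Qed.
Let g0 : g 0 = 0.
Proof. by apply: (addIr (g 0)); rewrite -gD !add0r. Qed.
Let fMn y n : f (y *+ n) = f y *+ n.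
Proof. by elim: n => [|n IH]; rewrite ?mulr0n ?f0 // !mulrS fD IH. Qed.
Let gMn y n : g (y *+ n) = g y *+ n.
Proof. by elim: n => [|n IH]; rewrite ?mulr0n ?g0 // !mulrS gD IH. Qed.
Let fsum I (r : seq I) (P : pred I) F :
  f (\sum_(i <- r | P i) F i) = \sum_(i <- r | P i) f (F i).
Proof. exact: (big_morph f fD f0). Qed.
Let gsum I (r : seq I) (P : pred I) F :
  g (\sum_(i <- r | P i) F i) = \sum_(i <- r | P i) g (F i).
Proof. exact: (big_morph g gD g0). Qed.
Let iterC n y : g (iter n f y) = iter n f (g y).
Proof. by elim: n => //= n IH; rewrite -fgC IH. Qed.

(** The binomial theorem in the commutative ring generated by [f] and [g]. One use takes for [f] the
    commutator with x and for [g] right multiplication by x, whose sum is left multiplication by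
    x. *)
Lemma iter_addf n y : iter n (fun y => f y + g y) y =
  \sum_(i < n.+1) iter i f (iter (n - i) g y) *+ 'C(n, i).
Proof.
have recl m (G : nat -> A) :
    \sum_(i < m.+1) G i *+ 'C(m, i) = G 0%N + \sum_(i < m) G i.+1 *+ 'C(m, i.+1).
  by rewrite big_ord_recl bin0 mulr1n.
elim: n => [|n IH]; first by rewrite big_ord_recl big_ord0 addr0.
rewrite iterS IH (recl n.+1 (fun i => iter i f (iter (n.+1 - i) g y))).
pose F i := iter i f (iter (n.+1 - i) g y).
have Ef : f (\sum_(i < n.+1) iter i f (iter (n - i) g y) *+ 'C(n, i))
   = \sum_(i < n.+1) F i.+1 *+ 'C(n, i).
  by rewrite fsum; apply: eq_bigr => i _; rewrite fMn -iterS /F subSS.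
have Eg : g (\sum_(i < n.+1) iter i f (iter (n - i) g y) *+ 'C(n, i))
   = F 0%N + \sum_(i < n.+1) F i.+1 *+ 'C(n, i.+1).
  rewrite (recl n (fun i => iter i f (iter (n - i) g y))) gD !subn0; congr (_ + _).
  rewrite gsum [RHS]big_ord_recr /= bin_small // mulr0n addr0.
  by apply: eq_bigr => i _; rewrite gMn -fgC iterC /F subSn.
rewrite Ef Eg addrCA -big_split /=; congr (_ + _).
by apply: eq_bigr => i _; rewrite binS mulrnDr addrC /F.
Qed.

(** Formally both sides are ((f + g)^n - g^n) / f; as [f] need not be invertible, the identity is
    proved by induction with Pascal's rule. *)
Lemma sum_iter_addf n y :
  \sum_(i < n) iter i (fun y => f y + g y) (iter (n.-1 - i) g y) =
  \sum_(j < n) iter j f (iter (n.-1 - j) g y) *+ 'C(n, j.+1).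
Proof.
case: n => [|n] /=; first by rewrite !big_ord0.
elim: n => [|n IH].
  by rewrite !big_ord_recl !big_ord0 /= mulr1n.
have hC m x : iter m (fun y => f y + g y) (g x) = g (iter m (fun y => f y + g y) x).
  by elim: m => //= m ->; rewrite fgC gD.
rewrite big_ord_recr /= subnn /=.
have -> : f (iter n (fun y => f y + g y) y) + g (iter n (fun y => f y + g y) y)
   = iter n.+1 (fun y => f y + g y) y by [].
rewrite iter_addf.
have -> : \sum_(i < n.+1) iter i (fun y => f y + g y) (iter (n.+1 - i) g y)
    = g (\sum_(i < n.+1) iter i (fun y => f y + g y) (iter (n - i) g y)).
  rewrite gsum; apply: eq_bigr => i _; rewrite -hC -iterS subSn //.
  by rewrite -ltnS.
rewrite IH gsum.
have -> : \sum_(i < n.+1) g (iter i f (iter (n - i) g y) *+ 'C(n.+1, i.+1))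
  = \sum_(i < n.+2) iter i f (iter (n.+1 - i) g y) *+ 'C(n.+1, i.+1).
  rewrite [RHS]big_ord_recr /= [in RHS]bin_small // mulr0n addr0.
  apply: eq_bigr => i _; rewrite gMn iterC -iterS -subSn //.
  by rewrite -ltnS.
by rewrite -big_split; apply: eq_bigr => i _; rewrite /= -mulrnDr -binS.
Qed.

Variable p : nat.
Hypotheses (p_pr : prime p) (Ap : forall y : A, y *+ p = 0).

Lemma pchar_iter_addf y :
  iter p (fun y => f y + g y) y = iter p f y + iter p g y.
Proof.
rewrite iter_addf big_ord_recr /= binn mulr1n subnn /= addrC; congr (_ + _).
have := prime_gt0 p_pr; case: p p_pr Ap => // q q_pr Aq _.
rewrite big_ord_recl bin0 mulr1n big1 ?addr0 // => i _.
have /dvdnP [m ->] : (q.+1 %| 'C(q.+1, i.+1))%N.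
  by apply: prime_dvd_bin => //; case: i => i /=; lia.
by rewrite mulrnA Aq.
Qed.

Lemma pchar_sum_iter_addf y :
  \sum_(i < p) iter i (fun y => f y + g y) (iter (p.-1 - i) g y) =
  iter p.-1 f y.
Proof.
rewrite sum_iter_addf; have := prime_gt0 p_pr; case: p p_pr Ap => // q q_pr Aq _.
rewrite big_ord_recr /= subnn binn mulr1n big1 ?add0r // => i _.
have /dvdnP [m ->] : (q.+1 %| 'C(q.+1, i.+1))%N.
  by apply: prime_dvd_bin => //; case: i => i /=; lia.
by rewrite mulrnA Aq.
Qed.

End CommutingAdditiveMaps.

(** * Commutators in characteristic p *)

Definition adj (R : nzRingType) (x y : R) : R := x * y - y * x.

Section Commutators.
Variable R : nzRingType.
Implicit Types x y z : R.

Lemma adjDr x : {morph adj x : y z / y + z}.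
Proof. by move=> y z; rewrite /adj mulrDr mulrDl opprD addrACA. Qed.
Lemma adjDl y x z : adj (x + z) y = adj x y + adj z y.
Proof. by rewrite /adj mulrDr mulrDl opprD addrACA. Qed.
Lemma adjN x y : adj x (- y) = - adj x y.
Proof. by rewrite /adj mulrN mulNr opprB opprK addrC. Qed.
Lemma adjNl x y : adj (- x) y = - adj x y.
Proof. by rewrite /adj mulrN mulNr opprB opprK addrC. Qed.
Lemma adjB x y z : adj x (y - z) = adj x y - adj x z.
Proof. by rewrite adjDr adjN. Qed.
Lemma adjBl x y z : adj (x - z) y = adj x y - adj z y.
Proof. by rewrite adjDl adjNl. Qed.
Lemma adjC x y : adj x y = - adj y x.
Proof. by rewrite /adj opprB. Qed.
Lemma adj0 x : adj x 0 = 0.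
Proof. by rewrite /adj mulr0 mul0r subrr. Qed.
Lemma adjM x y z : adj x (y * z) = adj x y * z + y * adj x z.
Proof. by rewrite /adj mulrBl mulrBr !mulrA addrA subrK. Qed.
Lemma adjMl x y z : adj (y * z) x = y * adj z x + adj y x * z.
Proof. by rewrite adjC adjM opprD -mulNr -mulrN -!adjC addrC. Qed.
Lemma adjP x y : adj x y = 0 <-> GRing.comm x y.
Proof. by rewrite /adj; split=> [/eqP|->]; rewrite ?subrr // subr_eq0 => /eqP. Qed.
Lemma adj_sum x I (r : seq I) (P : pred I) F :
  adj x (\sum_(i <- r | P i) F i) = \sum_(i <- r | P i) adj x (F i).
Proof. exact: (big_morph _ (adjDr x) (adj0 x)). Qed.
Lemma adjX x n : adj x (x ^+ n) = 0.
Proof. by apply/adjP/commrX. Qed.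

Lemma iter_mull x n y : iter n (fun y => x * y) y = x ^+ n * y.
Proof. by elim: n => [|n IH]; rewrite ?mul1r //= IH exprS mulrA. Qed.
Lemma iter_mulr x n y : iter n (fun y => y * x) y = y * x ^+ n.
Proof. by elim: n => [|n IH]; rewrite ?mulr1 //= IH exprSr mulrA. Qed.

Variable p : nat.
Hypothesis Rp : p \in [pchar R].

Let mulrnp y : y *+ p = 0.
Proof. by rewrite -mulr_natr pcharf0 // mulr0. Qed.
Let p_pr : prime p := pcharf_prime Rp.
Let adjxC x y : adj x (y * x) = adj x y * x.
Proof. by rewrite adjM {2}/adj subrr mulr0 addr0. Qed.
Let mulxE x : (fun y => adj x y + y * x) = (fun y => x * y).
Proof. by apply: funext => y; rewrite /adj subrK. Qed.

(** Left multiplication by x is [adj x] plus right multiplication by x, and these two commute, so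
    its p-th iterate is the sum of their p-th iterates. *)
Lemma adj_pchar x y : adj (x ^+ p) y = iter p (adj x) y.
Proof.
have := @pchar_iter_addf R (adj x) (fun y => y * x) (adjDr x)
   (fun y z => mulrDl y z x) (adjxC x) p p_pr mulrnp y.
by rewrite mulxE iter_mull iter_mulr => E; rewrite /adj E addrK.
Qed.

(** The left side is the derivative of the p-th power at x in the direction y; it links (x + y)^p to
    ad(x)^(p-1)(y). *)
Lemma sum_mul_pchar x y :
  \sum_(i < p) x ^+ i * y * x ^+ (p.-1 - i) = iter p.-1 (adj x) y.
Proof.
rewrite -(@pchar_sum_iter_addf R (adj x) (fun y => y * x) (adjDr x)
   (fun y z => mulrDl y z x) (adjxC x) p p_pr mulrnp y).
by apply: eq_bigr => i _; rewrite mulxE iter_mull iter_mulr mulrA.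
Qed.

End Commutators.

(** * The filtration by powers of the maximal ideal, and the residue map *)

Section Filtration.
Variables (D : unitRingType) (w : valuation D).
Hypothesis divD : division_ring D.
Implicit Types x y z : D.

Lemma div_mulf_neq0 x y : x != 0 -> y != 0 -> x * y != 0.
Proof.
by move=> /divD Ux; apply: contra => /eqP E; rewrite -[y](mulKr Ux) E mulr0.
Qed.

Lemma div_expf_neq0 x n : x != 0 -> x ^+ n != 0.
Proof.
by move=> x0; elim: n => [|n IH]; rewrite ?oner_neq0 // exprS div_mulf_neq0.
Qed.

Lemma valV x : x != 0 -> w x^-1 = - w x.
Proof.
move=> x0; have Ux := divD x0; have i0 : x^-1 != 0 by rewrite invr_eq0.
by apply/eqP; rewrite -addr_eq0 -valM // mulVr // val1.
Qed.

Lemma valX x n : x != 0 -> w (x ^+ n) = w x *+ n.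
Proof.
move=> x0; elim: n => [|n IH]; first by rewrite expr0 val1.
by rewrite exprS valM ?div_expf_neq0 // IH mulrS.
Qed.

(* [x] lies in the n-th power of the maximal ideal; the guard covers the junk
   value [w 0]. *)
Definition vge (n : nat) x := (x == 0) || (n%:Z <= w x).

Lemma vn_0 n : vge n 0. Proof. by rewrite /vge eqxx. Qed.

Lemma vn_leq m n x : (m <= n)%N -> vge n x -> vge m x.
Proof.
rewrite /vge => mn /orP [-> //|h]; apply/orP; right; apply: le_trans h.
by rewrite lez_nat.
Qed.

Lemma vnN n x : vge n (- x) = vge n x.
Proof.
rewrite /vge oppr_eq0; have [//|x0] /= := eqVneq x 0.
by rewrite valN.
Qed.

Lemma vnD n x y : vge n x -> vge n y -> vge n (x + y).
Proof.
have [->|x0] := eqVneq x 0; first by rewrite add0r.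
have [->|y0] := eqVneq y 0; first by rewrite addr0.
have [->|xy0] := eqVneq (x + y) 0; first by rewrite vn_0.
rewrite /vge (negPf x0) (negPf y0) (negPf xy0) /= => hx hy.
by apply: le_trans (valD w x0 y0 xy0); rewrite le_min hx.
Qed.

Lemma vnB n x y : vge n x -> vge n y -> vge n (x - y).
Proof. by move=> hx hy; rewrite vnD ?vnN. Qed.

Lemma vnDl n x y : vge n x -> vge n (x + y) = vge n y.
Proof.
move=> hx; apply/idP/idP => [h|]; last exact: vnD.
by rewrite -[y](addKr x) vnD ?vnN.
Qed.

Lemma vnDr n x y : vge n y -> vge n (x + y) = vge n x.
Proof. by rewrite addrC; apply: vnDl. Qed.

Lemma vnBC n x y : vge n (x - y) = vge n (y - x).
Proof. by rewrite -vnN opprB. Qed.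

Lemma vn_trans y n x z : vge n (x - y) -> vge n (y - z) -> vge n (x - z).
Proof. by move=> h1 h2; rewrite -[x](subrK y) -addrA vnD. Qed.

Lemma vn_sum n I (r : seq I) (P : pred I) (F : I -> D) :
  (forall i, P i -> vge n (F i)) -> vge n (\sum_(i <- r | P i) F i).
Proof. by move=> h; elim/big_rec: _ => [|i x Pi]; [exact: vn_0 | apply: vnD; exact: h]. Qed.

Lemma vnMn n x m : vge n x -> vge n (x *+ m).
Proof. by move=> h; elim: m => [|m IH]; rewrite ?mulr0n ?vn_0 // mulrS vnD. Qed.

Lemma vnM m n x y : vge m x -> vge n y -> vge (m + n) (x * y).
Proof.
have [->|x0] := eqVneq x 0; first by move=> *; rewrite mul0r vn_0.
have [->|y0] := eqVneq y 0; first by move=> *; rewrite mulr0 vn_0.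
rewrite /vge (negPf x0) (negPf y0) (negPf (div_mulf_neq0 x0 y0)) /= => hx hy.
by rewrite valM // PoszD lerD.
Qed.

Lemma vn1 : vge 0 1.
Proof. by rewrite /vge val1 lexx orbT. Qed.

Lemma vn_nat n : vge 0 n%:R.
Proof. exact/vnMn/vn1. Qed.

Lemma vnMl n x y : vge 0 x -> vge n y -> vge n (x * y).
Proof. exact: vnM. Qed.

Lemma vnMr n x y : vge n x -> vge 0 y -> vge n (x * y).
Proof. by move=> hx hy; rewrite -[n]addn0 vnM. Qed.

Lemma vnX m n x : vge m x -> vge (m * n) (x ^+ n).
Proof.
move=> h; elim: n => [|n IH]; first by rewrite muln0 vn1.
by rewrite mulnS exprS vnM.
Qed.

Lemma vnX0 n x : vge 0 x -> vge 0 (x ^+ n).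
Proof. by move/(vnX n); rewrite mul0n. Qed.

Lemma vn_adj m n x y : vge m x -> vge n y -> vge (m + n) (adj x y).
Proof. by move=> hx hy; apply: vnB; [|rewrite addnC]; apply: vnM. Qed.

(** Values are integers, so [vge n] and the negation of [vge n.+1] pin down the value; exact values
    are handled in this form below. *)
Lemma vn_exact n x : vge n x -> ~~ vge n.+1 x -> x != 0 /\ w x = n%:Z.
Proof.
rewrite /vge negb_or -ltNge => h /andP [x0 h']; split=> //.
move: h; rewrite (negPf x0) /= => h; apply/eqP.
by rewrite eq_le h andbT -ltzD1 (lt_le_trans h') // -addn1 PoszD.
Qed.

Lemma exact_vn n x : x != 0 -> w x = n%:Z -> vge n x /\ ~~ vge n.+1 x.
Proof. by move=> x0 wx; rewrite /vge (negPf x0) wx /= lexx lez_nat ltnn. Qed.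

Lemma vn_mul_exact m n x y :
  ~~ vge m.+1 x -> ~~ vge n.+1 y -> ~~ vge (m + n).+1 (x * y).
Proof.
rewrite /vge !negb_or -!ltNge => /andP [x0 hx] /andP [y0 hy].
rewrite div_mulf_neq0 //= valM //.
by move: hx hy; set a := w x; set b := w y; clear; lia.
Qed.

Lemma vn_inf x : (forall n, vge n x) -> x = 0.
Proof.
move=> h; apply/eqP/negPn/negP => x0; have := h `|w x|.+1; rewrite /vge (negPf x0) /=.
by set a := w x; clear; lia.
Qed.

Lemma vn_eq x y : (forall n, vge n (x - y)) -> x = y.
Proof. by move=> h; apply/eqP; rewrite -subr_eq0; apply/eqP/vn_inf. Qed.

Lemma vn_divl m n z y : z != 0 -> w z = n%:Z -> vge (m + n) y -> vge m (z^-1 * y).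
Proof.
move=> z0 wz; have [->|y0] := eqVneq y 0; first by move=> *; rewrite mulr0 vn_0.
have i0 : z^-1 != 0 by rewrite invr_eq0.
rewrite /vge (negPf y0) (negPf (div_mulf_neq0 i0 y0)) /= valM // valV // wz.
by set a := w y; clear; lia.
Qed.

Lemma vn_divr m n z y : z != 0 -> w z = n%:Z -> vge (m + n) y -> vge m (y * z^-1).
Proof.
move=> z0 wz; have [->|y0] := eqVneq y 0; first by move=> *; rewrite mul0r vn_0.
have i0 : z^-1 != 0 by rewrite invr_eq0.
rewrite /vge (negPf y0) (negPf (div_mulf_neq0 y0 i0)) /= valM // valV // wz.
by set a := w y; clear; lia.
Qed.

Lemma mem_vring x : (x \in valuation_ring w) = vge 0 x.
Proof. by rewrite unfold_in. Qed.

(** The residue map as a total function on D. Outside the valuation ring it takes the residue of 0,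
    so the lemmas about it ask for [vge 0]. *)
Definition rho x : residue_ring w := residue (insubd (0 : vring w) x).

Lemma rho_val (v : vring w) : rho (val v) = residue v.
Proof. by rewrite /rho valKd. Qed.

Lemma vn_val (v : vring w) : vge 0 (val v).
Proof. by rewrite -mem_vring (valP v). Qed.

Lemma rho_lift (x : D) : vge 0 x -> exists2 v : vring w, val v = x & rho x = residue v.
Proof.
by rewrite -mem_vring => h; exists (insubd 0 x) => //; rewrite insubdK.
Qed.

Lemma rhoP x y : vge 0 x -> vge 0 y -> rho x = rho y <-> vge 1 (x - y).
Proof.
move=> /rho_lift [a <- ->] /rho_lift [b <- ->]; rewrite residue_eq.
by rewrite unfold_in raddfB /= /vge -gtz0_ge1.
Qed.

Lemma rhoD x y : vge 0 x -> vge 0 y -> rho (x + y) = rho x + rho y.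
Proof.
move=> /rho_lift [a <- ->] /rho_lift [b <- ->].
by rewrite -[val a + _]/(val (a + b)) rho_val residueD.
Qed.

Lemma rhoM x y : vge 0 x -> vge 0 y -> rho (x * y) = rho x * rho y.
Proof.
move=> /rho_lift [a <- ->] /rho_lift [b <- ->].
by rewrite -[val a * _]/(val (a * b)) rho_val rmorphM.
Qed.

Lemma rhoN x : vge 0 x -> rho (- x) = - rho x.
Proof.
by move=> /rho_lift [a <- ->]; rewrite -[- val a]/(val (- a)) rho_val raddfN.
Qed.

Lemma rhoB x y : vge 0 x -> vge 0 y -> rho (x - y) = rho x - rho y.
Proof. by move=> hx hy; rewrite rhoD ?vnN // rhoN. Qed.

Lemma rho0 : rho 0 = 0.
Proof. by rewrite -[0 : D]/(val (0 : vring w)) rho_val raddf0. Qed.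

Lemma rho1 : rho 1 = 1.
Proof. by rewrite -[1 : D]/(val (1 : vring w)) rho_val rmorph1. Qed.

Lemma rhoX x n : vge 0 x -> rho (x ^+ n) = rho x ^+ n.
Proof.
by move=> hx; elim: n => [|n IH]; rewrite ?rho1 // !exprS rhoM ?vnX0 // IH.
Qed.

Lemma rho_eq0 x : vge 0 x -> (rho x == 0) = vge 1 x.
Proof.
move=> hx; have [h1 h2] := rhoP hx (vn_0 0).
by move: h1 h2; rewrite subr0 rho0 => h1 h2; apply/eqP/idP.
Qed.

Lemma rho_surj (a : residue_ring w) : exists2 x, vge 0 x & rho x = a.
Proof. by exists (val (res_repr a)); [exact: vn_val | rewrite rho_val res_reprK]. Qed.

Lemma rho_unit (a : residue_ring w) : a != 0 -> exists b, a * b = 1 /\ b * a = 1.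
Proof.
have [x hx <-] := rho_surj a; rewrite rho_eq0 // => hx1.
have [x0 wx] := vn_exact hx hx1; have Ux := divD x0.
have hi : vge 0 x^-1 by rewrite -[x^-1]mulr1 (@vn_divl 0 0) // vn1.
by exists (rho x^-1); rewrite -!rhoM // mulrV // mulVr // rho1.
Qed.

End Filtration.

(** * Power series and the copy of k((t)) inside D *)

Section PowerSeriesCoefficients.
Variable k : fieldType.
Implicit Types f g : powser k.

Lemma powserM f g n : (f * g) n = \sum_(i < n.+1) f i * g (n - i)%N.
Proof. by []. Qed.

Lemma powser_sum I (r : seq I) (P : pred I) (F : I -> powser k) n :
  (\sum_(i <- r | P i) F i) n = \sum_(i <- r | P i) F i n.
Proof. exact: (big_morph (fun f : powser k => f n)). Qed.

Definition powserC (c : k) : powser k := fun n => if n is 0 then c else 0.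
Definition powserX : powser k := fun n => (n == 1)%:R.

Lemma powserCM c f n : (powserC c * f) n = c * f n.
Proof.
rewrite powserM big_ord_recl /= subn0 big1 ?addr0 // => i _.
by rewrite /= mul0r.
Qed.

Lemma powserC_is_zmod_morphism : zmod_morphism powserC.
Proof.
by move=> a b; apply: funext => -[|n]; rewrite //= [RHS]subr0.
Qed.

Lemma powserC_is_monoid_morphism : monoid_morphism powserC.
Proof.
split=> [|a b]; apply: funext => -[|n] //; rewrite powserCM //=.
by rewrite mulr0.
Qed.

HB.instance Definition _ := GRing.isZmodMorphism.Build k (powser k) powserC
  powserC_is_zmod_morphism.
HB.instance Definition _ := GRing.isMonoidMorphism.Build k (powser k) powserC
  powserC_is_monoid_morphism.

Lemma powserXM f n : (powserX * f) n = if n is m.+1 then f m else 0.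
Proof.
rewrite powserM; case: n => [|n].
  by rewrite big_ord_recl big_ord0 /= mul0r addr0.
rewrite big_ord_recl mul0r add0r big_ord_recl /= mul1r subSS subn0.
by rewrite big1 ?addr0 // => i _; rewrite /powserX /= mul0r.
Qed.

Lemma powserXnM f q n :
  (powserX ^+ q * f) n = if (q <= n)%N then f (n - q)%N else 0.
Proof.
elim: q n => [|q IH] n; first by rewrite expr0 mul1r subn0.
rewrite exprS -mulrA powserXM; case: n => [|n] //.
Qed.

Lemma powserCXn c q n : (powserC c * powserX ^+ q) n = if n == q then c else 0.
Proof.
rewrite mulrC powserXnM eqn_leq andbC; case: leqP => //= qn.
by rewrite -subn_eq0; case: (n - q)%N.
Qed.

Lemma order_powserX : ps_order powserX = 1%N.
Proof. by apply: ps_orderE => [|[]]; rewrite /powserX /= ?oner_eq0. Qed.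

Lemma powserX_neq0 : powserX != 0.
Proof. by apply/eqP => /(congr1 (fun f : powser k => f 1%N)) /eqP; rewrite oner_eq0. Qed.

Lemma laurent_div (a : laurent k) : exists f g : powser k,
  g != 0 /\ a = FracField.tofrac f / FracField.tofrac g.
Proof.
exists \n_(repr a), \d_(repr a); split; first exact: denom_ratioP.
have g0 : FracField.tofrac \d_(repr a) != 0 :> laurent k.
  by rewrite tofrac_eq0 denom_ratioP.
apply: (mulIf g0); rewrite divfK //.
have F (b : powser k) : FracField.tofrac b
    = \pi_(laurent k)%qT (Ratio b 1) by rewrite piE.
rewrite -[a in LHS]reprK !F -[LHS]FracField.pi_mul.
apply/eqmodP => /=; rewrite FracField.equivfE /FracField.mulf.
by rewrite !numden_Ratio ?mulr1 ?oner_neq0 ?denom_ratioP // reprK mulrC.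
Qed.

End PowerSeriesCoefficients.

Section BaseField.
Variables (k : fieldType) (D : falgType (laurent k)) (w : valuation D).
Hypotheses (divD : division_ring D).
Implicit Types f g : powser k.

Definition ps (f : powser k) : D := (FracField.tofrac f)%:A.

Lemma ps_is_zmod_morphism : zmod_morphism ps.
Proof. by move=> f g; rewrite /ps !rmorphB scalerBl. Qed.
Lemma ps_is_monoid_morphism : monoid_morphism ps.
Proof.
split; first by rewrite /ps rmorph1 scale1r.
by move=> f g; rewrite /ps rmorphM -scalerAl mul1r scalerA.
Qed.
HB.instance Definition _ := GRing.isZmodMorphism.Build (powser k) D ps
  ps_is_zmod_morphism.
HB.instance Definition _ := GRing.isMonoidMorphism.Build (powser k) D ps
  ps_is_monoid_morphism.

Definition cst (c : k) : D := ps (powserC c).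
Lemma cst_is_zmod_morphism : zmod_morphism cst.
Proof. by move=> f g; rewrite /cst !rmorphB. Qed.
Lemma cst_is_monoid_morphism : monoid_morphism cst.
Proof. by split=> [|f g]; rewrite /cst ?rmorph1 ?rmorphM. Qed.
HB.instance Definition _ := GRing.isZmodMorphism.Build k D cst
  cst_is_zmod_morphism.
HB.instance Definition _ := GRing.isMonoidMorphism.Build k D cst
  cst_is_monoid_morphism.

Definition tau : D := ps (@powserX k).

Lemma scal_comm (a : laurent k) (y : D) : GRing.comm a%:A y.
Proof. by rewrite /GRing.comm -scalerAl -scalerAr mul1r mulr1. Qed.
Lemma ps_comm f y : GRing.comm (ps f) y. Proof. exact: scal_comm. Qed.
Lemma cst_comm c y : GRing.comm (cst c) y. Proof. exact: scal_comm. Qed.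
Lemma tau_comm y : GRing.comm tau y. Proof. exact: scal_comm. Qed.
Lemma taun_comm n y : GRing.comm (tau ^+ n) y.
Proof. by apply/commr_sym/commrX/commr_sym/tau_comm. Qed.

Variable e : nat.
Hypothesis e_gt0 : (0 < e)%N.
Hypothesis w_e : forall a : laurent k, a != 0 -> w a%:A = e%:Z * tval a.

Lemma val_ps f : f != 0 -> w (ps f) = (e * ps_order f)%:Z.
Proof.
move=> f0; rewrite /ps w_e ?tofrac_eq0 // PoszM; congr (_ * _).
have one0 : (1 : powser k) != 0 by exact: oner_neq0.
have := tval_div f0 one0; rewrite rmorph1 divr1 => ->.
by rewrite (@ps_orderE _ 1 0%N) ?subr0 // oner_neq0.
Qed.

Lemma ps_eq0 f : (ps f == 0) = (f == 0).
Proof. by rewrite /ps scaler_eq0 oner_eq0 orbF tofrac_eq0. Qed.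

Lemma vn_ps f n : (forall m, (m < n)%N -> f m = 0) -> vge w (e * n) (ps f).
Proof.
move=> h; rewrite /vge; have [->|f0] := eqVneq f 0; first by rewrite rmorph0 eqxx.
rewrite val_ps // lez_nat leq_mul2l; apply/orP; right; apply/orP; right.
have [h1 _] := ps_orderP f0; rewrite leqNgt; apply: contra h1 => /h ->.
by rewrite eqxx.
Qed.

Lemma vn_ps0 f : vge w 0 (ps f).
Proof. by have := @vn_ps f 0; rewrite muln0; apply. Qed.

Lemma vn_cst c : vge w 0 (cst c). Proof. exact: vn_ps0. Qed.

Lemma vn1_cst c : vge w 1 (cst c) = (c == 0).
Proof.
apply/idP/eqP => [|->]; last by rewrite rmorph0 vn_0.
apply: contraTeq => c0; have C0 : powserC c != 0 by rewrite fmorph_eq0.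
rewrite /vge ps_eq0 (negPf C0) val_ps // (@ps_orderE _ _ 0%N) //.
by rewrite muln0.
Qed.

Lemma tau_neq0 : tau != 0.
Proof. by rewrite ps_eq0 powserX_neq0. Qed.

Lemma val_tau : w tau = e%:Z.
Proof. by rewrite val_ps ?powserX_neq0 // order_powserX muln1. Qed.

Lemma ps_trunc f n :
  vge w (e * n) (ps f - \sum_(q < n) cst (f q) * tau ^+ q).
Proof.
have -> : ps f - \sum_(q < n) cst (f q) * tau ^+ q
    = ps (f - \sum_(q < n) powserC (f q) * powserX k ^+ q).
  rewrite rmorphB rmorph_sum; congr (_ - _); apply: eq_bigr => q _.
  by rewrite rmorphM rmorphXn.
apply: vn_ps => m mn; 
rewrite -[LHS]/(f m - (\sum_(q < n) powserC (f q) * powserX k ^+ q : powser k) m).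
rewrite powser_sum.
rewrite (bigD1 (Ordinal mn)) //= powserCXn eqxx big1 ?addr0 ?subrr // => q ne.
rewrite powserCXn; case: eqP => // E; case/eqP: ne; exact/val_inj.
Qed.

Lemma scal_residue (a : laurent k) : vge w 0 a%:A -> exists c, vge w 1 (a%:A - cst c).
Proof.
have [f [g [g0 aE]]] := laurent_div a.
have [->|a0] := eqVneq a 0; first by exists 0; rewrite rmorph0 subr0 scale0r vn_0.
have f0 : f != 0.
  by apply: contraNneq a0 => f0; rewrite aE f0 rmorph0 mul0r.
rewrite /vge scaler_eq0 (negPf a0) oner_eq0 /= w_e // aE tval_div //.
rewrite pmulr_rge0 ?ltz_nat // subr_ge0 lez_nat => le_gf.
have [gn gm] := ps_orderP g0; have [_ fm] := ps_orderP f0.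
set n := ps_order g in gn gm le_gf *.
(* Both coefficients are taken at the order n of g, so c is 0 when f has larger order; f - c g then
   vanishes up to degree n included. *)
pose c := f n / g n; exists c; rewrite -/(vge w 1 _).
have tg0 : FracField.tofrac g != 0 :> laurent k by rewrite tofrac_eq0.
have pg0 : ps g != 0 by rewrite ps_eq0.
have -> : (FracField.tofrac f / FracField.tofrac g)%:A - cst c
    = (ps g)^-1 * ps (f - powserC c * g).
  have Ug := divD pg0; apply: (mulrI Ug); rewrite mulVKr // mulrBr.
  have -> : ps g * (FracField.tofrac f / FracField.tofrac g)%:A = ps f.
    by rewrite /ps -scalerAl mul1r scalerA mulrC divfK.
  by rewrite (ps_comm g (cst c)) [RHS]rmorphB [X in _ = _ - X]rmorphM.
apply: (@vn_divl _ _ divD 1 (e * n)) => //; first by rewrite val_ps.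
apply: vn_leq (_ : vge w (e * n.+1) _); first by rewrite mulnS leq_add2r.
apply: vn_ps => m; rewrite ltnS leq_eqVlt => h.
rewrite -[LHS]/(f m - (powserC c * g) m) powserCM.
case/orP: h => [/eqP ->|mn]; first by rewrite /c divfK ?subrr.
by rewrite gm // fm ?mulr0 ?subrr // (leq_trans mn).
Qed.

End BaseField.

(** * Power bases of the algebras F(x) *)

Section PowersOfAnElement.
Variables (F : fieldType) (A : falgType F) (x : A).

Definition powers n : seq A := mkseq (fun i => x ^+ i) n.

Let size_powers n : size (powers n) = n. Proof. exact: size_mkseq. Qed.

Let powersS n : powers n.+1 = rcons (powers n) (x ^+ n).
Proof. by rewrite /powers /mkseq -cats1 -addn1 iotaD map_cat. Qed.

Lemma mem_powers n i : (i < n)%N -> x ^+ i \in <<powers n>>%VS.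
Proof.
move=> lin; apply: memv_span; apply/(nthP 0); exists i; first by rewrite size_powers.
by rewrite nth_mkseq.
Qed.

Lemma adjoin_sub_powers d : (0 < d)%N -> x ^+ d \in <<powers d>>%VS ->
  (<<1; x>> <= <<powers d>>)%VS.
Proof.
move=> d0 xd; have mul_stable : (<[x]> * <<powers d>> <= <<powers d>>)%VS.
  apply/prodvP => u v /vlineP [c ->]; rewrite -scalerAl => pv; apply: memvZ.
  have sz : size (powers d) == d by rewrite size_powers.
  rewrite (@coord_span _ _ _ (Tuple sz) v pv) mulr_sumr; apply: memv_suml => i _.
  rewrite -scalerAr memvZ //= nth_mkseq // -exprS.
  case: (ltnP i.+1 d) => [/mem_powers //|di].
  by have -> : i.+1 = d by apply/eqP; rewrite eqn_leq di andbT.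
have one_in : (1 <= <<powers d>>)%VS by rewrite -memvE -(expr0 x) mem_powers.
apply: agenv_sub_modl => //; rewrite prodvDl subv_add mul_stable andbT.
by rewrite prod1v subvv.
Qed.

Lemma memX_adjoin i : x ^+ i \in <<1; x>>%VS.
Proof.
elim: i => [|i IH]; first by rewrite (subvP (sub1_agenv _)) ?expr0 ?memv_line.
by rewrite exprS; apply: (memvM (A := <<1; x>>%AS)) => //; exact: memv_adjoin.
Qed.

(** If x^d lay in the span of the lower powers, that span would be stable under multiplication by x,
    hence contain F(x), whose dimension would be at most d. *)
Lemma powers_free : free (powers (\dim <<1; x>>)).
Proof.
suff H d : (d <= \dim <<1; x>>)%N -> free (powers d) by exact: H.
elim: d => [|d IH] hd; first exact: nil_free.
rewrite powersS (perm_free (Y := x ^+ d :: powers d)) ?perm_rcons //.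
rewrite free_cons (IH (ltnW hd)) andbT; apply/negP => xd.
have d0 : (0 < d)%N.
  by case: d xd {IH hd} => //; rewrite span_nil memv0 expr0 oner_eq0.
have := dimvS (adjoin_sub_powers d0 xd); rewrite leqNgt => /negP; apply.
by apply: leq_ltn_trans hd; have := dim_span (powers d); rewrite size_powers.
Qed.

Lemma powers_basis : basis_of <<1; x>> (powers (\dim <<1; x>>)).
Proof.
rewrite basisEfree powers_free size_powers leqnn andbT /=.
apply/span_subvP => y /(nthP 0) [i]; rewrite size_powers => lti <-.
by rewrite nth_mkseq // memX_adjoin.
Qed.

Lemma adjoin_spanP y : y \in <<1; x>>%VS ->
  exists c : nat -> F, y = \sum_(i < \dim <<1; x>>) c i *: x ^+ i.
Proof.
set n := \dim _ => /(coord_basis (X := Tuple (introT eqP (size_powers n))) powers_basis) ->.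
pose c i := if insub i is Some j then coord (Tuple (introT eqP (size_powers n))) j y else 0.
exists c; apply: eq_bigr => i _; rewrite /c valK /= nth_mkseq //.
Qed.

Lemma adjoin_indep (c : nat -> F) n : (n <= \dim <<1; x>>)%N ->
  \sum_(i < n) c i *: x ^+ i = 0 -> forall i, (i < n)%N -> c i = 0.
Proof.
move=> len; set m := \dim _ in len *; pose c' i := if (i < n)%N then c i else 0.
have fr : free (Tuple (introT eqP (size_powers m))) := powers_free.
move=> S0 i ltin; have ltim := leq_trans ltin len.
have /freeP /(_ (fun j : 'I_m => c' j)) H := fr.
have := H _ (Ordinal ltim); rewrite /c' /= ltin; apply.
rewrite -[RHS]S0 (big_ord_widen m (fun i => c i *: x ^+ i) len) [RHS]big_mkcond /=.
by apply: eq_bigr => j _; rewrite nth_mkseq //; case: ifP; rewrite ?scale0r.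
Qed.

End PowersOfAnElement.

(** * Artin-Whaples independence and the dimension of commutative subalgebras *)

Section ArtinWhaples.
Variables (F : fieldType) (A : falgType F).
Hypothesis divA : division_ring A.
Hypothesis centA : 'Z({:A})%VS = 1%VS.

Lemma centralP (y : A) : (forall z, GRing.comm y z) -> exists c : F, y = c%:A.
Proof.
move=> h; apply/vlineP; rewrite -centA memv_cap memvf /=.
by apply/centvP => z _; exact: h.
Qed.

(* A shortest nontrivial relation, normalized so that some d_j is 1, has central
   coefficients: otherwise the relations at [y * b] and at [y] (times b on the
   right) differ by a shorter one. *)
Lemma artin_whaples m (l d : 'I_m -> A) :
  (forall c : 'I_m -> F, \sum_i c i *: l i = 0 -> forall i, c i = 0) ->
  (forall y, \sum_i l i * y * d i = 0) -> forall i, d i = 0.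
Proof.
move=> fl; have [n] := ubnP #|[pred i | d i != 0]|.
elim: n d => // n IH d; rewrite ltnS => len rel j; apply/eqP/negPn/negP => dj0.
have Uj := divA dj0; pose d' i := d i / d j.
have rel' y : \sum_i l i * y * d' i = 0.
  rewrite -[RHS](mul0r (d j)^-1) -[X in _ = X * _](rel y) [RHS]mulr_suml.
  by apply: eq_bigr => i _; rewrite mulrA.
have d'C i : exists c : F, d' i = c%:A.
  apply: centralP => b; pose d2 i := b * d' i - d' i * b.
  suff: d2 i = 0 by move/eqP; rewrite subr_eq0 => /eqP.
  move: i; apply: IH.
    apply: leq_trans len; apply: proper_card; apply/properP; split.
      apply/fintype.subsetP => i; rewrite !inE; apply: contra => /eqP di0.
      by rewrite /d2 /d' di0 !mul0r mulr0 subrr.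
    by exists j; rewrite !inE // /d2 /d' divrr // mulr1 mul1r subrr eqxx.
  move=> y; transitivity (\sum_i l i * (y * b) * d' i - (\sum_i l i * y * d' i) * b).
    rewrite mulr_suml -sumrB; apply: eq_bigr => i _.
    by rewrite /d2 mulrBr !mulrA.
  by rewrite !rel' mul0r subrr.
have /choice [c cE] := d'C.
have c0 : forall i, c i = 0.
  apply: fl; rewrite -[RHS](rel' 1).
  by apply: eq_bigr => i _; rewrite cE mulr1 -scalerAr mulr1.
have := cE j; rewrite c0 scale0r /d' divrr // => /eqP.
by rewrite oner_eq0.
Qed.

Lemma commutative_subalg_dim (L : {aspace A}) :
  {in L &, forall u v, u * v = v * u} -> (\dim L ^ 2 <= \dim {:A})%N.
Proof.
move=> comL.
have /(skew_field_module_semisimple divA) [X [SX /directvP /= DX nzX]] : (L * {:A} <= {:A})%VS.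
  exact: subvf.
have dimA : \dim {:A} = (size X * \dim L)%N.
  rewrite -SX DX /= big_seq.
  rewrite (eq_bigr (fun=> \dim L)); last first.
    move=> y Xy; rewrite dim_cosetv_unit //; apply: divA.
    by apply: contraNneq nzX => <-.
  by rewrite -big_seq big_const_seq count_predT iter_addn_0 mulnC.
rewrite dimA -mulnn leq_mul2r; apply/orP; right; rewrite leqNgt; apply/negP => ltrm.
set m := \dim L in ltrm dimA *; set r := size X in ltrm dimA *.
(* With (l_i) a basis of L, the map y |-> \sum_i l_i y d_i is L-linear; if the
   left L-dimension r of A were less than m, some d <> 0 would make it vanish
   on an L-basis X of A. *)
pose phi (d : {ffun 'I_m -> A}) : {ffun 'I_r -> A} :=
  [ffun j : 'I_r => \sum_(i < m) (vbasis L)`_i * X`_j * d i].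
have philin : linear phi.
  move=> a u v; apply/ffunP => j; rewrite !ffunE scaler_sumr -big_split.
  by apply: eq_bigr => i _; rewrite !ffunE mulrDr -scalerAr.
pose phiL : {linear _ -> _} := HB.pack phi (GRing.isLinear.Build _ _ _ _ phi philin).
have kerN0 : lker (linfun phiL) != 0%VS.
  apply/negP => /eqP ker0; have := limg_ker_dim (linfun phiL) fullv.
  have := dimvS (subvf (linfun phiL @: fullv)).
  rewrite ker0 capv0 dimv0 add0n => le E; move: le; rewrite E !dimvf /dim /= !card_ord.
  rewrite leq_mul2r leqNgt ltrm orbF => /eqP dA0.
  by have := FalgType_proper A; rewrite dA0.
set d := vpick (lker (linfun phiL)).
have d0 : d != 0 by rewrite vpick0.
have : d \in lker (linfun phiL) by exact: memv_pick.
rewrite memv_ker lfunE /= => /eqP phid.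
have sz : size (vbasis L) = m := size_tuple _.
have dz : forall i, d i = 0.
  apply: (@artin_whaples m (fun i => (vbasis L)`_i)).
    by apply/freeP; exact: basis_free (vbasisP L).
  pose psi y := \sum_(i < m) (vbasis L)`_i * y * d i.
  have psilin : linear psi.
    move=> a u v; rewrite /psi scaler_sumr -big_split; apply: eq_bigr => i _.
    by rewrite mulrDr mulrDl -scalerAr -scalerAl.
  pose psiL : {linear _ -> _} := HB.pack psi (GRing.isLinear.Build _ _ _ _ psi psilin).
  move=> y; have : y \in {:A}%VS by exact: memvf.
  suff /subvP H : ({:A} <= lker (linfun psiL))%VS.
    by move/H; rewrite memv_ker lfunE => /eqP.
  rewrite -SX big_seq; elim/big_ind: _ => [|U V sU sV|z Xz]; first exact: sub0v.
    by rewrite subv_add sU.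
  apply/prodvP => u v Lu /vlineP [c ->]; rewrite memv_ker lfunE /=; apply/eqP.
  have [j jr <-] := nthP 0 Xz.
  transitivity (u * (c *: (phi d (Ordinal jr)))); last by rewrite phid ffunE scaler0 mulr0.
  rewrite /phi /psi ffunE scaler_sumr mulr_sumr; apply: eq_bigr => i _.
  have Li : (vbasis L)`_i \in L by apply: vbasis_mem; rewrite mem_nth // sz.
  by rewrite mulrA (comL _ _ Li Lu) -!scalerAr -scalerAl !mulrA.
by case/eqP: d0; apply/ffunP => i; rewrite dz ffunE.
Qed.

End ArtinWhaples.

(** * Extensions of prime degree are simple *)

Section SimpleExtension.
Variables (k : fieldType) (R : nzRingType) (i : {rmorphism k -> R}).
Hypothesis R_comm : forall a b : R, a * b = b * a.
Hypothesis R_inv : forall a : R, a != 0 -> exists b, a * b = 1.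
Variables (p : nat) (p_pr : prime p) (b : 'I_p -> R).
Hypothesis b_span : forall x, exists c : 'I_p -> k, x = \sum_j i (c j) * b j.
Hypothesis b_free :
  forall c : 'I_p -> k, \sum_j i (c j) * b j = 0 -> forall j, c j = 0.
Variable a : R.
Hypothesis a_notin : forall c, a <> i c.

(** R is made a finite-dimensional k-algebra with coordinates along [b], so that degrees multiply:
    the degree of k(a) divides the prime p and is not 1, so k(a) = R. *)
Lemma simple_extension :
  (forall x, exists c : nat -> k, x = \sum_(j < p) i (c j) * a ^+ j) /\
  (forall c : nat -> k, \sum_(j < p) i (c j) * a ^+ j = 0 ->
     forall j, (j < p)%N -> c j = 0).
Proof.
pose scale (c : k) (x : R) := i c * x.
have scA c d x : scale c (scale d x) = scale (c * d) x.
  by rewrite /scale mulrA rmorphM.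
have sc1 : left_id 1 scale by move=> x; rewrite /scale rmorph1 mul1r.
have scDr : right_distributive scale +%R by move=> c x y; rewrite /scale mulrDr.
have scDl x : {morph scale^~ x : c d / c + d}.
  by move=> c d; rewrite /scale rmorphD mulrDl.
pose lmM := GRing.Zmodule_isLmodule.Build k R scA sc1 scDr scDl.
pose lmR : lmodType k := HB.pack R lmM.
have lalM : GRing.Lmodule_isLalgebra k lmR by constructor => c x y; exact: mulrA.
pose laR : lalgType k := HB.pack lmR lalM.
have alM : GRing.Lalgebra_isAlgebra k laR.
  constructor => c x y; rewrite -[LHS]/(i c * (x * y)) -[RHS]/(x * (i c * y)).
  by rewrite !mulrA [x * _]R_comm.
pose alR : algType k := HB.pack laR alM.
have b_uniq (c d : 'I_p -> k) : \sum_j i (c j) * b j = \sum_j i (d j) * b j -> c =1 d.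
  move=> /eqP; rewrite -subr_eq0 -sumrB => /eqP E j.
  apply/eqP; rewrite -subr_eq0; apply/eqP/(b_free (c := fun j => c j - d j)).
  by rewrite -[RHS]E; apply: eq_bigr => l _; rewrite rmorphB mulrBl.
have /choice [cf cfE] := b_span.
pose v2r (x : alR) : 'rV[k]_p := \row_j cf x j.
have v2r_lin : linear v2r.
  move=> c x y; apply/rowP => j; rewrite !mxE.
  apply: (b_uniq _ (fun j => c * cf x j + cf y j)).
  rewrite -cfE -[LHS]/(i c * x + y) {1}[x]cfE {1}[y]cfE mulr_sumr -big_split.
  by apply: eq_bigr => l _; rewrite /= rmorphD rmorphM mulrDl mulrA.
have v2r_bij : bijective v2r.
  exists (fun r : 'rV[k]_p => \sum_j i (r 0 j) * b j : alR) => [x|r].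
    by rewrite [RHS]cfE; apply: eq_bigr => j _; rewrite mxE.
  apply/rowP => j; rewrite mxE; apply: (b_uniq _ (fun j => r 0 j)).
  by rewrite -cfE.
pose vM := Lmodule_hasFinDim.Build k alR (exist2 _ _ v2r v2r_lin v2r_bij).
pose vL : vectType k := HB.pack alR vM.
pose aL : algType k := HB.pack vL alR.
pose faM := Algebra_isFalgebra.Build k aL.
pose fL : falgType k := HB.pack vL aL faM.
have divL : division_ring fL.
  move=> x /R_inv [y xy]; apply/unitrP; exists (y : fL); split; last exact: xy.
  by rewrite -[LHS]/((y : R) * (x : R)) R_comm.
have dimL : \dim {:fL} = p by rewrite dimvf.
pose x : fL := a.
have dimx : \dim <<1; x>> = p.
  have : (\dim <<1; x>> %| p)%N.
    rewrite -dimL; apply: (@skew_field_dimS _ fL divL <<1; x>>%AS {:fL}%AS).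
    exact: subvf.
  have /primeP [_ pdiv] := p_pr; move=> /pdiv /orP [/eqP d1|/eqP //].
  have E : 1%VS = <<1; x>>%VS.
    by apply/eqP; rewrite eqEdim sub1_agenv d1 dimv1.
  have /vlineP [c xc] : x \in 1%VS by rewrite E memv_adjoin.
  by case: (a_notin (c := c)); rewrite -[LHS]/x xc -[LHS]/(i c * 1) mulr1.
have scE c (y : fL) : c *: y = i c * (y : R) by [].
have sumE (c : nat -> k) : \sum_(j < p) i (c j) * a ^+ j = \sum_(j < \dim <<1; x>>) c j *: x ^+ j.
  by rewrite dimx.
split=> [y|c]; last first.
  rewrite sumE => S0 j jp; have H := @adjoin_indep _ fL x c _ (leqnn _) S0.
  by apply: H; rewrite dimx.
have [|c ->] := @adjoin_spanP _ _ x y.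
  have -> : <<1; x>>%VS = {:fL}%VS.
    by apply/eqP; rewrite eqEdim subvf dimx dimL leqnn.
  exact: memvf.
by exists c; rewrite sumE.
Qed.
End SimpleExtension.

(** Dependent choice with an invariant and a proximity relation that vary with the step. It serves
    the digit expansions, the chain of coefficient fields, and the approximations of z and x. *)
Lemma dependent_sequence (T : Type) (P : nat -> T -> Prop)
    (R : nat -> T -> T -> Prop) (t0 : T) :
  P 0%N t0 -> (forall n t, P n t -> exists2 t', P n.+1 t' & R n t t') ->
  exists f : nat -> T, f 0%N = t0 /\ forall n, P n (f n) /\ R n (f n) (f n.+1).
Proof.
move=> P0 step; have step' n (t : {t | P n t}) :
    {t' : {t | P n.+1 t} | R n (sval t) (sval t')}.
  have [t' Pt' Rt'] := cid2 (step n _ (svalP t)).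
  by exists (exist _ t' Pt').
pose f := fix f n : {t | P n t} :=
  if n is m.+1 then sval (step' m (f m)) else exist _ t0 P0.
by exists (fun n => sval (f n)); split=> // n; split;
  [exact: svalP | exact: (svalP (step' n (f n)))].
Qed.

(* The hypotheses of the theorem, with the ramification index [e] of D over
   k((t)) made explicit. *)
Record wild (k : fieldType) (D : falgType (laurent k)) (w : valuation D)
    (p e : nat) : Prop := Wild {
  wild_div : division_ring D;
  wild_cent : 'Z({:D})%VS = 1%VS;
  wild_char : p \in [pchar D];
  wild_e : (0 < e)%N;
  wild_val : forall a : laurent k, a != 0 -> w a%:A = e%:Z * tval a;
  wild_onto : forall n : int, exists2 x : D, x != 0 & w x = n;
  wild_comm : forall x : residue_ring w, ring_center x;
  wild_deg : has_degree (residue_of w 1%VS) (@ring_center (residue_ring w)) p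
}.

(** As B lies in A, the relation b1 b0 = b0 b1 between two basis vectors writes one element in two
    ways; uniqueness gives b1 = 0, and a zero basis vector contradicts uniqueness again. The lemma
    serves to find elements outside the ground field when the degree exceeds 1. *)
Lemma has_degree_le1 (R : nzRingType) (A B : R -> Prop) n :
  (forall a b : R, a * b = b * a) -> (forall a b, B a -> B b -> B (a * b)) ->
  A 0 /\ A 1 -> (forall x, B x -> A x) -> has_degree A B n -> (n <= 1)%N.
Proof.
move=> Rc BM [A0 A1] BA [b [Bb b_uniq]]; rewrite leqNgt; apply/negP => n1.
have n0 := ltnW n1; pose i0 := Ordinal n0; pose i1 := Ordinal n1.
have single (a : R) (i : 'I_n) : \sum_j (if j == i then a else 0) * b j = a * b i.
  rewrite (bigD1 i) //= eqxx big1 ?addr0 // => j /negPf ->.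
  by rewrite mul0r.
have [c [_ cU]] := b_uniq _ (BM _ _ (Bb i1) (Bb i0)).
have E0 : c = fun j => if j == i0 then b i1 else 0.
  by apply: cU; split=> [j|]; [case: eqP => // _; exact/BA/Bb | rewrite single].
have E1 : c = fun j => if j == i1 then b i0 else 0.
  by apply: cU; split=> [j|]; [case: eqP => // _; exact/BA/Bb | rewrite single Rc].
have b1 : b i1 = 0.
  by have := congr1 (fun f => f i0) (etrans (esym E0) E1); rewrite /= ?eqxx.
have B0 : B 0 by rewrite -b1.
have [d [_ dU]] := b_uniq 0 B0.
have F0 : d = fun j => if j == i0 then 0 else 0.
  by apply: dU; split=> [j|]; [case: eqP | rewrite single mul0r].
have F1 : d = fun j => if j == i1 then 1 else 0.
  by apply: dU; split=> [j|]; [case: eqP | rewrite single b1 mulr0].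
have := congr1 (fun f => f i1) (etrans (esym F1) F0); rewrite /= ?eqxx.
by move/eqP; rewrite oner_eq0.
Qed.

(** * Generators of the residue field, parameters and digit expansions *)

Section Setting.
Variables (k : fieldType) (D : falgType (laurent k)) (w : valuation D) (p e : nat).
Hypothesis H : wild w p e.

Let divD := wild_div H.
Let e_gt0 := wild_e H.
Let w_e := wild_val H.
Let p_pr : prime p := pcharf_prime (wild_char H).
Local Notation vn := (vge w).
Local Notation cst := (cst D).
Local Notation tau := (tau D).
Local Notation param := (parameter w).

Let vnc c : vn 0 (cst c) := vn_cst w_e c.

Definition resC_fun (c : k) : residue_ring w := rho w (cst c).
Lemma resC_is_zmod_morphism : zmod_morphism resC_fun.
Proof. by move=> a b; rewrite /resC_fun rmorphB /= rhoB. Qed.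
Lemma resC_is_monoid_morphism : monoid_morphism resC_fun.
Proof.
by split=> [|a b]; rewrite /resC_fun ?rmorph1 ?rho1 // rmorphM /= rhoM.
Qed.
Definition resC : {rmorphism k -> residue_ring w} :=
  HB.pack resC_fun (GRing.isZmodMorphism.Build _ _ _ resC_is_zmod_morphism)
    (GRing.isMonoidMorphism.Build _ _ _ resC_is_monoid_morphism).

Lemma resCE c : resC c = rho w (cst c). Proof. by []. Qed.

Lemma residue_of_resC y : residue_of w 1%VS y <-> exists c, y = resC c.
Proof.
split=> [[a /vlineP [c ac] <-]|[c ->]].
  have h : vn 0 c%:A by rewrite -ac vn_val.
  have [d hd] := scal_residue divD e_gt0 w_e h; exists d.
  by rewrite -rho_val -[val a]/(vring_val a) ac resCE; apply/rhoP.
have [v vc] := rho_lift (vnc c); rewrite resCE => ->; exists v => //.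
by rewrite -[val v]/(vring_val v) in vc; rewrite /= vc;
  apply/vlineP; exists (FracField.tofrac (powserC c)).
Qed.

(* The residue of [x] generates the residue field over k, whose degree is prime. *)
Definition resgen (x : D) := vn 0 x /\ forall c, ~ vn 1 (x - cst c).

Lemma resgenP x : vn 0 x -> resgen x <-> forall c, rho w x <> resC c.
Proof.
move=> hx; split=> [[_ h] c /rhoP E|h]; first by apply: (h c); apply: E.
by split=> // c /rhoP E; apply: (h c); apply: E.
Qed.

Lemma vn_pow_sum x (c : nat -> k) n : vn 0 x ->
  vn 0 (\sum_(j < n) cst (c j) * x ^+ j).
Proof. by move=> hx; apply: vn_sum => j _; rewrite vnMl // vnX0. Qed.

Lemma rho_pow_sum x (c : nat -> k) n : vn 0 x ->
  rho w (\sum_(j < n) cst (c j) * x ^+ j) = \sum_(j < n) resC (c j) * rho w x ^+ j.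
Proof.
move=> hx; elim: n => [|n IH]; first by rewrite !big_ord0 rho0.
rewrite !big_ord_recr /= rhoD ?vn_pow_sum ?vnMl ?vnX0 // IH.
by rewrite rhoM ?vnX0 // rhoX // resCE.
Qed.

Lemma resgen_basis x : resgen x ->
  (forall y, vn 0 y -> exists c : nat -> k, vn 1 (y - \sum_(j < p) cst (c j) * x ^+ j)) /\
  (forall c : nat -> k, vn 1 (\sum_(j < p) cst (c j) * x ^+ j) ->
     forall j, (j < p)%N -> c j = 0).
Proof.
move=> gx; have hx := gx.1; have [b [_ b_uniq]] := wild_deg H.
have b_ex y : exists c : 'I_p -> k, y = \sum_j resC (c j) * b j.
  have [c [[cc yE] _]] := b_uniq y (wild_comm H y).
  have /choice [d dE] : forall j, exists d, c j = resC d.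
    by move=> j; apply/residue_of_resC/cc.
  by exists d; rewrite yE; apply: eq_bigr => j _; rewrite dE.
have b_free (c : 'I_p -> k) : \sum_j resC (c j) * b j = 0 -> forall j, c j = 0.
  move=> c0 j; have [d [_ dU]] := b_uniq 0 (wild_comm H 0).
  have in1 (f : 'I_p -> k) l : residue_of w 1%VS (resC (f l)).
    by apply/residue_of_resC; exists (f l).
  have E1 := dU (fun l => resC (c l)) (conj (in1 c) (esym c0)).
  have E2 : d = fun=> resC 0.
    apply: dU; split=> [l|]; first by apply/residue_of_resC; exists 0.
    by rewrite big1 // => l _; rewrite rmorph0 mul0r.
  have := congr1 (fun f => f j) (etrans (esym E1) E2).
  rewrite -[LHS]/(rho w (cst (c j))) -[RHS]/(rho w (cst 0)) rmorph0 rho0 => /eqP.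
  by rewrite (rho_eq0 (vnc _)) (vn1_cst w_e) => /eqP.
have Rinv (a : residue_ring w) : a != 0 -> exists b, a * b = 1.
  by move=> /(rho_unit divD) [a' [aa' _]]; exists a'.
have ga : forall c, rho w x <> resC c by apply/resgenP.
have [S1 S2] := simple_extension (fun a b => wild_comm H a b) Rinv p_pr b_ex b_free ga.
split=> [y hy|c hc j jp].
  have [c yE] := S1 (rho w y); exists c.
  by apply/(rhoP hy (vn_pow_sum c p hx)); rewrite rho_pow_sum.
apply: S2 jp; rewrite -rho_pow_sum //; apply/eqP.
by rewrite rho_eq0 ?vn_pow_sum.
Qed.

Lemma exists_resgen : exists x, resgen x.
Proof.
apply: contrapT => h; have := prime_gt1 p_pr; rewrite ltnNge => /negP; apply.
apply: (has_degree_le1 _ _ _ _ (wild_deg H)) => [a b|||y _].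
- exact: (wild_comm H a b).
- by move=> a b _ _ c; exact: (wild_comm H (a * b) c).
- by split; [apply/residue_of_resC; exists 0 | apply/residue_of_resC; exists 1];
    rewrite ?rmorph0 ?rmorph1.
have [x hx <-] := rho_surj y; apply: contrapT => hy; apply: h.
exists x; apply/resgenP => // c xc; apply: hy.
by apply/residue_of_resC; exists c.
Qed.

Lemma exists_param : exists z, param z.
Proof. by have [z z0 wz] := wild_onto H 1; exists z. Qed.

Lemma param_vn z : param z -> vn 1 z.
Proof. by case=> z0 wz; have [] := @exact_vn _ w 1 z z0 wz. Qed.

Lemma param_val z n : param z -> z ^+ n != 0 /\ w (z ^+ n) = n%:Z.
Proof.
by move=> [z0 wz]; rewrite div_expf_neq0 // valX // wz -mulr_natr mul1r natz.
Qed.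

Section Expansions.
Variables x z : D.
Hypotheses (gx : resgen x) (pz : param z).
Let hx : vn 0 x := gx.1.

(* Elements of value n which use only the powers z^l with l < e. *)
Let upi n := tau ^+ (n %/ e) * z ^+ (n %% e).

Let upi_val n : upi n != 0 /\ w (upi n) = n%:Z.
Proof.
have t0 : tau != 0 := tau_neq0 D.
have [z0 wz] := param_val (n %% e) pz; have tn0 := div_expf_neq0 divD (n %/ e) t0.
split; first exact: div_mulf_neq0.
rewrite valM // wz valX // (val_tau w_e) -mulr_natr natz -PoszM -PoszD.
by rewrite mulnC -divn_eq.
Qed.

Let dig (c : nat -> k) n := (\sum_(j < p) cst (c j) * x ^+ j) * upi n.

Let digit n r : vn n r -> exists c, vn n.+1 (r - dig c n).
Proof.
move=> hr; have [u0 wu] := upi_val n.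
have hq : vn 0 (r * (upi n)^-1) by rewrite (vn_divr divD u0 wu).
have [c hc] := (resgen_basis gx).1 _ hq; exists c; rewrite /dig.
have [hu _] := exact_vn u0 wu; have := vnM divD hc hu.
by rewrite mulrBl divrK ?divD.
Qed.

(** One expansion serves two purposes: an eventually constant sequence gives the spanning of D over
    F, a Cauchy sequence gives the completeness of D. *)
Lemma complete_span (s : nat -> D) : s 0%N = 0 ->
  (forall n, vn n (s n.+1 - s n)) ->
  exists a : 'I_p -> 'I_e -> laurent k,
    forall n, vn n (\sum_j \sum_l (a j l)%:A * x ^+ j * z ^+ l - s n).
Proof.
move=> s0 hs.
have [Y [Y0 HY]] : exists Y : nat -> D, Y 0%N = 0 /\ forall n,
    vn n (s n - Y n) /\ exists c, Y n.+1 = Y n + dig c n.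
  apply: (@dependent_sequence D (fun n y => vn n (s n - y))
    (fun n y y' => exists c, y' = y + dig c n)); first by rewrite s0 subrr vn_0.
  move=> n y hy; have /digit [c hc] : vn n (s n.+1 - y) by apply: vn_trans hy.
  by exists (y + dig c n); [rewrite opprD addrA | exists c].
have /choice [C YS] : forall n, exists c, Y n.+1 = Y n + dig c n by move=> n; case: (HY n).
have YD m l : Y (m + l)%N = Y m + \sum_(i < l) dig (C (m + i)%N) (m + i)%N.
  elim: l => [|l IH]; first by rewrite big_ord0 addn0 addr0.
  by rewrite addnS YS IH big_ord_recr /= addrA.
(* The digit at position e q + l carries tau^q z^l, so the digits of one class modulo e assemble
   into a power series in t. *)
pose g (j : 'I_p) (l : 'I_e) : powser k := fun q => C (e * q + l)%N j.
exists (fun j l => FracField.tofrac (g j l)) => n.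
set y := \sum_j _.
have Ye N : Y (e * N)%N =
    \sum_j \sum_(l < e) (\sum_(q < N) cst (g j l q) * tau ^+ q) * x ^+ j * z ^+ l.
  elim: N => [|N IH].
    rewrite muln0 Y0; rewrite big1 // => j _; rewrite big1 // => l _.
    by rewrite big_ord0 !mul0r.
  rewrite mulnS addnC YD IH.
  have -> : \sum_(i < e) dig (C (e * N + i)%N) (e * N + i)%N =
      \sum_(j < p) \sum_(l < e) cst (g j l N) * tau ^+ N * x ^+ j * z ^+ l.
    rewrite exchange_big /=; apply: eq_bigr => l _.
    rewrite /dig mulr_suml; apply: eq_bigr => j _.
    rewrite /upi mulnC divnMDl // divn_small // addn0 modnMDl modn_small //.
    by rewrite /g (mulnC N) mulrA -[_ * x ^+ j * tau ^+ N]mulrA -(taun_comm N (x ^+ j)) !mulrA.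
  rewrite -big_split; apply: eq_bigr => j _; rewrite -big_split; apply: eq_bigr => l _.
  by rewrite /= big_ord_recr /= !mulrDl.
have hyY N : vn (e * N) (y - Y (e * N)%N).
  rewrite Ye /y -sumrB; apply: vn_sum => j _; rewrite -sumrB; apply: vn_sum => l _.
  rewrite -!mulrBl; apply: vnMr => //; last exact/vnX0/(vn_leq (leqnSn 0))/param_vn.
  by apply: vnMr => //; [exact: ps_trunc | exact: vnX0].
have hYY m : vn n (Y (n + m)%N - Y n).
  rewrite YD addrC addKr; apply: vn_sum => i _; apply: vn_leq (leq_addr i n) _.
  by apply: vnMl => //; [exact: vn_pow_sum |
    have [u0 wu] := upi_val (n + i); have [] := exact_vn u0 wu].
apply: (@vn_trans _ w (Y n)); last by rewrite vnBC; case: (HY n).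
have len : (n <= e * n)%N by rewrite leq_pmull.
apply: vn_trans (vn_leq len (hyY n)) _.
by have := hYY (e * n - n)%N; rewrite subnKC.
Qed.

End Expansions.
End Setting.

(** * Independence by values; the dimension of D and of its subalgebras *)

Section DominantTerm.
Variables (D : nzRingType) (w : valuation D).

Lemma val_sum_gt (I : Type) (r : seq I) (P : pred I) (F : I -> D) (m : int) :
  (forall i, P i -> F i = 0 \/ m < w (F i)) ->
  let S := \sum_(i <- r | P i) F i in S = 0 \/ m < w S.
Proof.
move=> h /=; elim/big_rec: _ => [|i y Pi [->|hy]]; first by left.
  by rewrite addr0; exact: h.
have [->|hi] := h i Pi; first by rewrite add0r; right.
have [Fi0|Fi0] := eqVneq (F i) 0; first by rewrite Fi0 add0r; right.
have [->|y0] := eqVneq y 0; first by rewrite addr0; right.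
have [|s0] := eqVneq (F i + y) 0; first by left.
by right; apply: lt_le_trans (valD w Fi0 y0 s0); rewrite lt_min hi.
Qed.

Lemma dominant_term (I : finType) (F : I -> D) (i0 : I) : F i0 != 0 ->
  (forall i, i != i0 -> F i = 0 \/ w (F i0) < w (F i)) -> \sum_i F i <> 0.
Proof.
move=> F0 h; rewrite (bigD1 i0) //= => /eqP; rewrite addr_eq0 => /eqP E.
have [S0|] := val_sum_gt (index_enum I) h; first by rewrite S0 oppr0 in E; rewrite E eqxx in F0.
set S := \sum_(i | _) _ in E *; have S0 : S != 0 by rewrite -oppr_eq0 -E.
by rewrite E valN // ltxx.
Qed.

Lemma exists_min_val (I : finType) (F : I -> D) (i1 : I) : F i1 != 0 ->
  exists2 i0, F i0 != 0 & forall i, F i != 0 -> w (F i0) <= w (F i).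
Proof.
move=> F1; case: (@arg_minP _ _ I i1 (fun i => F i != 0) (fun i => w (F i)) F1) => i0 Fi0 h.
by exists i0.
Qed.
End DominantTerm.

Section Dimension.
Variables (k : fieldType) (D : falgType (laurent k)) (w : valuation D) (p e : nat).
Hypothesis H : wild w p e.

Let divD := wild_div H.
Let e_gt0 := wild_e H.
Let w_e := wild_val H.
Let p_pr : prime p := pcharf_prime (wild_char H).
Let p_gt0 : (0 < p)%N := prime_gt0 p_pr.
Local Notation vn := (vge w).
Local Notation cst := (cst D).
Local Notation tau := (tau D).

Lemma D_span x z : resgen w x -> parameter w z -> forall y : D,
  exists a : 'I_p -> 'I_e -> laurent k,
    y = \sum_j \sum_l (a j l)%:A * x ^+ j * z ^+ l.
Proof.
move=> gx pz y.
have [n hn] : exists n, vn 0 (tau ^+ n * y).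
  have [->|y0] := eqVneq y 0; first by exists 0%N; rewrite mulr0 vn_0.
  have t0 := div_expf_neq0 divD `|w y| (tau_neq0 D).
  exists `|w y|%N; rewrite /vge valM // valX ?tau_neq0 // (val_tau w_e).
  rewrite (negPf (div_mulf_neq0 divD t0 y0)) /= -mulr_natr natz -PoszM.
  have := @leq_pmull `|w y|%N e e_gt0; move: (w y) => m; clear; lia.
(* The value 0 at index 0 is imposed by [complete_span] and costs nothing, as the first difference
   need only be integral. *)
pose s m := if m is 0 then 0 else tau ^+ n * y.
have [|a ha] := complete_span H gx pz (erefl : s 0%N = 0).
  by case=> [|m]; rewrite /= ?subr0 // subrr vn_0.
set y' := \sum_j _ in ha; have E : y' = tau ^+ n * y.
  by apply: (vn_eq (w := w)) => m; apply: vn_leq (leqnSn m) (ha m.+1).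
pose t := FracField.tofrac (powserX k) ^+ n.
have t0 : t != 0 by rewrite expf_neq0 // tofrac_eq0 powserX_neq0.
have tE : t%:A = tau ^+ n by rewrite /tau -rmorphXn /= /ps /t rmorphXn.
exists (fun j l => t^-1 * a j l); transitivity (t^-1 *: y').
  by rewrite E -tE -scalerAl mul1r scalerA mulVf // scale1r.
rewrite /y' scaler_sumr; apply: eq_bigr => j _; rewrite scaler_sumr.
by apply: eq_bigr => l _; rewrite -scalerA !scalerAl.
Qed.

Lemma dim_le : (\dim {:D} <= p * e)%N.
Proof.
have [x gx] := exists_resgen H; have [z pz] := exists_param H.
pose X := [seq x ^+ j * z ^+ l | j <- iota 0 p, l <- iota 0 e].
have -> : (p * e)%N = size X by rewrite size_allpairs !size_iota.
apply: leq_trans (dim_span X); apply: dimvS; apply/subvP => y _.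
have [a ->] := D_span gx pz y; apply: memv_suml => j _; apply: memv_suml => l _.
rewrite -mulrA -scalerAl mul1r memvZ // memv_span //.
by apply/allpairsP; exists (val j, val l); rewrite !mem_iota /= !ltn_ord.
Qed.

Lemma scal_val (a : laurent k) : a != 0 -> (a%:A : D) != 0 /\ exists n : int, w a%:A = e%:Z * n.
Proof.
by move=> a0; rewrite scaler_eq0 (negPf a0) oner_eq0 w_e //; split=> //; exists (tval a).
Qed.

(** The value of the term of index l is congruent to l modulo e, so the nonzero terms have distinct
    values and the least one cannot be cancelled. *)
Lemma param_indep z (a : nat -> laurent k) n : parameter w z -> (n <= e)%N ->
  \sum_(l < n) a l *: z ^+ l = 0 -> forall l, (l < n)%N -> a l = 0.
Proof.
move=> pz ne S0 l1 l1n; apply/eqP/negPn/negP => a1.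
pose F (l : 'I_n) : D := a l *: z ^+ l.
have Fv (l : 'I_n) : F l != 0 -> exists m : int, w (F l) = e%:Z * m + l%:Z.
  rewrite /F scaler_eq0 negb_or => /andP [al0 zl0].
  have [al1 [m wm]] := scal_val al0; exists m.
  have -> : a l *: z ^+ l = (a l)%:A * z ^+ l by rewrite -scalerAl mul1r.
  by rewrite valM // wm (param_val H l pz).2.
have F1 : F (Ordinal l1n) != 0.
  by rewrite /F scaler_eq0 negb_or a1 (param_val H _ pz).1.
have [l0 F0 hmin] := exists_min_val w F1.
apply: (dominant_term (w := w) F0 _ S0) => l ne_l.
have [|Fl] := eqVneq (F l) 0; [by left | right].
rewrite lt_neqAle hmin // andbT; apply: contra ne_l => /eqP E; apply/eqP/val_inj => /=.
have [m wm] := Fv l Fl; have [m0 wm0] := Fv l0 F0; move: E; rewrite wm wm0.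
have ll := leq_trans (ltn_ord l) ne; have ll0 := leq_trans (ltn_ord l0) ne.
move: (nat_of_ord l) (nat_of_ord l0) ll ll0 => {l l0 F0 hmin Fl wm wm0} i j ie je.
case: (ltrgtP m m0) => [mm|mm|-> /addrI [//]]; last first.
  have : e%:Z * (m0 + 1) <= e%:Z * m by rewrite ler_wpM2l // lezD1.
  by rewrite mulrDr; move: (e%:Z * m) (e%:Z * m0) => a' b'; clear -ie je; lia.
have : e%:Z * (m + 1) <= e%:Z * m0 by rewrite ler_wpM2l // lezD1.
by rewrite mulrDr; move: (e%:Z * m) (e%:Z * m0) => a' b'; clear -ie je; lia.
Qed.

(** Dividing by a coefficient of least value makes all coefficients integral and one of them 1;
    reduction gives a nontrivial relation over k between powers of the residue of x. *)
Lemma resgen_indep x (a : nat -> laurent k) n : resgen w x -> (n <= p)%N ->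
  \sum_(j < n) a j *: x ^+ j = 0 -> forall j, (j < n)%N -> a j = 0.
Proof.
move=> gx np S0 j1 j1n; apply/eqP/negPn/negP => a1; have hx := gx.1.
pose F (j : 'I_n) : D := (a j)%:A.
have F1 : F (Ordinal j1n) != 0 by have [] := scal_val a1.
have [j0 F0 hmin] := exists_min_val w F1.
have a0 : a j0 != 0 by apply: contraNneq F0 => E; rewrite /F E scale0r.
pose b j := a j / a j0.
have bv (j : 'I_n) : vn 0 (b j)%:A.
  have -> : (b j)%:A = F j * (F j0)^-1.
    by apply: (mulIr (divD F0)); rewrite divrK ?divD // /F -scalerAl mul1r scalerA /b divfK.
  have [->|Fj] := eqVneq (F j) 0; first by rewrite mul0r vn_0.
  have i0 : (F j0)^-1 != 0 by rewrite invr_eq0.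
  rewrite /vge (negPf (div_mulf_neq0 divD Fj i0)) valM // valV // subr_ge0.
  exact: hmin.
have b_ex j : exists c, (j < n)%N -> vn 1 ((b j)%:A - cst c).
  have [jn|] := boolP (j < n)%N; last by exists 0.
  by have [c hc] := scal_residue divD e_gt0 w_e (bv (Ordinal jn)); exists c.
have /choice [c hc] := b_ex.
pose c' j := if (j < n)%N then c j else 0.
have Sc : vn 1 (\sum_(j < p) cst (c' j) * x ^+ j).
  have -> : \sum_(j < p) cst (c' j) * x ^+ j = \sum_(j < n) cst (c j) * x ^+ j.
    rewrite (big_ord_widen p (fun j => cst (c j) * x ^+ j) np) [RHS]big_mkcond /=.
    by apply: eq_bigr => j _; rewrite /c'; case: ifP => // _; rewrite rmorph0 mul0r.
  have Sb : \sum_(j < n) (b j)%:A * x ^+ j = 0.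
    rewrite -[RHS](scaler0 _ (a j0)^-1) -[X in _ *: X]S0 scaler_sumr.
    by apply: eq_bigr => j _; rewrite scalerA -scalerAl mul1r mulrC.
  rewrite -[\sum_(j < n) _]subr0 -[X in _ - X]Sb -sumrB; apply: vn_sum => j _.
  by rewrite -mulrBl vnMr ?vnX0 // vnBC hc.
have := (resgen_basis H gx).2 _ Sc j0 (leq_trans (ltn_ord j0) np).
rewrite /c' ltn_ord => cj0; have := hc j0 (ltn_ord j0).
rewrite cj0 rmorph0 subr0 /b divff // scale1r /vge oner_eq0 val1.
by [].
Qed.

Lemma adjoin_dim_ge (y : D) n :
  (forall a : nat -> laurent k, forall m, (m <= n)%N ->
     \sum_(j < m) a j *: y ^+ j = 0 -> forall j, (j < m)%N -> a j = 0) ->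
  (n <= \dim <<1; y>>)%N.
Proof.
move=> indep; rewrite leqNgt; apply/negP; set d := \dim _ => dn.
have [c cE] := adjoin_spanP (memX_adjoin y d).
pose a j := if j == d then - 1 else c j.
have := indep a d.+1 dn _ d (ltnSn d); rewrite /a eqxx => E.
have /eqP : - 1 = 0 :> laurent k; last by rewrite oppr_eq0 oner_eq0.
apply: E; rewrite big_ord_recr /= eqxx scaleN1r cE; apply/eqP; rewrite subr_eq0.
by apply/eqP/eq_bigr => j _; rewrite ltn_eqF.
Qed.

Lemma comm_adjoin (y : D) : {in <<1; y>>%VS &, forall u v, u * v = v * u}.
Proof.
have sub (v : D) : y \in 'C[v]%VS -> (<<1; y>> <= 'C[v])%VS.
  move=> hv; apply: (@agenv_sub_modl _ _ _ 'C[v]%VS).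
    by rewrite -memvE cent1v1.
  rewrite prodvDl subv_add prod1v subvv /=.
  apply: (@prodv_sub _ _ _ _ 'C[v]%AS) => //.
move=> u v hu hv; apply/cent1vP; apply: (subvP (sub _ _)) hu.
by rewrite cent1vC; apply: (subvP (sub _ _)) hv; exact: cent1v_id.
Qed.

Lemma e_eq_p : e = p.
Proof.
have [x gx] := exists_resgen H; have [z pz] := exists_param H.
have hz : (e <= \dim <<1; z>>)%N.
  by apply: adjoin_dim_ge => a m me; exact: param_indep pz me.
have hx : (p <= \dim <<1; x>>)%N.
  by apply: adjoin_dim_ge => a m mp; exact: resgen_indep gx mp.
have cz := commutative_subalg_dim divD (wild_cent H) (L := <<1; z>>%AS) (@comm_adjoin z).
have cx := commutative_subalg_dim divD (wild_cent H) (L := <<1; x>>%AS) (@comm_adjoin x).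
have dl := dim_le; move: cz cx hz hx => /= cz cx hz hx.
apply/eqP; rewrite eqn_leq.
have z2 : (e ^ 2 <= p * e)%N by apply: leq_trans dl; apply: leq_trans cz; rewrite leq_exp2r.
have x2 : (p ^ 2 <= p * e)%N by apply: leq_trans dl; apply: leq_trans cx; rewrite leq_exp2r.
by move: z2 x2; rewrite -!mulnn leq_pmul2r // leq_pmul2l // => -> ->.
Qed.

Lemma dim_D : \dim {:D} = (p ^ 2)%N.
Proof.
have [x gx] := exists_resgen H.
have hx : (p <= \dim <<1; x>>)%N.
  by apply: adjoin_dim_ge => a m mp; exact: resgen_indep gx mp.
have cx := commutative_subalg_dim divD (wild_cent H) (L := <<1; x>>%AS) (@comm_adjoin x).
apply/eqP; rewrite eqn_leq; apply/andP; split.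
  by have := dim_le; rewrite e_eq_p mulnn.
by apply: leq_trans cx; rewrite leq_exp2r.
Qed.

Lemma dim_aspace (A : {aspace D}) : [\/ \dim A = 1%N, \dim A = p | \dim A = (p ^ 2)%N].
Proof.
have : (\dim A %| p ^ 2)%N.
  by rewrite -dim_D; apply: (@skew_field_dimS _ _ divD A {:D}%AS); exact: subvf.
case/(dvdn_pfactor _ _ p_pr) => [] [|[|[|m]]] //= _ ->.
- by constructor 1. - by constructor 2. - by constructor 3.
Qed.

Lemma dim_proper_aspace (A : {aspace D}) : 1 \in A -> (A != 1%VS :> {vspace D}) ->
  (A != {:D}%VS :> {vspace D}) -> \dim A = p.
Proof.
move=> A1 AN1 ANf; have [d|//|d] := dim_aspace A.
  by case/eqP: AN1; apply/esym/eqP; rewrite eqEdim -memvE A1 d dimv1.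
by case/eqP: ANf; apply/eqP; rewrite eqEdim subvf dim_D d /=.
Qed.

Lemma not_comm_D : ~ (forall u v : D, u * v = v * u).
Proof.
move=> cD; have : {:D}%VS = 1%VS.
  rewrite -(wild_cent H); apply/eqP; rewrite eqEsubv subvf andbT.
  by apply/subvP => u _; rewrite memv_cap memvf; apply/centvP => v _; exact: cD.
move/(congr1 (fun U => \dim U)); rewrite dim_D dimv1 => /eqP.
by rewrite -mulnn muln_eq1 andbb => /eqP p1; move: p_pr; rewrite p1.
Qed.

Lemma dim_adjoin (y : D) : y \notin 1%VS -> \dim <<1; y>> = p.
Proof.
move=> yN1; apply: (dim_proper_aspace (A := <<1; y>>%AS)).
- by rewrite (subvP (sub1_agenv _)) // memv_line.
- by apply: contraNneq yN1 => <-; exact: memv_adjoin.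
apply/eqP => yf; apply: not_comm_D => u v; apply: (@comm_adjoin y).
  by rewrite [<<1; y>>%VS]yf memvf.
by rewrite [<<1; y>>%VS]yf memvf.
Qed.

Lemma adjoin_sub_cent1 (y : D) : (<<1; y>> <= 'C[y])%VS.
Proof.
by apply/subvP => u hu; apply/cent1vP; apply: (@comm_adjoin y) => //; exact: memv_adjoin.
Qed.

(** F(y) lies in the centralizer, and both are subalgebras other than F and D; as dimensions of
    subalgebras divide p^2, both have dimension p. *)
Lemma cent1_adjoin (y : D) : y \notin 1%VS -> 'C[y]%VS = <<1; y>>%VS.
Proof.
move=> yN1; apply/esym/eqP; rewrite eqEdim adjoin_sub_cent1 dim_adjoin //=.
suff -> : \dim 'C[y] = p by [].
apply: (dim_proper_aspace (A := 'C[y]%AS)); first exact: cent1v1.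
  by apply: contraNneq yN1 => <-; exact: cent1v_id.
apply: contraNneq yN1 => Cf; rewrite -(wild_cent H) memv_cap memvf /=.
apply/centvP => v _; apply/esym/cent1vP.
by rewrite -[(v \in _)]/(v \in ('C[y]%AS : {vspace D})) Cf memvf.
Qed.

(** If y is not central its centralizer is F(y), which is commutative, yet it would contain the
    noncommuting x and h. *)
Lemma central_criterion (x h y : D) : adj x h != 0 -> adj y x = 0 -> adj y h = 0 ->
  y \in 1%VS.
Proof.
move=> xh /adjP yx /adjP yh; apply/negPn/negP => yN1; case/eqP: xh; apply/adjP.
by apply: (@comm_adjoin y); rewrite -cent1_adjoin //; apply/cent1vP.
Qed.

Lemma central_mem (y : D) : (forall v, adj y v = 0) -> y \in 1%VS.
Proof.
move=> h; rewrite -(wild_cent H) memv_cap memvf /=.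
by apply/centvP => v _; apply/adjP/h.
Qed.

Lemma mem1_adj (y v : D) : y \in 1%VS -> adj y v = 0.
Proof. by case/vlineP => c ->; apply/adjP/scal_comm. Qed.

Lemma resgen_notin1 x : resgen w x -> x \notin 1%VS.
Proof.
case=> hx gx; apply/negP => /vlineP [c xc]; rewrite xc in hx gx.
by have [d hd] := scal_residue divD e_gt0 w_e hx; exact: (gx d).
Qed.

End Dimension.

(** * Completeness, and embeddings as limits of polynomial lifts *)

Section Embedding.
Variables (k : fieldType) (D : falgType (laurent k)) (w : valuation D) (p e : nat).
Hypothesis H : wild w p e.

Let divD := wild_div H.
Let w_e := wild_val H.
Local Notation vn := (vge w).
Local Notation cst := (cst D).
Local Notation rho := (rho w).

Lemma complete (s : nat -> D) : (forall n, vn n (s n.+1 - s n)) ->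
  exists y, forall n, vn n (y - s n).
Proof.
move=> hs; have [x gx] := exists_resgen H; have [z pz] := exists_param H.
have [|n|a ha] := @complete_span _ _ _ _ _ H _ _ gx pz (fun n => s n - s 0%N).
- exact: subrr.
- by rewrite opprB addrA subrK.
set y := \sum_j _ in ha; exists (y + s 0%N) => n.
by have := ha n; rewrite opprB addrA.
Qed.

Lemma lim_adj (y v : D) (s : nat -> D) : (forall n, vn n (y - s n)) ->
  vn 0 v -> (forall n, vn n (adj (s n) v)) -> adj y v = 0.
Proof.
move=> ys hv hs; apply: (vn_inf (w := w)) => n.
rewrite -[y](subrK (s n)) adjDl vnD //.
by have := vn_adj divD (ys n) hv; rewrite addn0.
Qed.

Lemma vn_adj_unit (a b : D) : vn 0 a -> vn 0 b -> vn 1 (adj a b).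
Proof.
move=> ha hb; rewrite -rho_eq0; last by rewrite (vn_adj divD (m := 0) (n := 0)).
have [hab hba] := (vnMl divD ha hb, vnMl divD hb ha).
by rewrite /adj rhoB // !rhoM // (wild_comm H) subrr.
Qed.

Lemma cst_commr (x : D) : commr_rmorph cst x.
Proof. by move=> c; apply/commr_sym/cst_comm. Qed.

Definition ev (x : D) : {rmorphism {poly k} -> D} := horner_morph (cst_commr x).

Lemma ev_wide (x : D) (q : {poly k}) n : (size q <= n)%N ->
  ev x q = \sum_(j < n) cst q`_j * x ^+ j.
Proof.
move=> sz; rewrite /= /horner_morph (horner_coef_wide x (leq_trans (size_poly _ _) sz)).
by apply: eq_bigr => j _; rewrite coef_map.
Qed.

Lemma ev_poly (x : D) (c : nat -> k) n :
  ev x (\poly_(j < n) c j) = \sum_(j < n) cst (c j) * x ^+ j.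
Proof.
rewrite (@ev_wide _ _ n (size_poly _ _)).
by apply: eq_bigr => j _; rewrite coef_poly ltn_ord.
Qed.

Lemma ev_X (x : D) : ev x 'X = x. Proof. exact: horner_morphX. Qed.
Lemma ev_C (x : D) c : ev x c%:P = cst c. Proof. exact: horner_morphC. Qed.

Lemma vn_ev (x : D) q : vn 0 x -> vn 0 (ev x q).
Proof.
move=> hx; rewrite (@ev_wide _ _ (size q)) //; apply: vn_sum => j _.
by rewrite (vnMl divD) ?vnX0 // (vn_cst w_e).
Qed.

Lemma ev_comm (x v : D) q : adj x v = 0 -> adj (ev x q) v = 0.
Proof.
move=> /adjP xv; rewrite (@ev_wide _ _ (size q)) //; apply/adjP/commr_sym.
apply: commr_sum => j _; apply: commrM; first exact/commr_sym/cst_comm.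
exact/commrX/commr_sym.
Qed.

Variables (x : D) (P : nat -> {poly k} -> Prop).
Hypothesis hx : vn 0 x.
Hypothesis P1 : forall n, P n 1.
Hypothesis PB : forall n q r, P n q -> P n r -> P n (q - r).
Hypothesis PM : forall n q r, P n q -> P n r -> P n (q * r).
Hypothesis PS : forall n q, P n.+1 q -> P n q.
Hypothesis P_onto : forall n y, vn 0 y -> exists2 q, P n q & vn 1 (y - ev x q).
Hypothesis P_inj : forall n q, P n q -> vn 1 (ev x q) -> vn n (ev x q).

(* [P n q] says that [q] may be used modulo the n-th power of the maximal ideal:
   residues have lifts [ev x q] with [P n q] which are unique to precision n,
   so the limits of these lifts form an embedding. *)
Lemma approx_embedding : exists u : {rmorphism residue_ring w -> vring w},
  embedding u /\
  forall a n q, P n q -> rho (ev x q) = a -> vn n (val (u a) - ev x q).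
Proof.
have hev q := vn_ev q hx.
have Ule a : exists U, vn 0 U /\ forall n q, P n q -> rho (ev x q) = a -> vn n (U - ev x q).
  have [y hy ya] := rho_surj a.
  have /choice [q hq] : forall n, exists q, P n q /\ vn 1 (y - ev x q).
    by move=> n; have [q Pq hq] := P_onto n hy; exists q.
  have rq n : rho (ev x (q n)) = a.
    by rewrite -ya; apply/rhoP => //; rewrite vnBC (hq n).2.
  have near n r : P n r -> rho (ev x r) = a -> vn n (ev x r - ev x (q n)).
    move=> Pr ra; rewrite -rmorphB; apply: P_inj; first exact: PB Pr (hq n).1.
    by rewrite rmorphB; apply/rhoP => //; rewrite ra rq.
  have [U hU] := @complete (fun n => ev x (q n)) (fun n => near n _ (PS (hq n.+1).1) (rq n.+1)).
  exists U; split=> [|n r Pr ra].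
    by rewrite -[U](subrK (ev x (q 0%N))) vnD // hU.
  by apply: vn_trans (hU n) _; rewrite vnBC; exact: near.
have /choice [U hU] := Ule.
(* Any element with admissible approximations of residue a at all precisions is [U a], so the ring
   morphism laws follow by combining approximations with [PB] and [PM]. *)
have Uuniq a v : (forall n, exists q, [/\ P n q, rho (ev x q) = a & vn n (v - ev x q)]) -> U a = v.
  move=> h; apply: (vn_eq (w := w)) => n; have [q [Pq qa vq]] := h n.
  by apply: vn_trans ((hU a).2 n q Pq qa) _; rewrite vnBC.
have Uex a n : exists q, [/\ P n q, rho (ev x q) = a & vn n (U a - ev x q)].
  have [y hy ya] := rho_surj a; have [q Pq hq] := P_onto n hy.
  have qa : rho (ev x q) = a by rewrite -ya; apply/rhoP => //; rewrite vnBC.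
  by exists q; split=> //; exact: (hU a).2.
pose u a : vring w := insubd 0 (U a).
have uE a : val (u a) = U a by rewrite insubdK // mem_vring (hU a).1.
have uB : zmod_morphism u.
  move=> a b; apply: val_inj; rewrite raddfB /= -/(u _) !uE; apply: Uuniq => n.
  have [q [Pq qa aq]] := Uex a n; have [r [Pr rb br]] := Uex b n.
  exists (q - r); split; first exact: PB.
    by rewrite rmorphB rhoB // qa rb.
  by rewrite rmorphB opprD addrACA -opprD vnB.
have uM : monoid_morphism u.
  split=> [|a b]; apply: val_inj; rewrite uE.
    apply: Uuniq => n; exists 1; split=> //; first by rewrite rmorph1 rho1.
    by rewrite !rmorph1 subrr vn_0.
  rewrite rmorphM /= -!/(u _) !uE; apply: Uuniq => n.
  have [q [Pq qa aq]] := Uex a n; have [r [Pr rb br]] := Uex b n.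
  exists (q * r); split; first exact: PM.
    by rewrite rmorphM rhoM // qa rb.
  have -> : U a * U b - ev x (q * r) = (U a - ev x q) * U b + ev x q * (U b - ev x r).
    by rewrite rmorphM mulrBl mulrBr addrA subrK.
  by rewrite vnD ?(vnMr divD aq) ?(hU b).1 // vnMl.
pose uR : {rmorphism residue_ring w -> vring w} :=
  HB.pack u (GRing.isZmodMorphism.Build _ _ _ uB) (GRing.isMonoidMorphism.Build _ _ _ uM).
exists uR.
split=> [a|a n q Pq qa] /=; last by rewrite uE; exact: (hU a).2.
have [q [Pq qa aq]] := Uex a 1%N; rewrite -rho_val uE -[RHS]qa.
by apply/rhoP => //; exact: (hU a).1.
Qed.

End Embedding.

Section Frobenius.
Variables (R : nzRingType) (p : nat).
Hypothesis Rp : p \in [pchar R].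

Lemma expr_pcharD (x y : R) : GRing.comm x y -> (x + y) ^+ p = x ^+ p + y ^+ p.
Proof. by move=> xy; have := pFrobenius_autD_comm Rp xy. Qed.

Lemma expr_pcharB (x y : R) : GRing.comm x y -> (x - y) ^+ p = x ^+ p - y ^+ p.
Proof. by move=> xy; have := pFrobenius_autB_comm Rp xy. Qed.

Lemma expr_pchar_sum (F : nat -> R) n :
  (forall i j, GRing.comm (F i) (F j)) ->
  (\sum_(i < n) F i) ^+ p = \sum_(i < n) F i ^+ p.
Proof.
have p0 : (0 < p)%N := prime_gt0 (pcharf_prime Rp).
move=> cF; elim: n => [|n IH]; first by rewrite !big_ord0 expr0n; case: p p0.
rewrite !big_ord_recr /= expr_pcharD ?IH //.
by apply/commr_sym/commr_sum => i _.
Qed.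
End Frobenius.

(** * An Artin-Schreier generator when conjugation moves residues *)

Section NontrivialResidueAction.
Variables (k : fieldType) (D : falgType (laurent k)) (w : valuation D) (p e : nat).
Hypothesis H : wild w p e.

Let divD := wild_div H.
Let w_e := wild_val H.
Let Dp := wild_char H.
Let p_pr : prime p := pcharf_prime (wild_char H).
Let p_gt0 : (0 < p)%N := prime_gt0 p_pr.
Local Notation vn := (vge w).
Local Notation cst := (cst D).
Local Notation rho := (rho w).

Let vnc c : vn 0 (cst c) := vn_cst w_e c.
Let vnle m n (y : D) : (m <= n)%N -> vn n y -> vn m y := @vn_leq D w m n y.

Lemma pchar_res : p \in [pchar residue_ring w].
Proof.
apply/andP; split=> //; apply/eqP.
have natE n : rho n%:R = n%:R.
  elim: n => [|n IH]; first by rewrite rho0.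
  by rewrite -!natr1 rhoD ?vn1 ?vn_nat // IH rho1.
by rewrite -natE (pcharf0 Dp) rho0.
Qed.

Variables (z y0 : D).
Hypotheses (pz : parameter w z) (hy0 : vn 0 y0) (moved : ~ vn 1 (z * y0 * z^-1 - y0)).

Let z0 : z != 0 := pz.1.
Let Uz : z \is a GRing.unit := divD z0.
Let sg (y : D) := z * y * z^-1.
Let dl (y : D) := sg y - y.

Let sgD : {morph sg : a b / a + b}.
Proof. by move=> a b; rewrite /sg mulrDr mulrDl. Qed.
Let sgM a b : sg (a * b) = sg a * sg b.
Proof. by rewrite /sg !mulrA mulrVK. Qed.
Let sgX a n : sg (a ^+ n) = sg a ^+ n.
Proof.
elim: n => [|n IH]; first by rewrite !expr0 /sg mulr1 mulrV.
by rewrite exprS sgM IH exprS.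
Qed.
Let sgB a b : sg (a - b) = sg a - sg b.
Proof. by rewrite /sg mulrBr mulrBl. Qed.
Let sgc c : sg (cst c) = cst c.
Proof. by rewrite /sg -(cst_comm c z) mulrK. Qed.
Let vnsg n a : vn n a -> vn n (sg a).
Proof.
move=> ha; apply: (vn_divr divD (n := 1)) => //; first exact: pz.2.
by rewrite addn1 -add1n; apply: (vnM divD) => //; exact: param_vn pz.
Qed.
Let dlD : {morph dl : a b / a + b}.
Proof. by move=> a b; rewrite /dl sgD opprD addrACA. Qed.
Let vndl n a : vn n a -> vn n (dl a).
Proof. by move=> ha; rewrite vnB ?vnsg. Qed.
Let dlcr a c : dl (a * cst c) = dl a * cst c.
Proof. by rewrite /dl sgM sgc mulrBl. Qed.

(* z^p / t is a unit, and units act trivially on the commutative residue field. *)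
Let dl_nil a : vn 0 a -> vn 1 (iter p dl a).
Proof.
move=> ha; have Ap (y : D) : y *+ p = 0 by rewrite -mulr_natr (pcharf0 Dp) mulr0.
(* In characteristic p, (alpha - 1)^p = alpha^p - 1. *)
have := pchar_iter_addf dlD (fun a b => erefl : id (a + b) = id a + id b)
  (fun _ => erefl) p_pr Ap a.
have -> : (fun y => dl y + id y) = sg by apply: funext => y; rewrite /dl subrK.
have sgn n : iter n sg a = z ^+ n * a * z ^- n.
  elim: n => [|n IH]; first by rewrite /= mul1r invr1 mulr1.
  by rewrite /= IH exprS invrM ?unitrX // /sg !mulrA.
have idn n : iter n id a = a by elim: n => //= n ->.
rewrite sgn idn => /eqP; rewrite -subr_eq => /eqP <-.
pose v := z ^+ p / tau D.
have t0 : tau D != 0 := tau_neq0 D.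
have Ut := divD t0.
have [zp0 wzp] := param_val H p pz.
have it0 : (tau D)^-1 != 0 by rewrite invr_eq0.
have v0 : v != 0 by rewrite (div_mulf_neq0 divD).
have wv : w v = 0.
  by rewrite valM // valV // wzp (val_tau w_e) (e_eq_p H) subrr.
have hv : vn 0 v by rewrite /vge wv lexx orbT.
have Uv := divD v0.
have -> : z ^+ p * a * z ^- p - a = adj v a * v^-1.
  have -> : z ^+ p = v * tau D by rewrite /v mulrVK.
  by rewrite invrM // /adj mulrBl (mulrK Uv) -(mulrA v) (tau_comm a) !mulrA (mulrK Ut).
apply: (vn_divr divD (n := 0)) => //.
by rewrite addn0 (vn_adj_unit H).
Qed.

(** An element fixed modulo the maximal ideal and not congruent to a constant would generate the
    residue field, and the action would be trivial, against [moved]. *)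
Let dl_fixed c : vn 0 c -> vn 1 (dl c) -> exists d, vn 1 (c - cst d).
Proof.
move=> hc dc; apply: contrapT => nd; apply: moved.
have gc : resgen w c by split=> // d hd; apply: nd; exists d.
have [f hf] := (resgen_basis H gc).1 _ hy0.
rewrite -/(sg y0) -/(dl y0) -[y0](subrK (\sum_(j < p) cst (f j) * c ^+ j)) dlD.
apply: vnD; first exact: vndl.
have dlX j : vn 1 (dl (c ^+ j)).
  elim: j => [|j IH]; first by rewrite expr0 /dl /sg mulr1 mulrV // subrr vn_0.
  have -> : dl (c ^+ j.+1) = dl c * sg (c ^+ j) + c * dl (c ^+ j).
    by rewrite /dl exprS sgM mulrBl mulrBr addrA subrK.
  by rewrite vnD ?(vnMr divD dc) ?(vnMl divD hc IH) // vnsg // vnX0.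
rewrite (big_morph dl dlD (_ : dl 0 = 0)); last by rewrite /dl /sg mulr0 mul0r subrr.
apply: vn_sum => j _; rewrite (cst_comm (f j) (c ^+ j)) dlcr.
by apply: vnMr.
Qed.

(** The last nonzero iterate of alpha - 1 at the residue of [y0] is fixed by alpha, hence a constant
    d; dividing the iterate before it by d gives b0 with alpha(b0) = b0 + 1. Then b0^p - b0 is fixed
    too, hence constant. *)
Lemma artin_schreier_residue : exists b0 c,
  [/\ vn 0 b0, vn 1 (dl b0 - 1) & vn 1 (b0 ^+ p - b0 - cst c)].
Proof.
have ex : exists m, vn 1 (iter m dl y0) by exists p; exact: dl_nil.
case: (ex_minnP ex) => m hm mmin.
have hit n : vn 0 (iter n dl y0) by elim: n => //= n IH; exact: vndl.
case: m hm mmin => [|[|m]] hm mmin.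
- by case: moved; exact: vndl.
- by case: moved.
set y1 := iter m dl y0; set c1 := dl y1.
have hc1 : ~ vn 1 c1 by move=> h1; have := mmin m.+1 h1; rewrite ltnn.
have [d hd] := dl_fixed (hit m.+1) hm.
have d0 : d != 0.
  by apply/eqP => d0; apply: hc1; move: hd; rewrite d0 rmorph0 subr0.
pose b0 := y1 * cst d^-1.
have hb0 : vn 0 b0 := vnMr divD (hit m) (vnc _).
have db0 : vn 1 (dl b0 - 1).
  have -> : dl b0 - 1 = (c1 - cst d) * cst d^-1.
    have cdd : cst d * cst d^-1 = 1 by rewrite -[LHS](rmorphM cst) divff // rmorph1.
    by rewrite [RHS]mulrBl cdd /b0 dlcr.
  by apply: vnMr.
have [c hc] : exists c, vn 1 (b0 ^+ p - b0 - cst c).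
  apply: dl_fixed; first by rewrite vnB ?vnX0.
  have hs := vnsg hb0; have hsp : vn 0 (sg b0 ^+ p - sg b0) by rewrite vnB ?vnX0.
  have hbp : vn 0 (b0 ^+ p - b0) by rewrite vnB ?vnX0.
  rewrite /dl sgB sgX; apply/(rhoP hsp hbp).
  have E : rho (sg b0) = rho b0 + 1.
    rewrite -[1]rho1 -rhoD ?vn1 //; apply/rhoP => //; first by rewrite vnD ?vn1.
    by rewrite opprD addrA.
  rewrite !rhoB ?vnX0 // !rhoX // E (expr_pcharD pchar_res) ?expr1n; last exact: commr1.
  by rewrite opprD addrACA subrr addr0.
by exists b0, c.
Qed.

(** The error m = b0^p - b0 - c commutes with b0, so adding a y that commutes with b0 and satisfies
    y^p - y = -m makes the equation exact. *)
Lemma artin_schreier_lift : exists x c, resgen w x /\ x ^+ p - x = cst c.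
Proof.
have [b0 [c [hb0 db0 hm]]] := artin_schreier_residue.
set m := _ - cst c in hm.
have mb : GRing.comm m b0.
  apply/commr_sym/commrB; last exact/commr_sym/cst_comm.
  by apply: commrB => //; exact: commrX.
(* The sum y of the series of the m^(p^i) satisfies y^p = y - m. *)
pose s n := \sum_(i < n) m ^+ (p ^ i).
have p1 := prime_gt1 p_pr.
have [n|y hy] := complete H (s := s).
  rewrite /s big_ord_recr /= addrAC subrr add0r; apply: vnle (vnX divD (p ^ n) hm).
  by rewrite mul1n; exact/ltnW/ltn_expl.
have ym : vn 1 y.
  rewrite -[y](subrK (s 1%N)) vnD ?hy // /s big_ord_recl big_ord0 addr0.
  by rewrite expr1.
have sC n v : GRing.comm v m -> GRing.comm v (s n).
  by move=> vm; apply: commr_sum => i _; exact: commrX.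
have yb : GRing.comm b0 y.
  apply/commr_sym/adjP/(lim_adj H hy hb0) => n.
  have /adjP -> : GRing.comm (s n) b0 by apply/commr_sym/sC/commr_sym.
  exact: vn_0.
have hm0 : vn 0 m := vnle (leqnSn 0) hm.
have ymC : GRing.comm y m.
  apply/adjP/(lim_adj H hy hm0) => n.
  have /adjP -> : GRing.comm (s n) m by apply/commr_sym/sC.
  exact: vn_0.
have yp : y ^+ p = y - m.
  apply: (vn_eq (w := w)) => n.
  have ysn : GRing.comm y (s n) by exact: sC.
  have sp : s n ^+ p = s n - m + m ^+ (p ^ n).
    rewrite (expr_pchar_sum Dp (F := fun i => m ^+ (p ^ i))); last first.
      by move=> i j; apply/commrX/commr_sym/commrX.
    have -> : \sum_(i < n) (m ^+ (p ^ i)) ^+ p = \sum_(i < n) m ^+ (p ^ i.+1).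
      by apply: eq_bigr => i _; rewrite -exprM expnSr.
    have : s n.+1 = s n + m ^+ (p ^ n) by rewrite /s big_ord_recr.
    rewrite {1}/s big_ord_recl /= expr1 => E; apply: (addrI m).
    by rewrite [RHS]addrA [m + (_ - _)]addrC subrK -E.
  have -> : y ^+ p - (y - m) = (y - s n) ^+ p - (y - s n) + m ^+ (p ^ n).
    rewrite (expr_pcharB Dp ysn) sp; generalize (s n) (m ^+ (p ^ n)) m => B C M.
    rewrite !opprD !opprK !addrA [RHS](ACl (1*5*3*(2*6)*(4*7))%AC) /=.
    by rewrite !addNr !addr0.
  have pn : (n <= p ^ n)%N by exact/ltnW/ltn_expl.
  have hmp : vn n (m ^+ (p ^ n)) by apply: vnle (vnX divD (p ^ n) hm); rewrite mul1n.
  apply: vnD; last exact: hmp.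
  apply: vnB; last exact: hy.
  by apply: vnle (vnX divD p (hy n)); rewrite leq_pmulr.
exists (b0 + y), c; split; last first.
  rewrite (expr_pcharD Dp yb) yp /m !opprD !opprK !addrA.
  by rewrite [LHS](ACl (5*(1*3)*(2*7)*(4*6))%AC) /= !subrr !addr0.
(* A constant residue would be fixed by conjugation, whereas that of b0 is moved by 1. *)
split=> [|d hd]; first by rewrite vnD // (vnle (leqnSn 0)).
have : vn 1 (dl b0).
  have hbd : vn 1 (b0 - cst d).
    by have := vnB hd ym; rewrite addrAC addrK.
  have dlc : dl (cst d) = 0 by rewrite /dl sgc subrr.
  by rewrite -[b0](subrK (cst d)) dlD dlc addr0 vndl.
move=> h; have := vnB h db0; rewrite opprB addrC subrK /vge oner_eq0 val1.
by [].
Qed.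

End NontrivialResidueAction.

(** * Subfields as abstract extensions; a criterion for cyclicity *)

Section Subfields.
Variables (F : fieldType) (A : falgType F).
Hypothesis divA : division_ring A.

(** E becomes an abstract field extension of F embedded in A, so that root counting and Galois
    theory apply to it. *)
Lemma subfield_ext (E : {vspace A}) : is_subfield E ->
  exists (L : fieldExtType F) (f : {lrmorphism L -> A}),
    (forall y, y \in E <-> exists x, f x = y) /\ \dim {:L} = \dim E.
Proof.
case=> E1 EM EV EC.
have EA : is_aspace E.
  by rewrite /is_aspace has_algid1 //=; apply/prodvP => u v; exact: EM.
pose B : {aspace A} := ASpace EA.
have mulC : GRing.PzRing_hasCommutativeMul (subvs_of B).
  by constructor => u v; apply: val_inj; rewrite /= EC ?subvsP.
pose cL : comUnitRingType := HB.pack (subvs_of B) mulC.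
have fieldM : GRing.ComUnitRing_isField cL.
  constructor => u u0; apply: vsval_unitr; apply: divA.
  by apply: contra_neq u0 => u0; apply: val_inj.
pose L : fieldExtType F := HB.pack (subvs_of B) cL fieldM.
have vM : monoid_morphism (vsval : L -> A).
  by split=> //; apply/eqP; rewrite -[X in X == _]/(algid B) algid_eq1.
pose fv (x : L) : A := vsval x.
have fvL : linear fv by move=> a x y; exact: linearP.
pose f : {lrmorphism L -> A} := HB.pack fv (GRing.isLinear.Build F L A _ fv fvL)
  (GRing.isMonoidMorphism.Build L A fv vM).
exists L, f; split=> [y|]; last by rewrite dimvf.
split=> [Ey|[x <-]]; last exact: subvsP.
by exists (Subvs (Ey : y \in B)).
Qed.

Lemma lift_seq (L : fieldExtType F) (f : L -> A) (E : {vspace A}) (r : seq A) :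
  (forall y, y \in E <-> exists x, f x = y) -> {subset r <= E} ->
  exists s : seq L, r = map f s.
Proof.
move=> fE; elim: r => [|y r IH] rE; first by exists [::].
have [|s ->] := IH; first by move=> u ur; apply: rE; rewrite inE ur orbT.
have /fE [x <-] := rE y (mem_head _ _).
by exists (x :: s).
Qed.

Variables (E : {vspace A}) (q : {poly F}) (n : nat).
Hypotheses (subE : is_subfield E) (size_q : size q = n.+1).

Lemma horner_alg_subfield (L : fieldExtType F) (f : {lrmorphism L -> A}) x :
  horner_alg (f x) q = f (map_poly (in_alg L) q).[x].
Proof.
have szA : (size (map_poly (in_alg A) q) <= size q)%N := size_poly _ _.
have szL : (size (map_poly (in_alg L) q) <= size q)%N := size_poly _ _.
rewrite (horner_coef_wide x szL) rmorph_sum /=.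
rewrite -[LHS]/((map_poly (in_alg A) q).[f x]) (horner_coef_wide (f x) szA).
apply: eq_bigr => i _; rewrite !coef_map /= rmorphM rmorphXn /=.
by rewrite rmorph_alg.
Qed.

Lemma max_subfield_roots (r : seq A) : uniq r -> {subset r <= E} ->
  (forall y, y \in r -> horner_alg y q = 0) -> (size r <= n)%N.
Proof.
move=> Ur rE rq; have [L [f [fE dimL]]] := subfield_ext subE.
have [s sE] := lift_seq fE rE.
have finj : injective f := fmorph_inj _.
rewrite sE size_map -ltnS -size_q -(size_map_poly (in_alg L)).
apply: max_poly_roots.
- by rewrite -size_poly_eq0 size_map_poly size_q.
- apply/allP => x xs; rewrite rootE; apply/eqP/finj.
  by rewrite -horner_alg_subfield rmorph0 rq // sE map_f.
- by rewrite sE map_inj_uniq in Ur.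
Qed.

Hypotheses (n_pr : prime n) (dimE : \dim E = n).

(** One root lies outside F and the degree is prime, so the roots generate E, which is thus the
    splitting field of a polynomial with distinct roots; its Galois group has prime order n. *)
Lemma cyclic_of_roots (r : seq A) : uniq r -> size r = n -> {subset r <= E} ->
  (forall y, y \in r -> horner_alg y q = 0) -> has (fun y => y \notin 1%VS) r ->
  cyclic_galois E.
Proof.
move=> Ur sz rE rq rN1; have [L [f [fE dimL]]] := subfield_ext subE.
have [s sE] := lift_seq fE rE.
have finj : injective f := fmorph_inj _.
pose qL := map_poly (in_alg L) q.
have q1 : qL \is a polyOver 1%VS.
  by apply/polyOver1P; exists q.
have Us : uniq s by rewrite sE map_inj_uniq in Ur.
have qE : qL %= \prod_(y <- s) ('X - y%:P).
  rewrite (@all_roots_prod_XsubC _ qL s).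
  - by apply: eqp_scale; rewrite lead_coef_eq0 -size_poly_eq0 size_map_poly size_q.
  - by rewrite size_map_poly size_q -sz sE size_map.
  - apply/allP => x xs; rewrite rootE; apply/eqP/finj.
    by rewrite -horner_alg_subfield rmorph0 rq // sE map_f.
  - by rewrite uniq_rootsE.
have gen : <<1 & s>>%VS = {:L}%VS.
  have /hasP [y yr yN1] := rN1; move: yr; rewrite sE => /mapP [x xs yx].
  have : (\dim <<1 & s>> %| n)%N.
    by rewrite -dimE -dimL; apply: (@field_dimS _ _ <<1 & s>>%AS {:L}%AS); exact: subvf.
  have /primeP [_ dvn] := n_pr; move=> /dvn /orP [] /eqP d1; last first.
    by apply/eqP; rewrite eqEdim subvf d1 dimL dimE leqnn.
  have E1 : 1%VS = <<1 & s>>%VS.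
    apply/eqP; rewrite eqEdim d1 dimv1 leqnn andbT.
    exact: subv_trans (sub1_agenv _).
  case/negP: yN1; rewrite yx; have /vlineP [c ->] : x \in 1%VS.
    by rewrite E1; exact: seqv_sub_adjoin.
  by rewrite linearZ /= rmorph1; apply/vlineP; exists c.
have splM : FieldExt_isSplittingField F L.
  by constructor; exists qL => //; exists s.
pose M : splittingFieldType F := HB.pack L splM.
exists M, (linfun_ahom f); split.
- apply/vspaceP => y; apply/idP/idP.
    by case/memv_imgP => x _ ->; apply/fE; exists x; rewrite lfunE.
  by case/fE => x <-; rewrite -[f x](lfunE f) memv_img ?memvf.
- apply/splitting_galoisField; exists qL; split=> //.
    by rewrite (eqp_separable qE) separable_prod_XsubC.
  by exists s.
- apply: prime_cyclic; rewrite -galois_dim.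
    by rewrite dimv1 divn1 dimL dimE.
  apply/splitting_galoisField; exists qL; split=> //.
    by rewrite (eqp_separable qE) separable_prod_XsubC.
  by exists s.
Qed.

End Subfields.

(** * Maximal subfields; the case of a nontrivial action *)

Section ArtinSchreier.
Variables (k : fieldType) (D : falgType (laurent k)) (w : valuation D) (p e : nat).
Hypothesis H : wild w p e.

Let divD := wild_div H.
Let Dp := wild_char H.
Let p_pr : prime p := pcharf_prime (wild_char H).
Let p_gt0 : (0 < p)%N := prime_gt0 p_pr.
Local Notation vn := (vge w).
Local Notation cst := (cst D).

Lemma adjoin_is_subfield (y : D) : is_subfield <<1; y>>%VS.
Proof.
split.
- by rewrite (subvP (sub1_agenv _)) // memv_line.
- by move=> u v; exact: (@memvM _ _ <<1; y>>%AS).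
- by move=> u; rewrite -(@memvV _ _ <<1; y>>%AS).
- exact: comm_adjoin.
Qed.

Lemma subfield_dim_le (E : {vspace D}) : is_subfield E -> (\dim E <= p)%N.
Proof.
case=> E1 EM EV EC.
have EA : is_aspace E.
  by rewrite /is_aspace has_algid1 //=; apply/prodvP => u v; exact: EM.
have [/= ->|/= -> //|/= d] := dim_aspace H (ASpace EA); first exact: p_gt0.
have Ef : E = {:D}%VS by apply/eqP; rewrite eqEdim subvf (dim_D H) d leqnn.
by case: (not_comm_D H) => u v; apply: EC; rewrite Ef memvf.
Qed.

Lemma maximal_subfield_dim (E : {vspace D}) :
  is_subfield E -> \dim E = p -> maximal_subfield E.
Proof.
move=> subE dE; split=> // E' subE' sEE'; apply/esym/eqP.
by rewrite eqEdim sEE' dE subfield_dim_le.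
Qed.

Lemma maximal_adjoin (y : D) : y \notin 1%VS -> maximal_subfield <<1; y>>%VS.
Proof.
by move=> y1; apply: maximal_subfield_dim; [exact: adjoin_is_subfield | exact: (dim_adjoin H)].
Qed.

Lemma nat_pchar_inj (R : nzRingType) (i j : nat) : p \in [pchar R] ->
  (i < p)%N -> (j < p)%N -> i%:R = j%:R :> R -> i = j.
Proof.
move=> Rp; wlog ij : i j / (i <= j)%N => [wl|] ip jp E.
  by case/orP: (leq_total i j) => h; [exact: wl | apply/esym/wl].
have : (j - i)%:R = 0 :> R by rewrite natrB // E subrr.
move/eqP; rewrite -(dvdn_pcharf Rp) => dv; apply/eqP; rewrite eqn_leq ij /=.
rewrite -subn_eq0; apply: contraTT dv => nz; rewrite gtnNdvd ?lt0n //.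
exact: leq_ltn_trans (leq_subr _ _) jp.
Qed.

Lemma cyclic_adjoin_roots (y : D) (q : {poly laurent k}) (r : nat -> D) :
  y \notin 1%VS -> size q = p.+1 ->
  (forall i, (i < p)%N -> r i \in <<1; y>>%VS /\ horner_alg (r i) q = 0) ->
  (forall i j, (i < p)%N -> (j < p)%N -> r i = r j -> i = j) ->
  r 0%N \notin 1%VS -> cyclic_galois <<1; y>>%VS.
Proof.
move=> y1 sq hr rinj r0.
apply: (@cyclic_of_roots _ D divD _ q p (adjoin_is_subfield y) sq p_pr (dim_adjoin H y1)
  [seq r i | i <- iota 0 p]).
- rewrite map_inj_in_uniq ?iota_uniq // => i j; rewrite !mem_iota /= => ip jp.
  exact: rinj.
- by rewrite size_map size_iota.
- by move=> u /mapP [i]; rewrite mem_iota => /hr [ri _] ->.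
- by move=> u /mapP [i]; rewrite mem_iota => /hr [_ ri] ->.
- by apply/hasP; exists (r 0%N) => //; apply: map_f; rewrite mem_iota.
Qed.

(** The roots of X^p - X - c in F(h) are h, h + 1, ..., h + p - 1. *)
Lemma artin_schreier_cyclic (h : D) : h \notin 1%VS -> h ^+ p - h \in 1%VS ->
  cyclic_division_algebra D p.
Proof.
move=> h1 /vlineP [c hc]; split=> //; first exact: wild_cent H.
  exact: (dim_D H).
exists <<1; h>>%VS; first exact: maximal_adjoin.
have p1 := prime_gt1 p_pr.
have sq : size ('X^p - 'X - c%:P : {poly laurent k}) = p.+1.
  rewrite -addrA -opprD size_polyDl size_polyXn // size_polyN.
  by rewrite size_XaddC.
apply: (cyclic_adjoin_roots (r := fun i => h + i%:R) h1 sq).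
- move=> i ip; have hi : h + i%:R \in <<1; h>>%VS.
    rewrite memvD ?memv_adjoin // (subvP (sub1_agenv _)) // -scaler_nat.
    by rewrite memvZ ?memv_line.
  split=> //; rewrite !rmorphB rmorphXn /= horner_algX horner_algC.
  have natp : (i%:R : D) ^+ p = i%:R by rewrite -(pFrobenius_autE Dp) pFrobenius_aut_nat.
  rewrite (expr_pcharD Dp); last exact: commr_nat.
  by rewrite natp opprD addrACA subrr addr0 hc subrr.
- by move=> i j ip jp /addrI; exact: nat_pchar_inj.
- by rewrite addr0.
Qed.

Lemma nontrivial_action_conclusion (z y0 : D) :
  parameter w z -> vn 0 y0 -> ~ vn 1 (z * y0 * z^-1 - y0) ->
  splittable w /\ cyclic_division_algebra D p.
Proof.
move=> pz hy moved; have [x [c [gx xc]]] := artin_schreier_lift H pz hy moved.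
have hx := gx.1; have [S1 S2] := resgen_basis H gx.
have p1 := prime_gt1 p_pr.
split; last first.
  apply: (@artin_schreier_cyclic x); first exact: (resgen_notin1 H).
  by rewrite xc; apply/vlineP; exists (FracField.tofrac (powserC c)).
pose q0 : {poly k} := 'X^p - 'X - c%:P.
have sq : size q0 = p.+1.
  rewrite /q0 -addrA -opprD size_polyDl size_polyXn // size_polyN.
  by rewrite size_XaddC.
have q00 : q0 != 0 by rewrite -size_poly_eq0 sq.
have evq0 : ev x q0 = 0.
  by rewrite /q0 !rmorphB rmorphXn /= -!/(ev x _) ev_X ev_C xc subrr.
have := @approx_embedding _ _ _ _ _ H x (fun _ _ => True) hx.
case=> // [n y hy'|n q _ hq|u [hu _]]; last by exists u.
  have [f hf] := S1 y hy'; exists (\poly_(j < p) f j) => //.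
  by rewrite ev_poly.
suff -> : ev x q = 0 by exact: vn_0.
have sz : (size (q %% q0)%R <= p)%N by rewrite -ltnS -sq ltn_modp.
move: hq; rewrite (divp_eq q q0) rmorphD rmorphM evq0 mulr0 add0r.
rewrite (ev_wide _ sz) => /S2 h; rewrite big1 // => j _.
by rewrite h // rmorph0 mul0r.
Qed.

End ArtinSchreier.

(** * The Poisson bracket on the graded ring; invariance of the height *)

Section TrivialResidueAction.
Variables (k : fieldType) (D : falgType (laurent k)) (w : valuation D) (p e : nat).
Hypothesis H : wild w p e.

Let divD := wild_div H.
Let w_e := wild_val H.
Let Dp := wild_char H.
Let p_pr : prime p := pcharf_prime (wild_char H).
Local Notation vn := (vge w).
Local Notation cst := (cst D).
Local Notation resgen := (resgen w).
Local Notation param := (parameter w).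

Let vnc c : vn 0 (cst c) := vn_cst w_e c.
Let vnle m n (y : D) : (m <= n)%N -> vn n y -> vn m y := @vn_leq D w m n y.

Lemma adj_cst (c : k) (y : D) : adj y (cst c) = 0.
Proof. by apply/adjP/commr_sym/cst_comm. Qed.

Lemma vn_adj_pow n (y x : D) j : vn 0 x -> vn n (adj y x) -> vn n (adj y (x ^+ j)).
Proof.
move=> hx h; elim: j => [|j IH]; first by rewrite expr0 -(rmorph1 cst) adj_cst vn_0.
by rewrite exprS adjM vnD ?(vnMr divD h) ?vnX0 // vnMl.
Qed.

Lemma vn_adj_pow_sum n (y x : D) (c : nat -> k) m : vn 0 x -> vn n (adj y x) ->
  vn n (adj y (\sum_(j < m) cst (c j) * x ^+ j)).
Proof.
move=> hx h; rewrite adj_sum; apply: vn_sum => j _.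
by rewrite adjM adj_cst mul0r add0r vnMl // vn_adj_pow.
Qed.

Lemma param_div z n y : param z -> vn n y -> exists2 v, vn 0 v & y = v * z ^+ n.
Proof.
move=> pz hy; have [zn0 wz] := param_val H n pz.
by exists (y * z ^- n); rewrite ?mulrVK ?divD //; apply: (vn_divr divD zn0 wz).
Qed.

(** The shift by one between i and the value of [z, x] comes from [z, x] = (z x z^-1 - x) z, and i >
    0 because the action is trivial. The bracket is not 0: otherwise x would commute with the
    products x^j z^l, which span D. *)
Lemma exists_height x z : resgen x -> param z ->
  (forall y, vn 0 y -> vn 1 (z * y * z^-1 - y)) ->
  exists2 i, (0 < i)%N & vn i.+1 (adj z x) && ~~ vn i.+2 (adj z x).
Proof.
move=> gx pz triv; have hx := gx.1.
have nz : adj z x != 0.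
  apply: contraNneq (resgen_notin1 H gx) => /adjP zx; apply: (central_mem H) => v.
  have [a ->] := D_span H gx pz v; apply/adjP.
  apply: commr_sum => j _; apply: commr_sum => l _; apply: commrM.
    by apply: commrM; [exact/commr_sym/scal_comm | exact: commrX].
  exact/commrX/commr_sym.
have h2 : vn 2 (adj z x).
  have -> : adj z x = (z * x * z^-1 - x) * z.
    by rewrite /adj mulrBl mulrVK // divD // pz.1.
  by apply: (vnM divD (m := 1) (n := 1)); [exact: triv | exact: param_vn pz].
pose P n := ~~ vn n (adj z x).
have exP : exists n, P n.
  apply/not_existsP => h; case/eqP: nz; apply: (vn_inf (w := w)) => n.
  by apply/negPn/negP; exact: h.
case: (ex_minnP exP) => m Pm mmin.
have m2 : (2 < m)%N by rewrite ltnNge; apply: contra Pm => /vnle; apply.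
exists m.-2; first by rewrite -subn2 subn_gt0.
case: m m2 Pm mmin => [|[|m]] //= m2 Pm mmin; rewrite -/(P _) Pm andbT.
by apply/negPn/negP => /mmin; rewrite ltnn.
Qed.

Variables (x z : D) (i : nat).
Hypotheses (gx : resgen x) (pz : param z) (i_gt0 : (0 < i)%N).
Hypotheses (hi : vn i.+1 (adj z x)) (hi' : ~~ vn i.+2 (adj z x)).

Let hx : vn 0 x := gx.1.
Let hz : vn 1 z := param_vn pz.

(* [adj y'] is a derivation, so its order is governed by its values at x and z. *)
Let derivation_bound (y' : D) c0 : vn c0 y' -> vn (c0 + i) (adj y' x) ->
  vn (c0 + i).+1 (adj y' z) -> forall m y, vn m y -> vn (m + c0 + i) (adj y' y).
Proof.
move=> hy' dx dz.
have dzm m : vn (m + c0 + i) (adj y' (z ^+ m)).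
  elim: m => [|m IH]; first by rewrite expr0 -(rmorph1 cst) adj_cst vn_0.
  rewrite exprS adjM vnD //.
    have := vnM divD dz (vnX divD m hz); rewrite mul1n; apply: vnle.
    by rewrite -addnA addnC addSn addnS.
  by have := vnM divD hz IH; rewrite !addSn add0n.
(* The gain L over the trivial bound grows by one at a time: the part of y left after its leading
   digit lies one level deeper, and this pays for the step. *)
suff W L : (L <= i)%N -> forall m y, vn m y -> vn (m + c0 + L) (adj y' y).
  by move=> m y; apply: W.
elim: L => [|L IH] Li m y hy.
  by rewrite addn0 addnC (vn_adj divD).
have [v hv ->] := param_div pz hy.
have [c hc] := (resgen_basis H gx).1 _ hv.
rewrite -[v](subrK (\sum_(j < p) cst (c j) * x ^+ j)) mulrDl adjDr.
set s := \sum_(j < p) _ in hc *; have hs : vn 0 s by rewrite (vn_pow_sum H).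
apply: vnD.
  have h1 : vn m.+1 ((v - s) * z ^+ m).
    by have := vnM divD hc (vnX divD m hz); rewrite mul1n add1n.
  by have := IH (ltnW Li) _ _ h1; rewrite !addSn addnS.
rewrite adjM; apply: vnD.
  have := vnM divD (vn_adj_pow_sum c p hx dx) (vnX divD m hz); rewrite mul1n.
  by apply: vnle; rewrite -addnA addnC leq_add2r leq_add2l.
apply: (vnMl divD hs); apply: vnle (dzm m); rewrite leq_add2l; exact: Li.
Qed.

Let bracket_x m y : vn m y -> vn (m + i) (adj x y).
Proof.
move=> hy; rewrite -[m]addn0; apply: derivation_bound => //.
  by rewrite /adj subrr vn_0.
by rewrite adjC vnN.
Qed.

Let bracket_z m y : vn m y -> vn (m + 1 + i) (adj z y).
Proof.
move=> hy; apply: derivation_bound => //.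
by rewrite /adj subrr vn_0.
Qed.

(** [derivation_bound] is applied to [adj b], whose effect on x and z is bounded by the same
    statement for [adj x] and [adj z]. *)
Lemma bracket m n a b : vn m a -> vn n b -> vn (m + n + i) (adj a b).
Proof.
move=> ha hb; rewrite (addnC m); apply: derivation_bound => //.
  by rewrite adjC vnN; exact: bracket_x.
by rewrite adjC vnN -addSn -addn1; exact: bracket_z.
Qed.

(** Residues are polynomials in that of x, and polynomials in x commute, so the Poisson bracket
    vanishes in degree 0 and one more unit is gained. *)
Lemma bracket_unit a b : vn 0 a -> vn 0 b -> vn i.+1 (adj a b).
Proof.
have bx c : vn 0 c -> vn i.+1 (adj c x).
  move=> hc; have [f hf] := (resgen_basis H gx).1 _ hc.
  rewrite adjC vnN -[c](subrK (\sum_(j < p) cst (f j) * x ^+ j)) adjDr vnD //.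
    by have := bracket hx hf; rewrite add0n add1n.
  by apply: vn_adj_pow_sum => //; rewrite /adj subrr vn_0.
move=> ha hb; have [f hf] := (resgen_basis H gx).1 _ hb.
rewrite -[b](subrK (\sum_(j < p) cst (f j) * x ^+ j)) adjDr vnD //.
  by have := bracket ha hf; rewrite add0n add1n.
by apply: vn_adj_pow_sum => //; exact: bx.
Qed.

Lemma iter_adj_vn m c n a y : vn c a -> vn m y ->
  vn (m + n * (c + i)) (iter n (adj a) y).
Proof.
move=> ha hy; elim: n => [|n IH]; first by rewrite addn0.
have := bracket ha IH; rewrite /= mulSn; apply: vnle.
by clear; lia.
Qed.

(* Its leading form is the logarithmic Poisson bracket {z, x} / z. *)
Definition hg := adj z x * z^-1.

Lemma hgE : adj z x = hg * z.
Proof. by rewrite /hg mulrVK // divD // pz.1. Qed.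

Lemma vn_hg : vn i hg.
Proof. by apply: (vn_divr divD pz.1 pz.2); rewrite addn1. Qed.

Lemma hg_exact : ~~ vn i.+1 hg.
Proof.
apply: contra hi' => h; rewrite hgE.
by have := vnM divD h hz; rewrite addn1.
Qed.

Lemma hg_val : hg != 0 /\ w hg = i%:Z.
Proof. exact: vn_exact vn_hg hg_exact. Qed.

(** Write y as v z^n with v integral: by [bracket_unit] only z^n contributes to the leading form,
    and it gives n z^(n-1) {z, x}. So bracketing with x acts in degree n as multiplication by n
    times [hg], which is 0 exactly when p divides n. *)
Lemma bracket_gr n y : vn n y -> vn (n + i).+1 (adj y x - (hg * y) *+ n).
Proof.
have gz m : vn (m + i).+1 (adj (z ^+ m) x - (hg * z ^+ m) *+ m).
  elim: m => [|m IH].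
    by rewrite mulr0n subr0 expr0 adjC -(rmorph1 cst) adj_cst oppr0 vn_0.
  have zm : vn m (z ^+ m) by have := vnX divD m hz; rewrite mul1n.
  have -> : adj (z ^+ m.+1) x - (hg * z ^+ m.+1) *+ m.+1
    = z * (adj (z ^+ m) x - (hg * z ^+ m) *+ m) + (adj z hg * z ^+ m) *+ m.
    rewrite exprS adjMl hgE mulrS opprD addrA -(mulrA hg) addrK [z * (_ - _ *+ _)]mulrBr mulrnAr.
    by rewrite [adj z hg]/adj mulrBl mulrnBl !mulrA addrA subrK.
  apply: vnD.
    exact: (vnM divD hz IH).
  apply: vnMn; apply: vnle (vnM divD (bracket hz vn_hg) zm).
  by clear -i_gt0; lia.
move=> hy; have [v hv ->] := param_div pz hy.
have zn : vn n (z ^+ n) by have := vnX divD n hz; rewrite mul1n.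
have -> : adj (v * z ^+ n) x - (hg * (v * z ^+ n)) *+ n
  = v * (adj (z ^+ n) x - (hg * z ^+ n) *+ n) + adj v x * z ^+ n
    + (adj v hg * z ^+ n) *+ n.
  rewrite adjMl [v * (_ - _ *+ _)]mulrBr mulrnAr [adj v hg]/adj.
  rewrite [(_ - hg * v) * _]mulrBl mulrnBl !mulrA addrA.
  by rewrite [RHS](ACl (1*3*(2*4)*5)%AC) /= addNr addr0.
apply: vnD; first apply: vnD.
- exact: (vnMl divD hv (gz n)).
- have := vnM divD (bracket_unit hv hx) zn; apply: vnle; clear; lia.
- apply: vnMn; apply: vnle (vnM divD (bracket hv vn_hg) zn); clear -i_gt0; lia.
Qed.

(** Up to an error in the maximal ideal, x is a polynomial in b, and the bracket of the error with z
    has value at least i + 2; too large a value of [z, b] would pass to [z, x]. *)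
Lemma height_lower b : resgen b -> ~~ vn i.+2 (adj z b).
Proof.
move=> gb; apply: contra hi' => h.
have [f hf] := (resgen_basis H gb).1 _ hx.
rewrite -[x](subrK (\sum_(j < p) cst (f j) * b ^+ j)) adjDr vnD //.
  by have := bracket hz hf; rewrite add1n add2n.
by apply: vn_adj_pow_sum => //; exact: gb.1.
Qed.

(** Write z' = v z with v a unit: [z', b] = v [z, b] + [v, b] z, and the second term has value at
    least i + 2 by [bracket_unit]. *)
Lemma height_indep b z' : resgen b -> param z' ->
  vn i.+1 (adj z' b) && ~~ vn i.+2 (adj z' b).
Proof.
move=> gb pz'; have hb := gb.1.
have := bracket (param_vn pz') hb; rewrite addn0 add1n => -> /=.
have [v hv E] := param_div (n := 1) pz (param_vn pz').
have hv1 : ~~ vn 1 v.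
  apply/negP => h; have := vnM divD h hz; rewrite -E.
  by have [_ /negP] := exact_vn pz'.1 (pz'.2 : w z' = 1%:Z).
rewrite E expr1 adjMl vnDr.
  by have := vn_mul_exact divD hv1 (height_lower gb); rewrite add0n.
by have := vnM divD (bracket_unit hv hb) hz; rewrite addn1.
Qed.

(** [b^p, z] = ad(b)^p(z) has value at least 1 + p i, hence at least i + 2, which [height_lower]
    forbids if the residue of b^p generates. So the residue field is purely inseparable over k. *)
Lemma resgen_pow_notgen b : vn 0 b -> exists c, vn 1 (b ^+ p - cst c).
Proof.
move=> hb; apply: contrapT => nc.
have gb : resgen (b ^+ p) by split=> [|c hc]; [exact: vnX0 | apply: nc; exists c].
have /negP := height_lower gb; apply.
rewrite adjC vnN (adj_pchar Dp); have := iter_adj_vn p hb hz.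
by apply: vnle; rewrite add0n; have := prime_gt1 p_pr; clear -i_gt0; nia.
Qed.

End TrivialResidueAction.

(** * Chains of coefficient subfields of k *)

Section SubfieldChain.
Variables (k : fieldType) (p : nat).
Hypothesis kp : p \in [pchar k].
Implicit Types (T S : k -> Prop) (q : {poly k}).

Let p_pr : prime p := pcharf_prime kp.
Let p_gt0 : (0 < p)%N := prime_gt0 p_pr.

Definition subring_set T :=
  [/\ T 1, forall a b, T a -> T b -> T (a - b) & forall a b, T a -> T b -> T (a * b)].

Section Coefficients.
Variable T : k -> Prop.
Hypothesis hT : subring_set T.

Lemma sub_set1 : T 1. Proof. by case: hT. Qed.
Lemma sub_setB a b : T a -> T b -> T (a - b). Proof. by case: hT => ? h ?; exact: h. Qed.
Lemma sub_setM a b : T a -> T b -> T (a * b). Proof. by case: hT => ? ? h; exact: h. Qed.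
Lemma sub_set0 : T 0. Proof. by rewrite -(subrr 1); apply: sub_setB; exact: sub_set1. Qed.
Lemma sub_setN a : T a -> T (- a).
Proof. by move=> ha; rewrite -sub0r; apply: sub_setB => //; exact: sub_set0. Qed.
Lemma sub_setD a b : T a -> T b -> T (a + b).
Proof. by move=> ha hb; rewrite -[b]opprK; apply: sub_setB => //; exact: sub_setN. Qed.
Lemma sub_set_sum I (s : seq I) (P : pred I) (F : I -> k) :
  (forall i, P i -> T (F i)) -> T (\sum_(i <- s | P i) F i).
Proof.
move=> h; elim/big_rec: _ => [|i y Pi]; first exact: sub_set0.
by apply: sub_setD; exact: h.
Qed.
Lemma sub_setX a n : T a -> T (a ^+ n).
Proof.
move=> ha; elim: n => [|n IH]; first exact: sub_set1.
by rewrite exprS; exact: sub_setM.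
Qed.
Lemma sub_setMn a n : T a -> T (a *+ n).
Proof.
move=> ha; elim: n => [|n IH]; first exact: sub_set0.
by rewrite mulrS; exact: sub_setD.
Qed.

Definition coefs_in q := forall i, T q`_i.

Lemma coefs_inB q (r : {poly k}) : coefs_in q -> coefs_in r -> coefs_in (q - r).
Proof. by move=> hq hr i; rewrite coefB; exact: sub_setB. Qed.
Lemma coefs_inM q (r : {poly k}) : coefs_in q -> coefs_in r -> coefs_in (q * r).
Proof.
by move=> hq hr i; rewrite coefM; apply: sub_set_sum => j _; exact: sub_setM.
Qed.
Lemma coefs_in_sum I (s : seq I) (P : pred I) (F : I -> {poly k}) :
  (forall i, P i -> coefs_in (F i)) -> coefs_in (\sum_(i <- s | P i) F i).
Proof. by move=> h j; rewrite coef_sum; apply: sub_set_sum => i Pi; exact: h. Qed.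
Lemma coefs_inC c : T c -> coefs_in c%:P.
Proof. by move=> hc i; rewrite coefC; case: eqP => // _; exact: sub_set0. Qed.
Lemma coefs_inXn n : coefs_in 'X^n.
Proof. by move=> i; rewrite coefXn; case: eqP => _; [exact: sub_set1 | exact: sub_set0]. Qed.
Lemma coefs_in1 : coefs_in 1.
Proof. exact: coefs_inXn 0%N. Qed.
Lemma coefs_inZ c q : T c -> coefs_in q -> coefs_in (c *: q).
Proof. by move=> hc hq i; rewrite coefZ; exact: sub_setM. Qed.
Lemma coefs_inMXaddC q c : coefs_in (q * 'X + c%:P) -> coefs_in q /\ T c.
Proof.
move=> h; split=> [i|].
  by have := h i.+1; rewrite coefD coefMX coefC /= addr0.
by have := h 0%N; rewrite coefD coefMX coefC /= add0r.
Qed.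
Lemma coefs_in_comp q n : coefs_in q -> coefs_in (q \Po 'X^n).
Proof.
move=> hq; rewrite comp_polyE; apply: coefs_in_sum => i _; apply: coefs_inZ => //.
by rewrite -exprM; exact: coefs_inXn.
Qed.
Lemma horner_in q c : coefs_in q -> T c -> T q.[c].
Proof.
move=> hq hc; rewrite horner_coef; apply: sub_set_sum => i _; apply: sub_setM => //.
exact: sub_setX.
Qed.

Lemma coefs_in_section q : coefs_in q ->
  exists Q : nat -> {poly k}, (forall r, coefs_in (Q r)) /\
    q = \sum_(r < p) 'X^r * (Q r \Po 'X^p).
Proof.
elim/poly_ind: q => [|q c IH] hq.
  exists (fun=> 0); split=> [_ i|]; first by rewrite coef0; exact: sub_set0.
  by rewrite big1 // => r _; rewrite comp_poly0 mulr0.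
have [{}hq hc] := coefs_inMXaddC hq; have [Q [hQ qE]] := IH hq.
(* Multiplication by X shifts the components cyclically; the last one comes back as the first,
   multiplied by X^p, that is by X before the substitution. *)
pose Q' r := if r is s.+1 then Q s else Q p.-1 * 'X + c%:P.
exists Q'; split=> [[|r]|] //=.
  move=> i; rewrite coefD coefMX; apply: sub_setD; last exact: coefs_inC.
  by case: ifP => _; [exact: sub_set0 | exact: hQ].
move: qE; case: p p_gt0 @Q' => // m _ Q' qE.
have L : q * 'X = \sum_(i < m) 'X^(i.+1) * (Q i \Po 'X^(m.+1)) + (Q m \Po 'X^(m.+1)) * 'X^(m.+1).
  rewrite {1}qE big_ord_recr /= mulrDl mulr_suml; congr (_ + _).
    by apply: eq_bigr => i _; rewrite mulrAC -exprSr.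
  by rewrite mulrAC -exprSr mulrC.
rewrite L big_ord_recl expr0 mul1r /= comp_polyD comp_polyM comp_polyX comp_polyC.
by rewrite -addrA addrC.
Qed.
End Coefficients.

Definition subfield_set T := subring_set T /\ forall a, T a -> T a^-1.

Lemma coefs_in_divides T f g : subring_set T -> coefs_in T f -> f \is monic ->
  coefs_in T g -> exists h r, [/\ coefs_in T r, g = h * f + r & (size r < size f)%N].
Proof.
move=> hT hf mf; have f0 := monic_neq0 mf.
have [n] := ubnP (size g); elim: n g => // n IH g; rewrite ltnS => sg hg.
have [lt|le] := ltnP (size g) (size f).
  by exists 0, g; rewrite mul0r add0r.
have [g0|gn0] := eqVneq g 0.
  by move: le; rewrite g0 size_poly0 leqn0 size_poly_eq0 (negPf f0).
pose m := (size g - size f)%N; pose g' := g - lead_coef g *: ('X^m * f).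
have hg' : coefs_in T g'.
  apply: coefs_inB => //; apply: coefs_inZ => //; first exact: hg.
  by apply: coefs_inM => //; exact: coefs_inXn.
have sg' : (size g' < size g)%N.
  have szm : size ('X^m * f) = size g.
    by rewrite size_monicM ?monicXn // size_polyXn addSn /= subnK.
  rewrite -(prednK (_ : 0 < size g)%N) ?size_poly_gt0 // ltnS.
  apply/leq_sizeP => j; rewrite leq_eqVlt => /orP [/eqP <-|lt]; last first.
    rewrite prednK ?size_poly_gt0 // in lt.
    rewrite coefB coefZ !nth_default ?mulr0 ?subrr //.
    by rewrite szm.
  rewrite coefB coefZ.
  have -> : ('X^m * f)`_(size g).-1 = 1.
    rewrite -szm -[LHS]/(lead_coef ('X^m * f)) lead_coefM lead_coefXn mul1r.
    exact: monicP.
  by rewrite mulr1 -[X in X - _]/(lead_coef g) subrr.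
have [h [r [hr E sr]]] := IH g' (leq_trans sg' sg) hg'.
exists (h + lead_coef g *: 'X^m), r; split=> //.
by rewrite mulrDl -scalerAl addrAC -E subrK.
Qed.

(** X^p - c^p = (X - c)^p, so a relation of least degree, made monic, is (X - c)^m with 0 < m < p;
    its coefficient of degree m - 1 is -m c, which puts c in T. *)
Lemma pth_root_indep T c (t : nat -> k) : subfield_set T -> ~ T c -> T (c ^+ p) ->
  (forall j, T (t j)) -> \sum_(j < p) t j * c ^+ j = 0 -> forall j, (j < p)%N -> t j = 0.
Proof.
case=> hT TV nTc Tcp Tt S0.
suff no q : coefs_in T q -> (size q <= p)%N -> q.[c] = 0 -> q = 0.
  have q0 : \poly_(j < p) t j = 0.
    apply: no; last by rewrite horner_poly.
      by move=> i; rewrite coef_poly; case: ifP => // _; exact: sub_set0.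
    exact: size_poly.
  by move=> j jp; have := congr1 (fun q : {poly k} => q`_j) q0; rewrite coef_poly jp coef0.
have [n] := ubnP (size q); elim: n q => // n IH q; rewrite ltnS => sq hq qp qc.
apply/eqP/negPn/negP => q0; have lq0 : lead_coef q != 0 by rewrite lead_coef_eq0.
pose f := (lead_coef q)^-1 *: q.
have mf : f \is monic by rewrite monicE lead_coefZ mulVf.
have sf : size f = size q by rewrite size_scale // invr_eq0.
have hf : coefs_in T f by apply: coefs_inZ => //; apply: TV; exact: hq.
have fc : f.[c] = 0 by rewrite hornerZ qc mulr0.
have hg : coefs_in T ('X^p - (c ^+ p)%:P).
  by apply: coefs_inB => //; [exact: coefs_inXn | exact: coefs_inC].
have [h [r [hr E sr]]] := coefs_in_divides hT hf mf hg.
have r0 : r = 0.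
  apply: IH => //; first by rewrite (leq_trans _ sq) // -sf.
    by apply: ltnW; apply: leq_trans sr _; rewrite sf.
  have := congr1 (fun u : {poly k} => u.[c]) E.
  by rewrite /= [LHS]hornerD hornerN hornerXn hornerC subrr [RHS]hornerD hornerM fc mulr0 add0r.
have fdiv : f %| ('X - c%:P) ^+ p.
  have polyp : p \in [pchar {poly k}] by rewrite pchar_poly.
  by rewrite (expr_pcharB polyp (mulrC _ _)) -rmorphXn E r0 addr0 dvdp_mull.
have /dvdp_exp_XsubCP [m mp fE] := fdiv.
have {}fE : f = ('X - c%:P) ^+ m.
  by apply/eqP; rewrite -eqp_monic // monic_exp // monicXsubC.
have m0 : (0 < m)%N.
  by case: m {mp} fE => // f1; move: fc; rewrite f1 expr0 hornerC => /eqP; rewrite oner_eq0.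
have mp' : (m < p)%N.
  by move: qp; rewrite -sf fE size_exp_XsubC.
have coefm : f`_m.-1 = - c *+ m.
  have -> : f = \prod_(u <- nseq m c) ('X - u%:P).
    by rewrite fE big_nseq iter_mulr_1.
  have := @coefPn_prod_XsubC _ (nseq m c); rewrite size_nseq -lt0n => -> //.
  by rewrite big_nseq iter_addr_0 mulNrn.
have := hf m.-1; rewrite coefm => Tcm.
have mk0 : (m%:R : k) != 0.
  by rewrite -(dvdn_pcharf kp) gtnNdvd.
apply: nTc; rewrite -[c]opprK -(mulfK mk0 (- c)) mulr_natr.
apply: sub_setN => //; apply: sub_setM => //; apply: TV.
by apply: sub_setMn => //; exact: sub_set1.
Qed.

(** Inverses come from a^-1 = a^(p-1) (a^-1)^p, whose last factor is the p-th power of an element of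
    S. *)
Lemma subfield_of_pth_powers S T : subfield_set S -> subring_set T ->
  (forall a, T a -> S a) -> (forall a, S a -> T (a ^+ p)) -> subfield_set T.
Proof.
move=> [_ SV] hT TS ST; split=> // a Ta.
have [->|a0] := eqVneq a 0; first by rewrite invr0; exact: sub_set0.
have -> : a^-1 = a ^+ p.-1 * a^-1 ^+ p.
  rewrite -{2}(prednK p_gt0) exprSr mulrA -exprMn mulfV // expr1n mul1r //.
by apply: sub_setM => //; [exact: sub_setX | apply/ST/SV/TS].
Qed.

(** The ring T[y]; it is a field when T contains the p-th powers of a field that contains T and
    y. *)
Definition adjoined T y (v : k) := exists2 q, coefs_in T q & v = q.[y].

Lemma adjoined_subring T y : subring_set T -> subring_set (adjoined T y).
Proof.
move=> hT; split=> [|a b [q hq ->] [r hr ->]|a b [q hq ->] [r hr ->]].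
- by exists 1; [exact: coefs_in1 | rewrite hornerC].
- by exists (q - r); [exact: coefs_inB | rewrite hornerD hornerN].
- by exists (q * r); [exact: coefs_inM | rewrite hornerM].
Qed.

Lemma adjoined_sub T y a : subring_set T -> T a -> adjoined T y a.
Proof. by move=> hT Ta; exists a%:P; [exact: coefs_inC | rewrite hornerC]. Qed.

Lemma adjoined_gen T y : subring_set T -> adjoined T y y.
Proof. by move=> hT; exists 'X; [exact: (coefs_inXn hT 1) | rewrite hornerX]. Qed.

Lemma adjoined_reduce T y v : subring_set T -> T (y ^+ p) -> adjoined T y v ->
  exists t : nat -> k, (forall j, T (t j)) /\ v = \sum_(j < p) t j * y ^+ j.
Proof.
move=> hT Typ [q hq ->]; have [Q [hQ ->]] := coefs_in_section hT hq.
exists (fun j => (Q j).[y ^+ p]); split=> [j|]; first exact: horner_in.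
rewrite horner_sum; apply: eq_bigr => j _.
by rewrite hornerM hornerXn horner_comp hornerXn mulrC.
Qed.

(** The subfield S^p avoids c, so Zorn's lemma gives a maximal T between S^p and S that avoids c.
    For y in S outside T, maximality puts c in T[y], and this forces y into T[c]. *)
Lemma maximal_subfield_avoiding S c : subfield_set S -> S c ->
  (forall a, S a -> a ^+ p <> c) -> exists T,
  [/\ subfield_set T, forall a, T a -> S a, forall a, S a -> T (a ^+ p), ~ T c
    & forall y, S y -> adjoined T c y].
Proof.
move=> hS Sc ncp; have [hS1 SV] := hS.
(* Zorn is applied to A while the subfield is A together with S^p, so that the
   union of the empty chain is admissible too. *)
pose G (A : set k) (a : k) := A a \/ exists2 b, S b & a = b ^+ p.
pose P (A : set k) := [/\ subring_set (G A), forall a, A a -> S a & ~ G A c].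
have powD (a b : k) : (a - b) ^+ p = a ^+ p - b ^+ p := expr_pcharB kp (mulrC a b).
have [F FP Ftot|A [[hG AS nGc] Amax]] := @Zorn_bigcup k P.
  (* Two elements lie over a common member of the chain, unless both are p-th powers. *)
  have common a b : G (\bigcup_(X in F) X)%classic a -> G (\bigcup_(X in F) X)%classic b ->
      (exists X, [/\ P X, (forall u, G X u -> G (\bigcup_(X in F) X)%classic u), G X a & G X b])
      \/ ((exists2 u, S u & a = u ^+ p) /\ exists2 u, S u & b = u ^+ p).
    have GX X : F X -> forall u, G X u -> G (\bigcup_(X in F) X)%classic u.
      by move=> FX u [Xu|h]; [left; exists X | right].
    case=> [[X FX Xa]|ha]; case=> [[Y FY Yb]|hb].
    - left; case: (Ftot X Y FX FY) => sub; [exists Y | exists X]; split;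
        by [exact: FP | exact: GX | left; exact: sub | left].
    - by left; exists X; split; [exact: FP | exact: GX | left | right].
    - by left; exists Y; split; [exact: FP | exact: GX | right | left].
    - by right.
  split=> [|a [X FX Xa]|[[X FX Xc]|[b Sb cb]]].
  - split=> [|a b ha hb|a b ha hb].
    + by right; exists 1; [exact: sub_set1 | rewrite expr1n].
    + have [[X [[hX _ _] XG Xa Xb]]|[[u Su ->] [v Sv ->]]] := common _ _ ha hb.
        by apply: XG; exact: sub_setB.
      by right; exists (u - v); [exact: sub_setB | rewrite powD].
    + have [[X [[hX _ _] XG Xa Xb]]|[[u Su ->] [v Sv ->]]] := common _ _ ha hb.
        by apply: XG; exact: sub_setM.
      by right; exists (u * v); [exact: sub_setM | rewrite exprMn].
  - by have [_ XS _] := FP X FX; exact: XS.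
  - by have [_ _ nX] := FP X FX; apply: nX; left.
  - exact: (ncp b Sb (esym cb)).
have GS a : G A a -> S a by case=> [/AS //|[b Sb ->]]; exact: sub_setX.
have SG a : S a -> G A (a ^+ p) by move=> Sa; right; exists a.
have fieldG : subfield_set (G A) := subfield_of_pth_powers hS hG GS SG.
exists (G A); split=> // y Sy.
have fieldAdj v : S v -> subfield_set (adjoined (G A) v).
  move=> Sv; apply: (subfield_of_pth_powers hS) => [|a [q hq ->]|a Sa].
  - exact: adjoined_subring.
  - by apply: horner_in => // i; exact/GS/hq.
  - by apply: adjoined_sub => //; exact: SG.
have [//|nGy] := pselect (G A y); first by move=> h; exact: adjoined_sub.
have adjS a : adjoined (G A) y a -> S a.
  by case=> q hq ->; apply: horner_in => // i; exact/GS/hq.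
have cy : adjoined (G A) y c.
  apply: contrapT => ncy; apply: (Amax (adjoined (G A) y)).
    split=> [a Aa|sub]; first by apply: adjoined_sub => //; left.
    by apply: nGy; left; apply: sub; exact: adjoined_gen.
  have GE a : G (adjoined (G A) y) a -> adjoined (G A) y a.
    by case=> // -[b Sb ->]; apply: adjoined_sub => //; exact: SG.
  have EG a : adjoined (G A) y a -> G (adjoined (G A) y) a by left.
  have [h1 h2 h3] := adjoined_subring y hG.
  split=> [||/GE //]; last exact: adjS.
  by split=> [|a b /GE ha /GE hb|a b /GE ha /GE hb]; apply: EG; [|exact: h2 | exact: h3].
have [t [ht cE]] := adjoined_reduce hG (SG _ Sy) cy.
apply: contrapT => nyc.
(* Over T[c], the equation c = t_0 + t_1 y + ... is a relation between powers of y below the p-th;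
   if y were not in T[c], independence would give c = t_0, an element of T. *)
pose t' j := if j is 0 then t 0%N - c else t j.
have adjt j : adjoined (G A) c (t' j).
  have h l : adjoined (G A) c (t l) by apply: adjoined_sub.
  case: j => [|j] //=; have [_ hB _] := adjoined_subring c hG.
  by apply: hB => //; exact: adjoined_gen.
have S0 : \sum_(j < p) t' j * y ^+ j = 0.
  move: cE; case: p p_gt0 => // m _; rewrite !big_ord_recl /= expr0 !mulr1 => cE.
  by rewrite addrAC -cE subrr.
have := pth_root_indep (fieldAdj c Sc) nyc (adjoined_sub c hG (SG _ Sy)) adjt S0 p_gt0.
by move=> /eqP; rewrite subr_eq0 => /eqP tc; apply: nGc; rewrite -tc.
Qed.

(* [S n] is the field of coefficients admitted at precision n. *)
Lemma subfield_chain c : (forall a : k, a ^+ p <> c) ->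
  exists S : nat -> k -> Prop, forall n,
  [/\ subfield_set (S n), forall a, S n.+1 a -> S n a, S n (c ^+ (p ^ n)),
      ~ S n.+1 (c ^+ (p ^ n)) & forall y : k, adjoined (S n) c y].
Proof.
move=> ncp.
(* c^(p^n) is the element to be avoided by the next field: it lies in S without being a p-th power
   there, and S with c still generates k. *)
pose P n S := [/\ subfield_set S, S (c ^+ (p ^ n)), forall a, S a -> a ^+ p <> c ^+ (p ^ n)
  & forall y : k, adjoined S c y].
pose R n S S' := (forall a : k, S' a -> S a) /\ ~ S' (c ^+ (p ^ n)).
have P0 : P 0%N (fun=> True).
  split=> [||a _|y] //; rewrite ?expr1 //.
  by exists y%:P; [move=> i | rewrite hornerC].
have step n S : P n S -> exists2 S', P n.+1 S' & R n S S'.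
  case=> hS Sc nS gen; have [T [hT TS ST nT TG]] := maximal_subfield_avoiding hS Sc nS.
  have hT1 := hT.1; exists T => //; split=> // [|a Ta E|y].
  - by rewrite expnSr exprM; exact: ST.
  (* The Frobenius is injective: a^p = c^(p^(n+1)) would give a = c^(p^n), which T avoids. *)
  - apply: nT; rewrite expnSr exprM in E.
    have /eqP : (a - c ^+ (p ^ n)) ^+ p = 0.
      by rewrite (expr_pcharB kp (mulrC _ _)) E subrr.
    by rewrite expf_eq0 p_gt0 subr_eq0 /= => /eqP <-.
  (* k = S[c], and elements of S are polynomials over T in c^(p^n), a power of c; so k = T[c]. *)
  - have [q hq ->] := gen y.
    have /choice [Q hQ] : forall i, exists r, coefs_in T r /\ q`_i = r.[c ^+ (p ^ n)].
      by move=> i; have [r hr rE] := TG _ (hq i); exists r.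
    exists (\sum_(i < size q) (Q i \Po 'X^(p ^ n)) * 'X^i).
      apply: coefs_in_sum => // i _; apply: coefs_inM => //; last exact: coefs_inXn.
      by apply: coefs_in_comp => //; exact: (hQ i).1.
    rewrite horner_coef horner_sum; apply: eq_bigr => i _.
    by rewrite hornerM hornerXn horner_comp hornerXn (hQ i).2.
have [S [_ hS]] := dependent_sequence P0 step.
by exists S => n; have [[h1 h2 h3 h4] [h5 h6]] := hS n.
Qed.

End SubfieldChain.

(** * The embedding of a purely inseparable residue field *)

Section InseparableEmbedding.
Variables (k : fieldType) (D : falgType (laurent k)) (w : valuation D) (p e : nat).
Hypothesis H : wild w p e.

Let divD := wild_div H.
Let w_e := wild_val H.
Let Dp := wild_char H.
Let p_pr : prime p := pcharf_prime (wild_char H).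
Let p_gt0 : (0 < p)%N := prime_gt0 p_pr.
Local Notation vn := (vge w).
Local Notation cst := (cst D).
Let vnc c : vn 0 (cst c) := vn_cst w_e c.
Let vnle m n (y : D) : (m <= n)%N -> vn n y -> vn m y := @vn_leq D w m n y.

Lemma pchar_base : p \in [pchar k].
Proof.
apply/andP; split=> //; apply/eqP.
have : cst p%:R = 0 by rewrite rmorph_nat (pcharf0 Dp).
by move/eqP; rewrite fmorph_eq0 => /eqP.
Qed.

Lemma vn1_pow y n : (0 < n)%N -> vn 0 y -> vn 1 (y ^+ n) -> vn 1 y.
Proof.
move=> n0 hy; apply: contraLR => ny; case: n n0 => // n _.
elim: n => [|n IH]; first by rewrite expr1.
by rewrite exprS; have := vn_mul_exact divD ny IH; rewrite add0n.
Qed.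

Lemma ev_cong N (u v : D) q : vn 0 u -> vn 0 v -> vn N (u - v) -> vn N (ev u q - ev v q).
Proof.
move=> hu hv huv; rewrite !(@ev_wide _ _ _ _ (size q)) // -sumrB; apply: vn_sum => j _.
rewrite -mulrBr; apply: (vnMl divD) => //.
elim: (nat_of_ord j) => [|i IH]; first by rewrite subrr vn_0.
have -> : u ^+ i.+1 - v ^+ i.+1 = u * (u ^+ i - v ^+ i) + (u - v) * v ^+ i.
  by rewrite mulrBr mulrBl -!exprS addrA subrK.
by apply: vnD; [exact: (vnMl divD) | apply: (vnMr divD) => //; exact: vnX0].
Qed.

Lemma ev_cst c q : ev (cst c) q = cst q.[c].
Proof.
rewrite (@ev_wide _ _ _ _ (size q)) // horner_coef rmorph_sum.
by apply: eq_bigr => i _; rewrite rmorphM rmorphXn.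
Qed.

Lemma ev_comp_Xn (u : D) q m : ev u (q \Po 'X^m) = ev (u ^+ m) q.
Proof.
rewrite comp_polyE rmorph_sum (@ev_wide _ _ (u ^+ m) q (size q)) //.
apply: eq_bigr => i _.
by rewrite -mul_polyC rmorphM ev_C !rmorphXn /= ev_X.
Qed.

(** An element outside the valuation ring has its inverse inside, with the same centralizer. *)
Lemma adj_integral (y : D) : (forall v, vn 0 v -> adj y v = 0) -> forall v, adj y v = 0.
Proof.
move=> h v; have [/h //|nv] := boolP (vn 0 v).
have [v0 wv] : v != 0 /\ w v < 0 by move: nv; rewrite /vge negb_or -ltNge => /andP.
have hi : vn 0 v^-1 by rewrite /vge valV // oppr_ge0 (ltW wv) orbT.
have /adjP/commrV := h _ hi; rewrite invrK => yv.
exact/adjP.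
Qed.

Variables (x : D) (c : k).
Hypotheses (gx : resgen w x) (hc : vn 1 (x ^+ p - cst c)).
Let hx : vn 0 x := gx.1.

Let c_not_pth_power (a : k) : a ^+ p <> c.
Proof.
move=> ac; apply: (gx.2 a); apply: (vn1_pow p_gt0); first by rewrite vnB.
by rewrite (expr_pcharB Dp) -?rmorphXn /= ?ac //; exact/commr_sym/cst_comm.
Qed.

Let chain := subfield_chain pchar_base c_not_pth_power.

(** [approx_embedding] is applied to polynomials with coefficients in [S n]: those with zero residue
    at x have value at least n at x, although x^p differs from c. If x^p is central, constants have
    approximate lifts that are polynomials in x^p, so the embedding maps k into the centre. *)
Lemma inseparable_embedding : exists u : {rmorphism residue_ring w -> vring w},
  embedding u /\ ((forall v, adj (x ^+ p) v = 0) ->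
    forall d v, adj (val (u (rho w (cst d)))) v = 0).
Proof.
have [S hS] := chain.
have SF n : subfield_set (S n) by case: (hS n).
have SR n : subring_set (S n) := (SF n).1.
have Smono j d a : S (j + d)%N a -> S j a.
  elim: d a => [|d IH] a; rewrite ?addn0 // addnS => h; apply: IH.
  by case: (hS (j + d)%N) => _ h' _ _ _; exact: h'.
have Sc j : S j (c ^+ (p ^ j)) by case: (hS j).
have nSc j : ~ S j.+1 (c ^+ (p ^ j)) by case: (hS j).
have p1 := prime_gt1 p_pr.
have vxX n : vn 0 (x ^+ n) by exact: vnX0.
(* Modulo the n-th power of the maximal ideal, x^(p^(j+1)) behaves like its
   approximation c^(p^j) for polynomials with coefficients in [S n]. *)
have J d : forall j q, coefs_in (S (j + d)%N) q -> q.[c ^+ (p ^ j)] = 0 ->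
    vn (j + d) (ev (x ^+ (p ^ j.+1)) q).
  elim: d => [|d IH] j q hq qc.
    rewrite addn0.
    have -> : ev (x ^+ (p ^ j.+1)) q = ev (x ^+ (p ^ j.+1)) q - ev (cst (c ^+ (p ^ j))) q.
      by rewrite ev_cst qc rmorph0 subr0.
    apply: ev_cong => //.
    have -> : x ^+ (p ^ j.+1) - cst (c ^+ (p ^ j)) = (x ^+ p - cst c) ^+ (p ^ j).
      elim: j {hq qc} => [|j IHj]; first by rewrite !expr1.
      rewrite (expnSr p j) [RHS]exprM -IHj (expr_pcharB Dp (commr_sym (cst_comm _ _))).
      by rewrite -exprM -rmorphXn -exprM /= -!expnSr.
    apply: vnle (vnX divD (p ^ j) hc); rewrite mul1n.
    exact/ltnW/ltn_expl.
  have [Q [hQ qE]] := coefs_in_section pchar_base (SR _) hq.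
  have SQ j' : S j.+1 (Q j').[c ^+ (p ^ j.+1)].
    by apply: horner_in => // i; apply: (@Smono j.+1 d); rewrite addSn -addnS; exact: hQ.
  (* c^(p^j) is not in [S j.+1], so the relation at c^(p^j) splits into p relations at c^(p^(j+1)),
     to which the induction applies with j raised by one. *)
  have Q0 : forall r, (r < p)%N -> (Q r).[c ^+ (p ^ j.+1)] = 0.
    apply: (pth_root_indep pchar_base (SF j.+1) (nSc j)) => //.
      by rewrite -exprM -expnSr.
    rewrite -[RHS]qc qE horner_sum; apply: eq_bigr => r _.
    have E : (c ^+ (p ^ j)) ^+ p = c ^+ (p ^ j.+1) by rewrite -exprM -expnSr.
    by rewrite hornerM hornerXn horner_comp hornerXn E mulrC.
  rewrite qE rmorph_sum; apply: vn_sum => r _; rewrite rmorphM; apply: (vnMl divD).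
    by rewrite rmorphXn /= ev_X vnX0.
  rewrite ev_comp_Xn -exprM -expnSr addnS -addSn; apply: IH; last exact: Q0.
  by rewrite addSn -addnS.
have [R1 R2] := resgen_basis H gx.
have indk (f : nat -> k) : vn 1 (\sum_(r < p) cst (f r) * x ^+ r) ->
    forall r, (r < p)%N -> f r = 0 by exact: R2.
have P_inj n q : coefs_in (S n) q -> vn 1 (ev x q) -> vn n (ev x q).
  move=> hq hq1; have [Q [hQ qE]] := coefs_in_section pchar_base (SR _) hq.
  have evq : ev x q = \sum_(r < p) ev (x ^+ p) (Q r) * x ^+ r.
    rewrite qE rmorph_sum; apply: eq_bigr => r _.
    rewrite rmorphM ev_comp_Xn rmorphXn /= ev_X.
    by apply/esym/adjP/ev_comm/adjP/commrX/commr_sym/commrX.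
  have near r : vn 1 (ev (x ^+ p) (Q r) - cst (Q r).[c]).
    by rewrite -ev_cst; apply: ev_cong.
  (* Modulo the maximal ideal x^p is c, so independence of 1, x, ..., x^(p-1) over k gives the
     vanishing at c that [J] takes as input for j = 0. *)
  have Q0 r : (r < p)%N -> (Q r).[c] = 0.
    apply: (indk (fun r => (Q r).[c])).
    have -> : \sum_(r < p) cst (Q r).[c] * x ^+ r
       = ev x q - \sum_(r < p) (ev (x ^+ p) (Q r) - cst (Q r).[c]) * x ^+ r.
      rewrite evq -sumrB; apply: eq_bigr => s _.
      by rewrite mulrBl opprB addrC subrK.
    apply: vnB => //; apply: vn_sum => s _; apply: (vnMr divD) => //.
  rewrite evq; apply: vn_sum => r _; apply: (vnMr divD) => //.
  have := J n 0%N (Q r); rewrite add0n expn1 !expr1; apply; first exact: hQ.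
  exact: Q0.
have P_near n d : exists2 q, coefs_in (S n) q & vn 1 (ev (x ^+ p) q - cst d).
  case: (hS n) => _ _ _ _ /(_ d) [q hq ->]; exists q => //.
  by rewrite -ev_cst; apply: ev_cong.
have P_onto n y : vn 0 y -> exists2 q, coefs_in (S n) q & vn 1 (y - ev x q).
  move=> hy; have [f hf] := R1 y hy.
  have /choice [Q hQ] : forall j, exists q, coefs_in (S n) q /\ vn 1 (ev (x ^+ p) q - cst (f j)).
    by move=> j; have [q h1 h2] := P_near n (f j); exists q.
  exists (\sum_(j < p) (Q j \Po 'X^p) * 'X^j).
    apply: coefs_in_sum => // j _; apply: coefs_inM => //; last exact: coefs_inXn.
    by apply: coefs_in_comp => //; exact: (hQ j).1.
  apply: vn_trans hf _; rewrite vnBC rmorph_sum -sumrB; apply: vn_sum => j _.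
  rewrite rmorphM ev_comp_Xn rmorphXn /= ev_X -mulrBl; apply: (vnMr divD) => //.
  exact: (hQ j).2.
have [||||u [hu uP]] :=
  @approx_embedding _ _ _ _ _ H x (fun n => coefs_in (S n)) hx _ _ _ _ P_onto P_inj.
- by move=> n; exact: coefs_in1.
- by move=> n q r; exact: coefs_inB.
- by move=> n q r; exact: coefs_inM.
- by move=> n q hq i; case: (hS n) => _ h _ _ _; apply: h; exact: hq.
exists u; split=> // xpC d; apply: adj_integral => v hv; apply: (vn_inf (w := w)) => n.
have [q hq hqd] := P_near n d.
have hqX : coefs_in (S n) (q \Po 'X^p) by apply: coefs_in_comp.
have evq : ev x (q \Po 'X^p) = ev (x ^+ p) q := ev_comp_Xn _ _ _.
have rq : rho w (ev x (q \Po 'X^p)) = rho w (cst d).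
  by rewrite evq; apply/rhoP => //; exact: (vn_ev H).
have := vn_adj divD (uP _ n _ hqX rq) hv.
by rewrite addn0 adjBl evq (ev_comm (v := v)) ?subr0 //; exact: xpC.
Qed.

End InseparableEmbedding.

Lemma exists_opp_inv p a : prime p -> ~~ (p %| a)%N -> exists c, (p %| c * a + 1)%N.
Proof.
move=> pp pa; have a0 : (0 < a)%N by case: a pa => //; rewrite dvdn0.
have cop : gcdn a p = 1%N by apply/eqP; rewrite -/(coprime a p) coprime_sym prime_coprime.
case: (egcdnP p a0) => km kn E _; rewrite cop in E.
exists (km * p.-1)%N; rewrite mulnAC E mulnDl mul1n -addnA -[(p.-1 + 1)%N]addSnnS addn0.
by rewrite prednK ?prime_gt0 // dvdn_add // mulnAC dvdn_mull.
Qed.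

(** * The height divisible by p: a parameter with central p-th power *)

Section PDividesHeight.
Variables (k : fieldType) (D : falgType (laurent k)) (w : valuation D) (p e : nat).
Hypothesis H : wild w p e.

Let divD := wild_div H.
Let w_e := wild_val H.
Let Dp := wild_char H.
Let p_pr : prime p := pcharf_prime (wild_char H).
Local Notation vn := (vge w).
Local Notation cst := (cst D).
Local Notation resgen := (resgen w).
Local Notation param := (parameter w).
Local Notation tau := (tau D).

Let vnle m n (y : D) : (m <= n)%N -> vn n y -> vn m y := @vn_leq D w m n y.

Lemma pchar_mulrn_dvd (y : D) m : (p %| m)%N -> y *+ m = 0.
Proof. by case/dvdnP => c ->; rewrite mulrnA -mulr_natr (pcharf0 Dp) mulr0. Qed.

Lemma vn_mulrn n m (y : D) : ~~ (p %| m)%N -> vn n (y *+ m) -> vn n y.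
Proof.
move=> /(exists_opp_inv p_pr) [c hc] h; have : y *+ (c * m + 1) = 0 by exact: pchar_mulrn_dvd.
rewrite addn1 mulrS mulnC mulrnA => /eqP; rewrite addr_eq0 => /eqP ->.
by rewrite vnN vnMn.
Qed.

Lemma tau_val_p n : tau ^+ n != 0 /\ w (tau ^+ n) = (p * n)%N%:Z.
Proof.
have t0 : tau != 0 := tau_neq0 D.
split; first exact: div_expf_neq0.
by rewrite valX // (val_tau w_e) -mulr_natr natz -PoszM (e_eq_p H).
Qed.

(** As e = p, some power of t has value n; the quotient of y by it is integral, with residue a
    polynomial in that of x. *)
Lemma approx_adjoin x n y : resgen x -> (p %| n)%N -> vn n y ->
  exists h, [/\ adj h x = 0, vn n h & vn n.+1 (y - h)].
Proof.
move=> gx /dvdnP [m ->] hy; have [tn0 wt] := tau_val_p m; rewrite mulnC in wt.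
have ht : vn (m * p) (tau ^+ m) by have [] := exact_vn tn0 wt.
have hq : vn 0 (y * tau ^- m) by rewrite (vn_divr divD tn0 wt).
have [f hf] := (resgen_basis H gx).1 _ hq.
set s := \sum_(j < p) _ in hf; have hs : vn 0 s by rewrite (vn_pow_sum H) // gx.1.
exists (s * tau ^+ m); split.
- apply/adjP/commr_sym; apply: commrM; last exact/commr_sym/taun_comm.
  apply: commr_sum => j _; apply: commrM; first exact/commr_sym/cst_comm.
  exact: commrX.
- by have := vnM divD hs ht.
have -> : y - s * tau ^+ m = (y * tau ^- m - s) * tau ^+ m.
  by rewrite mulrBl mulrVK // divD.
by have := vnM divD hf ht.
Qed.

Variables (x z : D) (i : nat).
Hypotheses (gx : resgen x) (pz : param z) (i_gt0 : (0 < i)%N).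
Hypotheses (hi : vn i.+1 (adj z x)) (hi' : ~~ vn i.+2 (adj z x)).
Hypothesis p_i : (p %| i)%N.

Let hx : vn 0 x := gx.1.
Let hz : vn 1 z := param_vn pz.
Let g0 := hg x z.
Let vg0 : vn i g0 := vn_hg H pz hi.
Let vg0' : ~~ vn i.+1 g0 := hg_exact H pz hi'.
Let gr n y : vn n y -> vn (n + i).+1 (adj y x - (g0 * y) *+ n) :=
  bracket_gr H gx pz i_gt0 hi (n := n) (y := y).

(* Approximate solutions (z', g) of [z', x] = g z' with g commuting with x. *)
Let good N (s : D * D) :=
  [/\ vn (i + 2 + N) (adj s.1 x - s.2 * s.1), vn 2 (s.1 - z),
      vn i.+1 (s.2 - g0) & adj s.2 x = 0].
Let near N (s s' : D * D) := vn N (s'.1 - s.1) /\ vn N (s'.2 - s.2).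

Let improve N s : good N s -> exists2 s', good N.+1 s' & near N s s'.
Proof.
case: s => z1 g1 [] /=; set err := adj z1 x - g1 * z1 => herr hz1 hg1 g1x.
have z0 := pz.1; have wz : w z = 1%:Z := pz.2.
(* If p divides the value of err / z then g is corrected; otherwise z' is, by
   a y of value N + 2, as adj y x - g y is then close to (N + 1) g y. *)
have [pN|pN] := boolP (p %| N.+1)%N.
  have herrz : vn (i + N.+1) (err * z^-1).
    by apply: (vn_divr divD z0 wz); apply: vnle herr; clear; lia.
  have [|h [hx0 vh hh]] := approx_adjoin gx _ herrz; first exact: dvdn_add.
  exists (z1, g1 + h); last first.
    split=> /=; first by rewrite subrr vn_0.
    by rewrite addrC addKr; apply: vnle vh; clear; lia.
  split=> //=; last by rewrite adjDl g1x hx0 addr0.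
    have -> : adj z1 x - (g1 + h) * z1 = (err * z^-1 - h) * z + h * (z - z1).
      rewrite mulrBl mulrVK ?divD // mulrBr /err mulrDl opprD !addrA.
      by rewrite subrK.
    apply: vnD.
      by apply: vnle (vnM divD hh hz); clear; lia.
    have hzz : vn 2 (z - z1) by rewrite vnBC.
    by apply: vnle (vnM divD vh hzz); clear; lia.
  rewrite addrAC; apply: vnD => //; apply: vnle vh; clear; lia.
(* c is the inverse of -(N + 1) modulo p, so the y below satisfies (N + 1) g0 y = -err. *)
have [c hc] := exists_opp_inv p_pr pN.
have [g00 wg0] := vn_exact vg0 vg0'.
pose y := (g0^-1 * err) *+ c.
have hy : vn (N + 2) y.
  apply: vnMn; apply: (vn_divl divD g00 wg0); apply: vnle herr; clear; lia.
have g0y : g0 * y = err *+ c by rewrite /y mulrnAr mulVKr // divD.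
exists (z1 + y, g1); last first.
  by split=> /=; [rewrite addrC addKr; apply: vnle hy; clear; lia | rewrite subrr vn_0].
split=> //=; last first.
  by rewrite addrAC; apply: vnD => //; apply: vnle hy; clear; lia.
have -> : adj (z1 + y) x - g1 * (z1 + y) =
   (adj y x - (g0 * y) *+ (N + 2)) - (g1 - g0) * y.
  have e0 : err + (g0 * y) *+ N.+1 = 0.
    rewrite g0y -mulrnA -[X in X + _]mulr1n -mulrnDr addnC.
    exact: pchar_mulrn_dvd.
  have -> : (g0 * y) *+ (N + 2) = g0 * y - err.
    move/eqP: e0; rewrite addr_eq0 => /eqP ->.
    by rewrite opprK addn2 mulrS.
  rewrite adjDl mulrDr mulrBl /err; move: (adj z1 x) (adj y x) => A B.
  rewrite !opprD !opprK !addrA.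
  by rewrite [RHS](ACl ((3*1*4*5)*(2*6))%AC) /= addNr addr0.
apply: vnB; first by apply: vnle (gr hy); clear; lia.
by apply: vnle (vnM divD hg1 hy); clear; lia.
Qed.

(** The iteration starts from an h that commutes with x and has the same leading form as [g0]; it
    exists because p divides the value i of [g0]. *)
Lemma exists_eigen_param : exists z' g,
  [/\ param z', adj z' x = g * z' & adj g x = 0].
Proof.
have [h [hx0 vh hh]] := approx_adjoin gx p_i vg0.
have start : good 0 (z, h).
  split=> //=; last by rewrite vnBC.
    rewrite (hgE H x pz) -/g0 -mulrBl; apply: vnle (vnM divD hh hz); clear; lia.
  by rewrite subrr vn_0.
have [s [s0 hs]] := dependent_sequence start improve.
have [|z' hz'] := complete H (s := fun n => (s n).1).
  by move=> n; have [_ []] := hs n.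
have [|g hg] := complete H (s := fun n => (s n).2).
  by move=> n; have [_ []] := hs n.
have gdx : adj g x = 0.
  by apply: (lim_adj H hg hx) => n; have [[_ _ _ ->] _] := hs n; exact: vn_0.
have z'z : vn 2 (z' - z).
  by apply: vn_trans (hz' 2) _; have [[_ h2 _ _] _] := hs 2.
have pz' : param z'.
  have [h1 h2] := exact_vn pz.1 (pz.2 : w z = 1%:Z).
  apply: (vn_exact (n := 1)); rewrite -[z'](subrK z) vnDl //.
  exact: vnle z'z.
exists z', g; split=> //; apply: (vn_eq (w := w)) => n.
have [[herr hzn hgn _] _] := hs n.
have vgn : vn 0 (s n).2.
  by rewrite -[(s n).2](subrK g0) vnD // ?(vnle _ vg0) // (vnle _ hgn).
have -> : adj z' x - g * z' = adj (z' - (s n).1) x - ((g - (s n).2) * z'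
    + (s n).2 * (z' - (s n).1)) + (adj (s n).1 x - (s n).2 * (s n).1).
  rewrite adjBl mulrBl mulrBr; move: (adj z' x) (adj (s n).1 x) => A B.
  rewrite !opprD !opprK !addrA.
  by rewrite [RHS](ACl (1*3*(2*7)*(4*5)*(6*8))%AC) /= addNr !subrr !addr0.
have hz0 : vn 0 z' := vnle (leqnSn 0) (param_vn pz').
apply: vnD; last by apply: vnle herr; clear; lia.
apply: vnB; first by have := vn_adj divD (hz' n) hx; rewrite addn0.
apply: vnD; first by apply: (vnMr divD).
exact: (vnMl divD).
Qed.

Lemma height_divisible_case :
  (exists2 z', param z' & z' ^+ p \in 1%VS) /\ cyclic_galois <<1; x>>%VS.
Proof.
have [z' [g [pz' ez gx0]]] := exists_eigen_param.
have x1 := resgen_notin1 H gx; have dimx := dim_adjoin H x1.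
have [z'0 wz'] := pz'; have Uz := divD z'0.
have p1 := prime_gt1 p_pr.
pose sg n (y : D) := z' ^+ n * y * z' ^- n.
have UzX n : z' ^+ n \is a GRing.unit by rewrite unitrX.
have sgS n y : sg n.+1 y = z' * sg n y * z'^-1.
  by rewrite /sg exprS invrM ?unitrX // !mulrA.
have sgD m n y : sg (m + n)%N y = sg m (sg n y).
  by rewrite /sg exprD invrM // !mulrA.
have sg_inj n : injective (sg n).
  by move=> u v /(mulIr _) => /(_ (etrans (unitrV _) (UzX n))) /(mulrI (UzX n)).
(* Conjugation by z' stabilizes F(x), and its iterates move x to conjugates of x
   over F, of which there are at most p. *)
have sg1 : z' * x * z'^-1 = x + g.
  apply: (mulIr Uz); rewrite mulrVK // mulrDl -ez /adj addrC subrK //.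
have sg_add n : {morph sg n : a b / a + b} by move=> a b; rewrite /sg mulrDr mulrDl.
have sg_mul n a b : sg n (a * b) = sg n a * sg n b by rewrite /sg !mulrA mulrVK.
have sg_scal n (a : laurent k) y : sg n (a *: y) = a *: sg n y.
  by rewrite /sg -scalerAr -scalerAl.
have sg_one n : sg n 1 = 1 by rewrite /sg mulr1 mulrV.
have sg_pow n y j : sg n (y ^+ j) = sg n y ^+ j.
  by elim: j => [|j IH]; rewrite ?expr0 ?sg_one // !exprS sg_mul IH.
have sg_sum n m (c : nat -> laurent k) y :
    sg n (\sum_(j < m) c j *: y ^+ j) = \sum_(j < m) c j *: sg n y ^+ j.
  have sg_zero : sg n 0 = 0 by rewrite /sg mulr0 mul0r.
  rewrite (big_morph (sg n) (sg_add n) sg_zero).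
  by apply: eq_bigr => j _; rewrite sg_scal sg_pow.
have gE : g \in <<1; x>>%VS by rewrite -(cent1_adjoin H x1); apply/cent1vP/adjP.
have sgE n : sg n x \in <<1; x>>%VS.
  elim: n => [|n IH]; first by rewrite /sg expr0 mul1r invr1 mulr1 memv_adjoin.
  rewrite sgS; have [c ->] := adjoin_spanP IH.
  have := sg_sum 1%N (\dim <<1; x>>) c x; rewrite /sg !expr1 => ->; rewrite sg1.
  have xgX j : (x + g) ^+ j \in <<1; x>>%VS.
    elim: j => [|j IHj]; first by rewrite expr0 (memX_adjoin x 0).
    rewrite exprS; apply: (memvM (A := <<1; x>>%AS)) => //.
    by rewrite memvD // memv_adjoin.
  by apply: memv_suml => j _; rewrite memvZ.
(* By [bracket_gr] the leading form of [z'^n, x] is n times a nonzero one, so z'^n commutes with x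
   only if p divides n. *)
have pgrow n : sg n x = x -> (p %| n)%N.
  move=> sn; have zn : adj (z' ^+ n) x = 0.
    by rewrite /adj -{2}sn /sg mulrVK // subrr.
  have [zn0 wzn] := param_val H n pz'; have [zn1 zn2] := exact_vn zn0 wzn.
  apply/negPn/negP => pn; have := gr zn1; rewrite zn sub0r vnN => /(vn_mulrn pn).
  by apply/negP; have := vn_mul_exact divD vg0' zn2; rewrite addnC.
have rinj i0 j0 : (i0 < p)%N -> (j0 <= p)%N -> sg i0 x = sg j0 x -> i0 = j0 \/ (i0 = 0%N /\ j0 = p).
  move=> ip jp E; case: (leqP i0 j0) => ij.
    have : sg i0 x = sg i0 (sg (j0 - i0)%N x) by rewrite -sgD subnKC.
    move=> /sg_inj /esym/pgrow dv.
    have [d0|d0] := posnP (j0 - i0)%N; first by left; clear -ij d0; lia.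
    have dl := dvdn_leq d0 dv; right; clear -ij ip jp dl; lia.
  have : sg j0 (sg (i0 - j0)%N x) = sg j0 x by rewrite -sgD (subnKC (ltnW ij)).
  move=> /sg_inj/pgrow dv.
  have d0 : (0 < i0 - j0)%N by rewrite subn_gt0.
  by have := dvdn_leq d0 dv; clear -ip ij; lia.
have [c cE] := adjoin_spanP (memX_adjoin x p); rewrite dimx in cE.
(* The minimal polynomial of x over F; conjugation fixes its coefficients, so every [sg n x] is a
   root. *)
pose q : {poly laurent k} := 'X^p - \poly_(j < p) c j.
have sq : size q = p.+1.
  by rewrite /q size_polyDl size_polyXn // size_polyN ltnS size_poly.
have evq y : horner_alg y q = y ^+ p - \sum_(j < p) c j *: y ^+ j.
  rewrite rmorphB rmorphXn /= horner_algX; congr (_ - _).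
  rewrite poly_def linear_sum; apply: eq_bigr => j _.
  by rewrite linearZ rmorphXn /= horner_algX mulr_algl.
have qroot n : horner_alg (sg n x) q = 0.
  by rewrite evq -sg_sum -sg_pow -cE subrr.
have sg0 : sg 0%N x = x by rewrite /sg expr0 mul1r invr1 mulr1.
split; last first.
  apply: (cyclic_adjoin_roots H (r := fun n => sg n x) x1 sq).
  - by move=> n _; split; [exact: sgE | exact: qroot].
  - move=> i0 j0 ip jp E; have [//|[_ jp']] := rinj i0 j0 ip (ltnW jp) E.
    by rewrite jp' ltnn in jp.
  - by rewrite sg0.
exists z' => //.
(* The p + 1 elements [sg n x] with n <= p are roots of q in the field F(x), so two coincide; by
   [rinj] these are the first and the last. *)
have sgp : sg p x = x.
  have := @max_subfield_roots _ D divD _ q p (adjoin_is_subfield x) sq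
    [seq sg n x | n <- iota 0 p.+1].
  have sub : {subset [seq sg n x | n <- iota 0 p.+1] <= <<1; x>>%VS}.
    by move=> u /mapP [n _ ->].
  have rt y : y \in [seq sg n x | n <- iota 0 p.+1] -> horner_alg y q = 0.
    by move=> /mapP [n _ ->].
  move=> mx; apply/eqP/negPn/negP => ne.
  have : uniq [seq sg n x | n <- iota 0 p.+1].
    rewrite map_inj_in_uniq ?iota_uniq // => i0 j0; rewrite !mem_iota /= !add0n !ltnS => ip jp E.
    have key a b : (a <= p)%N -> (b <= p)%N -> (a <= b)%N -> sg a x = sg b x -> a = b.
      move=> ap bp ab Eab; have [ap'|pa] := ltnP a p; last by clear -ap bp ab pa; lia.
      have [//|[a0 bp']] := rinj a b ap' bp Eab.
      by case/eqP: ne; rewrite -bp' -Eab a0 sg0.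
    case: (leqP i0 j0) => ij; first exact: key.
    by apply/esym/key => //; exact: ltnW.
  move=> un; have := mx un sub rt; rewrite size_map size_iota.
  by rewrite ltnn.
have zpx : adj (z' ^+ p) x = 0 by rewrite /adj -{2}sgp /sg mulrVK // subrr.
apply: (central_criterion H (x := x) (h := z')) => //.
  rewrite adjC oppr_eq0 ez; apply/eqP => gz.
  have := pgrow 1%N; rewrite /sg expr1 sg1.
  have g00 : g = 0.
    by apply: (mulIr Uz); rewrite gz mul0r.
  by rewrite g00 addr0 => /(_ erefl); rewrite dvdn1 => /eqP pe; rewrite pe in p1.
by rewrite adjC adjX oppr0.
Qed.

End PDividesHeight.

Lemma deriv_exp_comm (R : nzRingType) (A : {poly R}) n :
  (A ^+ n)^`() = \sum_(l < n) A ^+ l * A^`() * A ^+ (n.-1 - l).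
Proof.
case: n => [|n]; first by rewrite expr0 derivC big_ord0.
elim: n => [|n IH]; first by rewrite big_ord_recl big_ord0 /= !expr1 mul1r mulr1 addr0.
rewrite exprS derivM IH [RHS]big_ord_recl /= expr0 mul1r subn0; congr (_ + _).
rewrite mulr_sumr; apply: eq_bigr => l _.
by rewrite /bump /= add1n exprS subSS !mulrA.
Qed.

(** * The height prime to p: a generator with central p-th power *)

Section CoprimeHeight.
Variables (k : fieldType) (D : falgType (laurent k)) (w : valuation D) (p e : nat).
Hypothesis H : wild w p e.

Let divD := wild_div H.
Let Dp := wild_char H.
Let p_pr : prime p := pcharf_prime (wild_char H).
Let p_gt0 : (0 < p)%N := prime_gt0 p_pr.
Let p_gt1 : (1 < p)%N := prime_gt1 p_pr.
Local Notation vn := (vge w).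
Local Notation cst := (cst D).
Local Notation resgen := (resgen w).
Local Notation param := (parameter w).
Local Notation tau := (tau D).

Let vnle m n (y : D) : (m <= n)%N -> vn n y -> vn m y := @vn_leq D w m n y.

Lemma inseparable_cyclic (x z : D) : adj x z != 0 -> x ^+ p \in 1%VS ->
  cyclic_division_algebra D p.
Proof.
move=> xz xp1.
have ex : exists m, iter m (adj x) z == 0.
  by exists p; rewrite -(adj_pchar Dp) (mem1_adj _ xp1).
case: (ex_minnP ex) => m hm mmin.
case: m hm mmin => [|[|m]] hm mmin.
- by case/eqP: xz; move/eqP: hm => /= ->; rewrite adj0.
- by case/negP: xz.
set y := iter m (adj x) z in hm; set c := adj x y.
have c0 : c != 0 by apply/negP => h; have := mmin m.+1 h; rewrite ltnn.
have xc : GRing.comm x c by apply/adjP/eqP.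
have Uc := divD c0.
(* c is the last nonzero iterate of [adj x] on z, so it commutes with x, and y is the iterate before
   it; hence [x, h] = 1. *)
pose h := c^-1 * y.
have xh : adj x h = 1.
  have /adjP xci : GRing.comm x c^-1 by exact: commrV.
  by rewrite /h adjM xci mul0r add0r -/c mulVr.
have x0 : x != 0 by apply: contraNneq xz => ->; rewrite /adj mul0r mulr0 subrr.
pose n := h * x.
have xn : adj x n = x.
  by rewrite /n adjM xh mul1r [adj x x]subrr mulr0 addr0.
have n1 : n \notin 1%VS.
  by apply: contraNN x0 => /(mem1_adj x) nx; rewrite -xn adjC nx oppr0.
apply: (artin_schreier_cyclic H n1); apply: (central_criterion H (x := x) (h := n)).
- by rewrite xn.
(* Conjugation by x maps n to n + 1, which leaves n^p - n unchanged. *)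
- have xnE : x * n = (n + 1) * x by rewrite mulrDl mul1r -[X in _ + X]xn /adj addrC subrK.
  have xnp j : x * n ^+ j = (n + 1) ^+ j * x.
    elim: j => [|j IH]; first by rewrite mulr1 mul1r.
    by rewrite exprSr mulrA IH -mulrA xnE mulrA -exprSr.
  have E : x * (n ^+ p - n) = (n ^+ p - n) * x.
    rewrite mulrBr xnp xnE (expr_pcharD Dp (commr1 n)) expr1n -mulrBl.
    by rewrite opprD addrACA subrr addr0.
  by rewrite adjC /adj E subrr oppr0.
- by rewrite adjC adjB adjX [adj n n]subrr subr0 oppr0.
Qed.

Variables (x0 z : D) (i : nat).
Hypotheses (gx0 : resgen x0) (pz : param z) (i_gt0 : (0 < i)%N).
Hypotheses (hi0 : vn i.+1 (adj z x0)) (hi0' : ~~ vn i.+2 (adj z x0)).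
Hypothesis p_i : ~~ (p %| i)%N.

Let hz : vn 1 z := param_vn pz.
Let brk := bracket H gx0 pz hi0.

Section Generator.
Variable x : D.
Hypothesis gx : resgen x.
Let hx : vn 0 x := gx.1.
Let hi : vn i.+1 (adj z x).
Proof. by have /andP [] := height_indep H gx0 pz hi0 hi0' gx pz. Qed.
Let hi' : ~~ vn i.+2 (adj z x).
Proof. by have /andP [] := height_indep H gx0 pz hi0 hi0' gx pz. Qed.
Let g := hg x z.
Let vg : vn i g := vn_hg H pz hi.
Let vg' : ~~ vn i.+1 g := hg_exact H pz hi'.
Let gr n y : vn n y -> vn (n + i).+1 (adj y x - (g * y) *+ n) :=
  bracket_gr H gx pz i_gt0 hi (n := n) (y := y).

(** The leading form of [m, x] is n g times that of m, and n is invertible modulo p; if the former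
    vanishes, so does the latter. *)
Lemma vn_bump n m : ~~ (p %| n)%N -> vn n m -> vn (n + i).+1 (adj m x) -> vn n.+1 m.
Proof.
move=> pn hm mx; have [g0 wg] := vn_exact vg vg'.
have h : vn (n + i).+1 ((g * m) *+ n).
  by have := vnB mx (gr hm); rewrite opprB addrC subrK.
have := vn_mulrn H pn h => h1; rewrite -[m](mulKr (divD g0)).
by apply: (vn_divl divD g0 wg); rewrite addSn.
Qed.

(** Each application of [adj x] multiplies the leading form by -g and by the current degree, then
    raises the degree by i; hence the product of n, n + i, n + 2i, ... *)
Lemma iter_adj_gr n y r : vn n y ->
  vn (n + r * i).+1 (iter r (adj x) y -
    ((-1) ^+ r * g ^+ r * y) *+ \prod_(l < r) (n + l * i)).
Proof.
clearbody gr vg' vg g; move=> hy; elim: r => [|r IH].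
  by rewrite big_ord0 !expr0 !mul1r mulr1n subrr vn_0.
set K := \prod_(l < r) _ in IH; set A := _ *+ K in IH.
have hg' : vn (r * i) (g ^+ r) by rewrite mulnC; exact: vnX.
have hA : vn (n + r * i) A.
  apply: vnMn; rewrite -mulrA; apply: (vnMl divD).
    by apply: vnX0 => //; rewrite vnN vn1.
  by rewrite addnC; exact: vnM.
rewrite big_ord_recr /= -/K -[iter r _ _](subrK A) adjDr.
have -> : ((-1) ^+ r.+1 * g ^+ r.+1 * y) *+ (K * (n + r * i)) = - (g * A) *+ (n + r * i).
  rewrite mulrnA /A mulrnAr -mulNrn; congr (_ *+ _ *+ _).
  rewrite (exprS (-1)) (exprS g) mulN1r !mulNr; congr (- _); rewrite !mulrA.
  by rewrite (commr_sign g r : g * (-1) ^+ r = _).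
rewrite mulNrn -addrA; apply: vnD.
  by apply: vnle (brk hx IH); rewrite mulSn; clear; lia.
have -> : adj x A - - (g * A *+ (n + r * i)) = - (adj A x - g * A *+ (n + r * i)).
  by rewrite [adj x A]adjC opprK [RHS]opprB [LHS]addrC.
rewrite vnN.
by apply: vnle (gr hA); rewrite mulSn; clear; lia.
Qed.

End Generator.

(** ad(y^p) = ad(y)^p raises values by p(j + i), so y^p is nearly central. Once an element of F is
    removed, the remainder has no leading form in degrees prime to p, by [vn_bump]; in a degree
    divisible by p it is a constant times a power of t, since a generating residue would violate
    [height_lower]. *)
Lemma pth_power_approx j y : vn j y ->
  exists2 f, f \in 1%VS & vn (p * j + p.-1 * i) (y ^+ p - f).
Proof.
move=> hy.
suff W n : (n <= p * j + p.-1 * i)%N -> exists2 f, f \in 1%VS & vn n (y ^+ p - f).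
  exact: W.
elim: n => [|n IH] hn.
  by exists 0; rewrite ?mem0v // subr0; apply: vnle (vnX divD p hy).
have [f f1 hf] := IH (ltnW hn); set m := y ^+ p - f in hf.
(* The origin of the bound: for n below it, n + i is less than the gain p(j + i). *)
have pE : (p * j + p.-1 * i + i = p * (j + i))%N.
  have E : (p.-1 * i + i = p * i)%N by rewrite addnC -mulSn prednK.
  by rewrite mulnDr -addnA E.
have mv c v : vn c v -> vn (c + p * (j + i)) (adj m v).
  by move=> hv; rewrite /m adjBl (mem1_adj _ f1) subr0 (adj_pchar Dp);
    apply: (iter_adj_vn H gx0 pz hi0).
have [pn|pn] := boolP (p %| n)%N; last first.
  exists f => //; apply: (vn_bump gx0 pn hf).
  by apply: vnle (mv 0%N _ gx0.1); rewrite add0n -pE; clear -hn; lia.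
case/dvdnP: pn => d nE; have [tn0 wt] := tau_val_p H d; rewrite mulnC -nE in wt.
have Ut := divD tn0.
pose b := m * tau ^- d.
have hb : vn 0 b by rewrite (vn_divr divD tn0 wt).
have mE : m = b * tau ^+ d by rewrite mulrVK.
have [c hc] : exists c, vn 1 (b - cst c).
  apply: contrapT => nc; have gb : resgen b by split=> // c hc; apply: nc; exists c.
  have /negP := height_lower H gx0 pz hi0 hi0' gb; apply.
  have zb : adj z b = adj z m * tau ^- d.
    have zt : adj z (tau ^+ d) = 0 by apply/adjP/commr_sym/taun_comm.
    by rewrite mE (adjM z b) zt mulr0 addr0 mulrK.
  rewrite zb; apply: (vn_divr divD tn0 wt); rewrite adjC vnN.
  by apply: vnle (mv 1%N _ hz); rewrite -pE; clear -hn; lia.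
exists (f + cst c * tau ^+ d).
  apply: rpredD => //; apply: (central_mem H) => v; apply/adjP/commr_sym.
  by apply: commrM; [exact/commr_sym/cst_comm | exact/commr_sym/taun_comm].
have -> : y ^+ p - (f + cst c * tau ^+ d) = (b - cst c) * tau ^+ d.
  by rewrite opprD addrA -/m mulrBl -mE.
have ht : vn n (tau ^+ d) by have [] := exact_vn tn0 wt.
by have := vnM divD hc ht.
Qed.

Section Jacobson.
Variables (x y : D) (j : nat).
Hypotheses (hx : vn 0 x) (hy : vn j y).

(** The variable is given weight -j, which makes x + yX bounded by 0. *)
Let bounded c (q : {poly D}) := forall r, vn (r * j + c) q`_r.

Let bounded_adj c d q r : bounded c q -> bounded d r -> bounded (c + d + i) (adj q r).
Proof.
move=> hq hr n; rewrite /adj coefB coefM coefMr -sumrB; apply: vn_sum => a _.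
apply: vnle (brk (hq a) (hr (n - a)%N)).
by have := ltn_ord a; rewrite ltnS => an; rewrite -{1}(subnKC an) mulnDl; clear; lia.
Qed.

Let A : {poly D} := x%:P + y%:P * 'X.

Let coefA n (q : {poly D}) : (A * q)`_n.+1 = x * q`_n.+1 + y * q`_n.
Proof. by rewrite mulrDl coefD coefCM -mulrA -commr_polyX coefCM coefMX. Qed.

(* Jacobson's formula: the coefficients of (x + yX)^p are read off from its
   derivative, ad(x + yX)^(p-1)(y). *)
Lemma jacobson_approx :
  vn (2 * j + p.-1 * i) ((x + y) ^+ p - (x ^+ p + y ^+ p + iter p.-1 (adj x) y)).
Proof.
have Pp : p \in [pchar {poly D}] by rewrite pchar_poly.
have dA : A^`() = y%:P by rewrite derivD derivC add0r deriv_mulC derivX mulr1.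
have dAp : (A ^+ p)^`() = iter p.-1 (adj A) y%:P.
  by rewrite deriv_exp_comm dA; exact: sum_mul_pchar.
have bA : bounded 0 A.
  move=> [|[|r]]; rewrite coefD coefC coefCM coefX /=.
  - by rewrite mulr0 addr0.
  - by rewrite mulr1 add0r addn0 mul1n.
  - by rewrite mulr0 addr0 vn_0.
have bI n : bounded (j + n * i) (iter n (adj A) y%:P).
  elim: n => [|n IH].
    by move=> [|r]; rewrite coefC /= ?vn_0 // add0n addn0.
  by have := bounded_adj bA IH; rewrite add0n mulSn -addnA [(n * i + i)%N]addnC.
have c0 n : (A ^+ n)`_0 = x ^+ n.
  elim: n => [|n IH]; first by rewrite !expr0 coef1.
  by rewrite !exprS coef0M IH coefD coefC coefMX /= addr0.
have i0 n : (iter n (adj A) y%:P)`_0 = iter n (adj x) y.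
  elim: n => [|n IH]; first by rewrite coefC.
  have A0 : A`_0 = x by have := c0 1%N; rewrite !expr1.
  by rewrite /= coefB !coef0M IH A0.
have cbig n m : (n < m)%N -> (A ^+ n)`_m = 0.
  elim: n m => [|n IH] [|m] // nm; first by rewrite expr0 coef1.
  by rewrite exprS coefA !IH ?mulr0 ?addr0 // ltnW.
have ctop n : (A ^+ n)`_n = y ^+ n.
  elim: n => [|n IH]; first by rewrite !expr0 coef1.
  by rewrite !exprS coefA cbig // mulr0 add0r IH.
have csum n : (x + y) ^+ n = \sum_(s < n.+1) (A ^+ n)`_s.
  elim: n => [|n IH]; first by rewrite big_ord_recl big_ord0 addr0 !expr0 coef1.
  rewrite exprS big_ord_recl c0 exprS IH mulrDl.
  have -> : \sum_(s < n.+1) (A ^+ n.+1)`_(lift ord0 s) =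
      \sum_(s < n.+1) (x * (A ^+ n)`_s.+1 + y * (A ^+ n)`_s).
    by apply: eq_bigr => s _; rewrite lift0 exprS coefA.
  rewrite big_split -!mulr_sumr addrA; congr (_ + _).
  rewrite -c0 -mulrDr; congr (_ * _).
  have := big_ord_recl n.+1 (fun s : 'I_n.+2 => (A ^+ n)`_s) => /= E.
  by rewrite -[RHS]E [RHS]big_ord_recr /= cbig // addr0.
(* The derivative determines s times the coefficient of degree s, and s is invertible for 0 < s < p.
   Degrees 0, 1 and p give the three terms subtracted in the statement. *)
have cmid s : (0 < s < p)%N -> vn (s * j + p.-1 * i) (A ^+ p)`_s.
  case: s => // s /andP [_ sp]; apply: (vn_mulrn H (m := s.+1)); first by rewrite gtnNdvd.
  rewrite -coef_deriv dAp mulSn; apply: vnle (bI p.-1 s).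
  by clear; lia.
have c1 : (A ^+ p)`_1 = iter p.-1 (adj x) y.
  by rewrite -i0 -dAp coef_deriv mulr1n.
move: (csum p) (c0 p) cmid c1 (ctop p); case: p p_gt1 => [|[|q]] // _ cs cx cmid c1 cp.
rewrite cs big_ord_recl big_ord_recr big_ord_recl /= /bump /= !add1n cx cp c1.
have -> (a b c d : D) : a + (b + c + d) - (a + d + b) = c.
  by rewrite !opprD !addrA [LHS](ACl (3*(1*5)*(4*6)*(2*7))%AC) /= !subrr !addr0.
apply: vn_sum => s _; apply: vnle (cmid (2 + s)%N _).
  by rewrite leq_add2r leq_mul2r leq_addr orbT.
by have := ltn_ord s; clear; lia.
Qed.
End Jacobson.

Lemma resgen_near x x' : resgen x -> vn 1 (x' - x) -> resgen x'.
Proof.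
case=> hx gx hxx; split=> [|c hc].
  by rewrite -[x'](subrK x) vnD // (vnle (leqnSn 0)).
by apply: (gx c); apply: vn_trans hc; rewrite vnBC.
Qed.

Let residual_comm (x f : D) : f \in 1%VS -> adj (x ^+ p - f) x = 0.
Proof. by move=> f1; rewrite adjBl (mem1_adj _ f1) subr0 adjC adjX oppr0. Qed.

(** If p does not divide N, the remainder m commutes with x and [vn_bump] gains one unit with x
    unchanged. Otherwise y is chosen with ad(x)^(p-1)(y) close to -m, and y^p is absorbed by F up to
    higher order. *)
Lemma improve_pth_root x f N : resgen x -> f \in 1%VS -> (p.-1 * i < N)%N ->
  vn N (x ^+ p - f) -> exists x' f', [/\ resgen x', f' \in 1%VS,
    vn N.+1 (x' ^+ p - f') & vn (N - p.-1 * i) (x' - x)].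
Proof.
move=> gx f1 hN hm; set m := x ^+ p - f in hm; have hx := gx.1.
have mx : adj m x = 0 := residual_comm x f1.
have [pN|pN] := boolP (p %| N)%N; last first.
  exists x, f; split=> //; last by rewrite subrr vn_0.
  by apply: (vn_bump gx pN hm); rewrite mx vn_0.
have /andP [hi hi'] := height_indep H gx0 pz hi0 hi0' gx pz.
have [g0 wg] := hg_val H pz hi hi'; have Ug := divD g0.
have vg := vn_hg H pz hi.
set g := hg x z in g0 wg Ug vg; set j := (N - p.-1 * i)%N.
have j0 : (0 < j)%N by rewrite subn_gt0.
have jN : (j + p.-1 * i = N)%N by rewrite subnK // ltnW.
(* ad(x)^(p-1) multiplies the leading form of y by (-g)^(p-1) K. *)
pose K := (\prod_(l < p.-1) (j + l * i))%N.
(* As N is 0 modulo p, j is congruent to i, and the factors of K to i, 2i, ..., (p-1)i. *)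
have pK : ~~ (p %| K)%N.
  rewrite /K; elim/big_ind: _ => [|u v pu pv|l _]; first by rewrite gtnNdvd.
    by rewrite Euclid_dvdM // negb_or pu.
  apply/negP => dv; have : (p %| l.+1 * i)%N.
    have -> : (l.+1 * i = (j + l * i + p * i) - N)%N.
      have -> : (p * i = p.-1 * i + i)%N by rewrite addnC -mulSn prednK.
      by rewrite -jN mulSn; clear; lia.
    by rewrite dvdn_sub // dvdn_add // dvdn_mulr.
  rewrite Euclid_dvdM // (negPf p_i) orbF => /dvdn_leq => /(_ isT).
  by have := ltn_ord l; have := prednK p_gt0; clear; lia.
have [c hc] := exists_opp_inv p_pr pK.
have [gp0 wgp] : g ^+ p.-1 != 0 /\ w (g ^+ p.-1) = (p.-1 * i)%N%:Z.
  rewrite (div_expf_neq0 divD) // valX // wg -mulr_natr natz -PoszM mulnC.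
  by [].
have Ugp := divD gp0.
pose y := (-1) ^+ p.-1 * (g ^- p.-1 * m) *+ c.
have hy : vn j y.
  apply: vnMn; apply: (vnMl divD); first by apply: vnX0 => //; rewrite vnN vn1.
  by apply: (vn_divl divD gp0 wgp); rewrite jN.
have ady : vn N.+1 (iter p.-1 (adj x) y + m).
  have := iter_adj_gr gx p.-1 hy; rewrite -/g jN -/K.
  have -> : ((-1) ^+ p.-1 * g ^+ p.-1 * y) *+ K = - m.
    have sgn2 : (-1) ^+ p.-1 * (-1) ^+ p.-1 = 1 :> D.
      by rewrite -exprMn_comm ?mulrNN ?mul1r ?expr1n //; exact: commrN1.
    have -> : (-1) ^+ p.-1 * g ^+ p.-1 * y = m *+ c.
      rewrite /y mulrnAr; congr (_ *+ _).
      rewrite -mulrA (mulrA (g ^+ p.-1)) (commr_sign (g ^+ p.-1) p.-1 : _ = _ * _).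
      by rewrite -mulrA (mulVKr Ugp) mulrA sgn2 mul1r.
    apply/eqP; rewrite -addr_eq0 -mulrnA -[X in _ + X]mulr1n -mulrnDr.
    by rewrite (pchar_mulrn_dvd H).
  by rewrite opprK.
have [f2 f21 hf2] := pth_power_approx hy.
have gx' : resgen (x + y).
  by apply: resgen_near gx _; rewrite addrC addKr; exact: vnle hy.
exists (x + y), (f + f2); split=> //; first exact: rpredD.
  have J := jacobson_approx hx hy.
  have -> : (x + y) ^+ p - (f + f2) = ((x + y) ^+ p - (x ^+ p + y ^+ p + iter p.-1 (adj x) y))
      + (y ^+ p - f2) + (iter p.-1 (adj x) y + m).
    rewrite /m; move: ((x + y) ^+ p) (iter _ _ _) (x ^+ p) (y ^+ p) => a b a1 a2.
    by rewrite !opprD !addrA [RHS](ACl (1*9*6*(2*8)*(3*5)*(4*7))%AC) /= !addNr !addr0.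
  (* Both errors are beyond N = j + (p-1)i because j > 0: their orders are 2j + (p-1)i and pj +
     (p-1)i. *)
  apply: vnD => //; apply: vnD.
    by apply: vnle J; clear -jN j0; lia.
  by apply: vnle hf2; rewrite -jN -addSn leq_add2r; clear -j0 p_gt1; nia.
by rewrite addrC addKr.
Qed.

Lemma exists_inseparable_gen : exists2 x, resgen x & x ^+ p \in 1%VS.
Proof.
have [f0 f01 hf0] := pth_power_approx gx0.1.
(* [pth_power_approx] reaches precision (p-1)i for [x0]; this is prime to p, so [vn_bump] gains the
   unit with which [improve_pth_root] can start. *)
set N0 := (p.-1 * i).+1.
have pN : ~~ (p %| p.-1 * i)%N.
  rewrite Euclid_dvdM // (negPf p_i) orbF gtnNdvd //; first by rewrite -subn1 subn_gt0.
  by rewrite prednK.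
rewrite muln0 add0n in hf0.
have start : vn N0 (x0 ^+ p - f0).
  by apply: (vn_bump gx0 pN hf0); rewrite residual_comm // vn_0.
pose good n (s : D * D) := [/\ resgen s.1, s.2 \in 1%VS & vn (N0 + n) (s.1 ^+ p - s.2)].
pose near n (s s' : D * D) := vn n.+1 (s'.1 - s.1).
have step n s : good n s -> exists2 s', good n.+1 s' & near n s s'.
  case: s => x f [/= gx f1 hm]; have [|x' [f' [gx' f1' hm' hxx]]] := improve_pth_root gx f1 _ hm.
    by rewrite addSn ltnS leq_addr.
  exists (x', f'); first by split=> //=; rewrite addnS.
  by apply: vnle hxx; rewrite addSn -addnS addKn.
have start' : good 0 (x0, f0) by split=> //=; rewrite addn0.
have [s [s0 hs]] := dependent_sequence start' step.
have [|x hx] := complete H (s := fun n => (s n).1).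
  by move=> n; have [_ h] := hs n; exact: vnle h.
have gs n : resgen (s n).1 by have [[]] := hs n.
have gx : resgen x by apply: resgen_near (gs 1%N) (hx 1%N).
(* Centrality is tested on commutators: those of x^p are limits of those of x_n^p, which tend to 0
   as x_n^p approaches F. *)
exists x => //; apply: (central_mem H); apply: (adj_integral H) => v hv.
apply: (lim_adj H (s := fun n => (s n).1 ^+ p) _ hv) => n.
  have := @ev_cong _ _ _ _ _ H n x (s n).1 'X^p gx.1 (gs n).1 (hx n).
  by rewrite !rmorphXn /= -!/(ev _ _) !ev_X.
have [[_ f1 hm] _] := hs n.
have -> : adj ((s n).1 ^+ p) v = adj ((s n).1 ^+ p - (s n).2) v.
  by rewrite adjBl (mem1_adj _ f1) subr0.
by have := vn_adj divD hm hv; rewrite addn0; apply: vnle; rewrite leq_addl.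
Qed.

End CoprimeHeight.

(** * Assembling the two cases *)

Section Conclusion.
Variables (k : fieldType) (D : falgType (laurent k)) (w : valuation D) (p e : nat).
Hypothesis H : wild w p e.

Let divD := wild_div H.
Let p_pr : prime p := pcharf_prime (wild_char H).
Local Notation vn := (vge w).
Local Notation cst := (cst D).
Local Notation resgen := (resgen w).
Local Notation param := (parameter w).

Lemma vn_conj (z v : D) : param z -> vn 0 v -> vn 0 (z * v * z^-1).
Proof.
move=> pz hv; apply: (vn_divr divD (n := 1) pz.1 pz.2).
exact: (vnM divD (param_vn pz) hv).
Qed.

Lemma conj_residue_idP (z : D) : param z ->
  conj_residue w z =1 id <-> forall v, vn 0 v -> vn 1 (z * v * z^-1 - v).
Proof.
move=> pz; split=> h v => [hv|].
  have [a av _] := rho_lift hv; have [b bv rb] := rho_lift (vn_conj pz hv).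
  have := @conj_residueE _ _ w z a b divD pz.1; rewrite bv av => /(_ erefl).
  rewrite h -!rho_val av bv => /esym E; apply/(rhoP (vn_conj pz hv) hv).
  exact: E.
have [a av] : exists a : vring w, residue a = v by exists (res_repr v); exact: res_reprK.
have ha := vn_val a; have [b bv rb] := rho_lift (vn_conj pz ha).
rewrite -av (conj_residueE divD pz.1 bv) -!rho_val bv.
by apply/(rhoP (vn_conj pz ha) ha); exact: h.
Qed.

(** If all residues of E were in k, the residue degree, which is the dimension of E, would be at
    most 1. *)
Lemma unramified_resgen (E : {vspace D}) : is_subfield E -> (1 < \dim E)%N ->
  unramified w E -> exists2 y, y \in E & resgen y.
Proof.
move=> subE dE unr; apply: contrapT => nE.
have [E1 EM EV EC] := subE.
move: dE; rewrite ltnNge => /negP; apply.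
apply: (has_degree_le1 _ _ _ _ unr) => [a b||| _ [v vE <-]].
- exact: (wild_comm H a b).
- move=> _ _ [u uE <-] [v vE <-]; exists (u * v); last by rewrite rmorphM.
  exact: EM.
- by split; apply/(residue_of_resC H); [exists 0; rewrite rmorph0 | exists 1; rewrite rmorph1].
apply: contrapT => nv; apply: nE; exists (val v) => //.
apply/(resgenP H); first exact: vn_val.
move=> c vc; apply: nv; apply/(residue_of_resC H); exists c.
by rewrite -vc rho_val.
Qed.

Lemma subfield_adjoin (E : {vspace D}) y : is_subfield E -> y \in E -> y \notin 1%VS ->
  E = <<1; y>>%VS.
Proof.
move=> subE Ey y1; have [E1 EM EV EC] := subE; apply/esym/eqP.
rewrite eqEdim (dim_adjoin H y1) (subfield_dim_le H subE) andbT.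
have E1' : (1 <= E)%VS by rewrite -memvE.
apply: agenv_sub_modl => //; apply/prodvP => u v hu hv; apply: EM => //.
by apply: (subvP _ _ hu); rewrite subv_add E1' -memvE.
Qed.

Lemma maximal_subfield_dim_gt1 (E : {vspace D}) : maximal_subfield E -> (1 < \dim E)%N.
Proof.
case=> subE maxE; have [E1 EM EV EC] := subE; rewrite ltnNge; apply/negP => dE.
have E1' : (1 <= E)%VS by rewrite -memvE.
have EE : E = 1%VS by apply/esym/eqP; rewrite eqEdim E1' dimv1.
have [x gx] := exists_resgen H; have x1 := resgen_notin1 H gx.
have := maxE <<1; x>>%VS (adjoin_is_subfield x); rewrite EE => /(_ (sub1_agenv _)) Ex.
by case/negP: x1; rewrite -Ex memv_adjoin.
Qed.

Section TrivialAction.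
Variable z : D.
Hypotheses (pz : param z) (triv : conj_residue w z =1 id).

Lemma trivial_action_splittable : splittable w.
Proof.
have [x gx] := exists_resgen H.
have [i i0 /andP [hi hi']] := exists_height H gx pz ((conj_residue_idP pz).1 triv).
have [c hc] := resgen_pow_notgen H gx pz i0 hi hi' gx.1.
by have [u [hu _]] := inseparable_embedding H gx hc; exists u.
Qed.

Lemma inseparable_good_splittable x : resgen x -> x ^+ p \in 1%VS -> good_splittable w.
Proof.
move=> gx xp1.
have [i i0 /andP [hi hi']] := exists_height H gx pz ((conj_residue_idP pz).1 triv).
have [c hc] := resgen_pow_notgen H gx pz i0 hi hi' gx.1.
have [u [hu uC]] := inseparable_embedding H gx hc; exists u => // y.
rewrite (wild_cent H) => /(residue_of_resC H) [d ->].
apply: (central_mem H) => v; apply: uC => v'; exact: mem1_adj.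
Qed.

Lemma trivial_action_case : exists i : int,
  [/\ forall (u : {rmorphism residue_ring w -> vring w}) (z : D),
        embedding u -> parameter w z -> is_local_height u z i,
      coprimez i p%:Z -> good_splittable w
    & (p%:Z %| i)%Z ->
      (exists2 z, parameter w z & z ^+ p \in 'Z({:D})%VS) /\
      (forall E : {vspace D}, maximal_subfield E -> unramified w E ->
        cyclic_galois E)] /\ cyclic_division_algebra D p.
Proof.
have [x gx] := exists_resgen H.
have [i i0 /andP [hi hi']] := exists_height H gx pz ((conj_residue_idP pz).1 triv).
have zx : adj z x != 0 by apply: contraNneq hi' => ->; exact: vn_0.
have hgt y : resgen y -> vn i.+1 (adj z y) && ~~ vn i.+2 (adj z y).
  by move=> gy; exact: (height_indep H gx pz hi hi').
exists i%:Z; split; last first.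
  have [pi|pi] := boolP (p %| i)%N; last first.
    have [y gy y1] := exists_inseparable_gen H gx pz i0 hi hi' pi.
    have /andP [_ hy] := hgt y gy; apply: (inseparable_cyclic H (x := y) (z := z)) => //.
    by apply: contraNneq hy => yz; rewrite adjC yz oppr0 vn_0.
  have [_ cyc] := height_divisible_case H gx pz i0 hi hi' pi.
  split=> //; [exact: wild_cent H | exact: (dim_D H) |].
  by exists <<1; x>>%VS => //; apply: (maximal_adjoin H); exact: (resgen_notin1 H).
split=> [u z' hu pz'|cop|dv].
- have [z'0 wz'] : param z' := pz'; have i'0 : z'^-1 != 0 by rewrite invr_eq0.
  have dE b : z' * b * z'^-1 - b = adj z' b * z'^-1.
    by rewrite /adj mulrBl mulrK // divD.
  split; last first.
    move=> a; rewrite dE => d0.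
    have va : vn (i + 1) (adj z' (val (u a))).
      by have := bracket H gx pz hi (param_vn pz') (vn_val (u a)); rewrite addn0 addnC.
    have := vn_divr divD z'0 (wz' : w z' = 1%:Z) va.
    by rewrite /vge (negPf d0).
  (* The minimum is reached at the residue of x: its image under u has that residue again, so by
     [height_indep] its bracket with z' has value i + 1, and division by z' leaves i. *)
  exists (rho w x); rewrite dE.
  have gu : resgen (val (u (rho w x))).
    apply/(resgenP H); first exact: vn_val.
    by rewrite rho_val hu; apply/(resgenP H) => //; exact: gx.1.
  have /andP [h1 h2] := height_indep H gx pz hi hi' gu pz'.
  have [d0 wd] := vn_exact h1 h2.
  split; first exact: (div_mulf_neq0 divD).
  by rewrite valM // valV // wz' wd -addn1 PoszD addrK.
- have pi : ~~ (p %| i)%N.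
    by rewrite -prime_coprime // coprime_sym.
  have [y gy y1] := exists_inseparable_gen H gx pz i0 hi hi' pi.
  exact: inseparable_good_splittable gy y1.
have pi : (p %| i)%N by [].
split.
  have [[z' pz' zp] _] := height_divisible_case H gx pz i0 hi hi' pi.
  by exists z' => //; rewrite (wild_cent H).
move=> E maxE unr; have [subE _] := maxE.
have [y Ey gy] := unramified_resgen subE (maximal_subfield_dim_gt1 maxE) unr.
(* E = F(y) with y a generator of the residue field, and y can take the place of x. *)
rewrite (subfield_adjoin subE Ey (resgen_notin1 H gy)).
have /andP [h1 h2] := hgt y gy.
by have [_ cyc] := height_divisible_case H gy pz i0 h1 h2 pi.
Qed.

End TrivialAction.

Lemma nontrivial_action_case z : param z -> ~ (conj_residue w z =1 id) ->
  splittable w /\ cyclic_division_algebra D p.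
Proof.
move=> pz nt; suff [v [hv nv]] : exists v, vn 0 v /\ ~ vn 1 (z * v * z^-1 - v).
  exact: (nontrivial_action_conclusion H pz hv nv).
apply: contrapT => h; apply: nt; apply/(conj_residue_idP pz) => v hv.
by apply: contrapT => nv; apply: h; exists v.
Qed.

End Conclusion.

Theorem proposition6 (k : fieldType) (D : falgType (laurent k)) (p : nat)
    (w : valuation D)
    (D_division : division_ring D)
    (D_central : 'Z({:D})%VS = 1%VS)
    (D_char : p \in [pchar D])
    (w_ext : normalized_extension w)
    (res_comm : forall x : residue_ring w, ring_center x)
    (res_degree : has_degree (residue_of w 1%VS) (@ring_center (residue_ring w)) p) :
  [/\ splittable w,
      (exists2 z0, parameter w z0 & conj_residue w z0 =1 id) ->
      exists i : int,
        [/\ forall (u : {rmorphism residue_ring w -> vring w}) (z : D),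
            embedding u -> parameter w z -> is_local_height u z i,
            coprimez i p%:Z -> good_splittable w
          & (p%:Z %| i)%Z ->
            (exists2 z, parameter w z & z ^+ p \in 'Z({:D})%VS) /\
            (forall E : {vspace D}, maximal_subfield E -> unramified w E ->
              cyclic_galois E)]
    & cyclic_division_algebra D p].
Proof.
have [onto [e e_gt0 w_e]] := w_ext.
have H : wild w p e by [].
have [[z0 pz0 triv]|nt] := pselect (exists2 z0, parameter w z0 & conj_residue w z0 =1 id).
  have [i [hi cyc]] := trivial_action_case H pz0 triv.
  by split=> //; [exact: (trivial_action_splittable H pz0 triv) | exists i].
have [z pz] := exists_param H.
have [spl cyc] : splittable w /\ cyclic_division_algebra D p.
  by apply: (nontrivial_action_case H pz) => triv; apply: nt; exists z.
by split=> // -[z0 pz0 triv]; case: nt; exists z0.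
Qed.
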